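(* Assume $\mathbb E[\tanh(h)]\ne0$ and that the global minimum of $$H(x)=\frac12x^2-\mathbb E[\log\cosh(\sqrt{\theta_1}x+h)]$$ has flatness $\tau$. Then the Agnostic Non-centered Test (described in the context, with suitably small constants $\delta,\tau_\delta>0$) is asymptotically powerful when 1. $k=O\left(n^{\frac{2\tau-1}{4\tau-3}}\right)$ and $m\gtrsim\log n$ (i.e. $m\ge C\log n$ for a sufficiently large constant $C$); 2. $k=\omega\left(n^{\frac{2\tau-1}{4\tau-3}}\right)$ and $m=\omega(1)$.
   Context: Planted random field Curie-Weiss (pRFCW) model. Let $\mu$ be a probability measure on $\mathbb R$ with $\int|h|\,d\mu<\infty$, $h\sim\mu$, $\theta_1>0$, $[n]=\{1,\dots,n\}$, and $h_1,\dots,h_n$ i.i.d. $\sim\mu$, $\boldsymbol h=(h_1,\dots,h_n)$. For $S\subset[n]$ with $|S|=k$ define, for $\boldsymbol\sigma\in\{-1,+1\}^n$, $$\mathbb P_S(\boldsymbol\sigma\mid\boldsymbol h)\propto\exp\Big(\frac{\theta_1}{2k}\sum_{i,j\in S}\sigma_i\sigma_j+\sum_{i=1}^n h_i\sigma_i\Big),\qquad \mathbb P_0(\boldsymbol\sigma\mid\boldsymbol h)\propto\exp\Big(\sum_{i=1}^n h_i\sigma_i\Big),$$ each normalized, and $\mathbb P_S(\boldsymbol\sigma)=\mathbb E_{\boldsymbol h}[\mathbb P_S(\boldsymbol\sigma\mid\boldsymbol h)]$, $\mathbb P_0(\boldsymbol\sigma)=\mathbb E_{\boldsymbol h}[\mathbb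 P_0(\boldsymbol\sigma\mid\boldsymbol h)]$. One observes i.i.d. samples $\boldsymbol\sigma^{(1)},\boldsymbol\sigma^{(2)},\dots$; $\mathbb P_{0,m}$, $\mathbb P_{S,m}$ are the $m$-fold products of $\mathbb P_0$, $\mathbb P_S$. Asymptotics: $k\to\infty$ with $n=n(k)\ge k$, $m=m(k)\ge1$; $\mu,\theta_1$ fixed. A sequence of tests $\psi$ ($\psi=1$ means reject the null) is asymptotically powerful if the sum of the null rejection probability and $\sup_{S:|S|=k}$ of the acceptance probability under clique $S$ tends to $0$: $$\lim_{k\to\infty}\Big[\mathbb P_{0,m}(\psi=1)+\sup_{S:|S|=k}\mathbb P_{S,m}(\psi=0)\Big]=0.$$ $a=\omega(b)$ means $b=o(a)$. Flatness: a local minimum $x^*$ of $H$ has flatness $\tau\in\mathbb N$, $\tau\ge1$, if $H(x)=H(x^* )+\frac{H^{(2\tau)}(x^* )}{(2\tau)!}(x-x^* )^{2\tau}+O((x-x^* )^{2\tau+1})$ as $x\to x^*$ with $H^{(2\tau)}(x^* )>0$. (Equivalently one may use $M\mapsto\frac{\theta_1M^2}{2}-\mathbb E[\log\cosh(\theta_1M+h)]$ with $x=\sqrt{\theta_1}M$.) Agnostic Non-centered Test. - In regime 1: for each $S\subset[n]$, $|S|=k$, compute $\phi_S=\frac{1}{mk}\sum_{j=1}^m\sum_{i\in S}\sigma_i^{(j)}$, and $\xi=\frac{1}{mn}\sum_{j=1}^m\sum_{i=1}^n\sigma_i^{(j)}$. Reject the null if $\sup_{S:|S|=k}\phi_S>\xi+\delta$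 or $\inf_{S:|S|=k}\phi_S<\xi-\delta$, for a small constant $\delta>0$. - In regime 2: using $m$ independent pairs of samples ($2m$ samples in total), compute $\phi_8=m^{-1}k^{-\frac{4\tau-3}{2\tau-1}}\sum_{j=1}^m\Big(\sum_{i=1}^n(\sigma_i^{(2j-1)}-\sigma_i^{(2j)})\Big)^2$. Reject the null if $\phi_8\ge\tau_\delta$ for a small constant $\tau_\delta>0$.
   Formalization: In regime 1 with τ = 1, the condition k = O(n) is strengthened to k ≤ cn eventually for a constant c < 1 (δ and C may depend on c), since for k = n the test never rejects; ''the global minimum'' is read as a unique global minimizer. *)

(* Defs.v *)
From HB Require Import structures.
From mathcomp Require Import all_boot all_order all_algebra.
From mathcomp Require Import all_classical all_reals all_analysis.
Import Order.TTheory GRing.Theory Num.Theory.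
Import numFieldNormedType.Exports.

Set Implicit Arguments.
Unset Strict Implicit.
Unset Printing Implicit Defensive.

Local Open Scope classical_set_scope.
Local Open Scope ring_scope.

Definition cosh (R : realType) (x : R) : R := (expR x + expR (- x)) / 2.
Definition tanh (R : realType) (x : R) : R :=
  (expR x - expR (- x)) / (expR x + expR (- x)).

Section IidLaw.
Context (R : realType) (mu : probability (measurableTypeR R) R).

Definition tuple_cons (n : nat)
    (p : measurableTypeR R * n.-tuple (measurableTypeR R)) :
  n.+1.-tuple (measurableTypeR R) := [the n.+1.-tuple _ of p.1 :: p.2].

Lemma measurable_tuple_cons (n : nat) :
  measurable_fun setT (@tuple_cons n).
Proof. exact: measurable_cons measurable_fst measurable_snd. Qed.

HB.instance Definition _ (n : nat) :=
  isMeasurableFun.Build _ _ _ _ (@tuple_cons n) (@measurable_tuple_cons n).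

(* [iid_law n] is the n-fold product of [mu], the law of (h_1, ..., h_n) *)
Fixpoint iid_law (n : nat) : probability (n.-tuple (measurableTypeR R)) R :=
  match n with
  | 0 => \d_ [tuple]
  | n'.+1 => distribution (mu \x iid_law n')%E (@tuple_cons n')
  end.

End IidLaw.

Definition config (n : nat) := {ffun 'I_n -> bool}.

Definition spin (R : realType) (b : bool) : R := if b then 1 else - 1.

Definition gibbs (R : realType) (n : nat) (energy : config n -> R)
    (s : config n) : R :=
  expR (energy s) / \sum_(s' : config n) expR (energy s').

Section Model.
Context (R : realType) (mu : probability (measurableTypeR R) R) (theta1 : R).
Context (n : nat).

Definition field_energy (h : n.-tuple R) (s : config n) : R :=
  \sum_(i < n) tnth h i * spin R (s i).

Definition clique_energy (S : {set 'I_n}) (h : n.-tuple R) (s : config n) : R :=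
  theta1 / (2 * #|S|%:R) * (\sum_(i in S) \sum_(j in S) spin R (s i) * spin R (s j))
  + field_energy h s.

Definition P0 (s : config n) : R :=
  (\int[iid_law mu n]_h gibbs (field_energy h) s)%R.

Definition PS (S : {set 'I_n}) (s : config n) : R :=
  (\int[iid_law mu n]_h gibbs (clique_energy S h) s)%R.

End Model.

Definition prod_prob (R : realType) (n N : nat) (p : config n -> R)
    (A : pred (N.-tuple (config n))) : R :=
  \sum_(s : N.-tuple (config n) | A s) \prod_(j < N) p (tnth s j).

(* [psi k] is a test based on [N k] samples of size [n k];
   [psi k s = true] means that the null is rejected *)
Definition asymptotically_powerful (R : realType)
    (mu : probability (measurableTypeR R) R) (theta1 : R) (n N : nat -> nat)
    (psi : forall k, pred ((N k).-tuple (config (n k)))) : Prop :=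
  (fun k : nat =>
     prod_prob (P0 mu (n := n k)) (psi k) +
     sup [set prod_prob (PS mu theta1 S) (predC (psi k))
         | S in [set S : {set 'I_(n k)} | #|S| = k]]) @ \oo --> (0 : R).

Arguments asymptotically_powerful {R} mu theta1 n N psi.

Definition free_energy (R : realType) (mu : probability (measurableTypeR R) R)
    (theta1 : R) (x : R) : R :=
  x ^+ 2 / 2 - (\int[mu]_h ln (cosh (Num.sqrt theta1 * x + h)))%R.

Definition has_flatness (R : realType) (H : R -> R) (xs : R) (tau : nat) : Prop :=
  [/\ (1 <= tau)%N,
      \forall x \near xs, H xs <= H x,
      0 < derive1n (2 * tau) H xs
    & (fun x : R => H x - (H xs +
          derive1n (2 * tau) H xs / (2 * tau)`!%:R * (x - xs) ^+ (2 * tau)))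
        =O_ xs (fun x : R => (x - xs) ^+ (2 * tau + 1))].

Section MeanTest.
Context (R : realType) (n m k : nat) (s : m.-tuple (config n)).

Definition clique_mean (S : {set 'I_n}) : R :=
  (m%:R * k%:R)^-1 * \sum_(j < m) \sum_(i in S) spin R (tnth s j i).

Definition overall_mean : R :=
  (m%:R * n%:R)^-1 * \sum_(j < m) \sum_(i < n) spin R (tnth s j i).

Definition mean_test (delta : R) : bool :=
  (sup [set clique_mean S | S in [set S : {set 'I_n} | #|S| = k]]
     > overall_mean + delta) ||
  (inf [set clique_mean S | S in [set S : {set 'I_n} | #|S| = k]]
     < overall_mean - delta).

End MeanTest.

Lemma pair_fst_subproof (m : nat) (j : 'I_m) : (2 * j < 2 * m)%N.
Proof. by rewrite ltn_mul2l /= ltn_ord. Qed.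

Lemma pair_snd_subproof (m : nat) (j : 'I_m) : ((2 * j).+1 < 2 * m)%N.
Proof. by rewrite -[(2 * m)%N]mulnC -[(2 * j)%N]mulnC !muln2 ltn_Sdouble. Qed.

(* the pair of samples 2j-1 and 2j, counted from 1 *)
Definition pair_fst (m : nat) (j : 'I_m) : 'I_(2 * m) :=
  Ordinal (pair_fst_subproof j).
Definition pair_snd (m : nat) (j : 'I_m) : 'I_(2 * m) :=
  Ordinal (pair_snd_subproof j).

Section PairTest.
Context (R : realType) (n m k tau : nat) (s : (2 * m).-tuple (config n)).

Definition phi8 : R :=
  m%:R^-1 * k%:R `^ (- ((4 * tau%:R - 3) / (2 * tau%:R - 1))) *
  \sum_(j < m) (\sum_(i < n) (spin R (tnth s (pair_fst j) i)
                              - spin R (tnth s (pair_snd j) i))) ^+ 2.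

Definition pair_test (tau_delta : R) : bool := tau_delta <= phi8.

End PairTest.

(* Main.v *)
Require Import Defs.
From mathcomp Require Import all_boot all_order all_algebra.
From mathcomp Require Import all_classical all_reals all_analysis.
From mathcomp Require Import measurable_realfun ring lra.
Import Order.TTheory GRing.Theory Num.Theory.
Import numFieldNormedType.Exports.

Local Open Scope classical_set_scope.
Local Open Scope ring_scope.

Set Implicit Arguments.
Unset Strict Implicit.
Unset Printing Implicit Defensive.

(** Given the field, [PS] is the Gibbs law of a Curie-Weiss model on the clique
    [S], together with independent spins outside of it. Write [X] for the sum
    of the clique spins, [k] for the size of [S], [x = sqrt theta1 * X / k] for
    the rescaled magnetization and [H] for the free energy.

    The energy [theta1 X ^ 2 / (2 k)] is the supremum over [y] of the linear
    energies [sqrt theta1 y X - k y ^ 2 / 2], for which spins are independent.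
    Hence, given the field, each value of [X] has probability at most the
    exponential of an i.i.d. sum of mean [- k (H x - H xs)]
    ([gibbs_level_le]), and [x] concentrates exponentially at [xs]
    ([scaled_mag_concentration]). The equation [H' xs = 0] says that
    [xs / sqrt theta1 = E tanh (sqrt theta1 xs + h)]. The right-hand side is
    strictly increasing in [xs], so that [E tanh h <> 0] forces [xs <> 0], and
    then the magnetization [xs / sqrt theta1] of the clique differs from the
    null mean [E tanh h] ([magnetization_separated]).

    In the first regime this gap survives in the comparison of the clique
    average with the overall average, since [k / n] stays below [c < 1]
    ([mean_test_miss]). Under the null all spins are independent, and a
    Chernoff bound beats the number [n ^ k] of cliques as soon as [m] is a
    large multiple of [log n] ([mean_test_null]).

    The second regime is empty for [tau = 1], where [n = o(k)] contradicts
    [k <= n]. Let [tau >= 2]. Expanding [tanh] around [xs] in the local fields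
    gives a mean-field equation for the force [G = k H'(x) / sqrt theta1]:
    [G = T + A + small] ([mean_field_expansion]). Here [T] sums the deviations
    of the clique spins from their conditional means; for each field it has
    mean zero and second moment [O(k)]. The disorder [A] is a centered i.i.d.
    sum depending on the field alone. As [|H' x|] grows like
    [|x - xs| ^ (2 tau - 1)], the quantity [k |x - xs| ^ (2 tau - 1)] is
    of order [sqrt k] in the mean square ([mag_power_moment]).

    This order is attained. The variance of [A] is [V0 * k] with [V0 > 0]: if
    [tanh (sqrt theta1 xs + h)] were constant, [H'' xs = H''' xs = 0] would
    force [xs = 0] ([tanh_variance_gt0]). So [E (G A) >= c k]
    ([force_disorder_correlation]), whereas the force of an independent copy is
    uncorrelated with [A]. The forces of two copies therefore differ by order
    [sqrt k] with non-vanishing probability, and so do their magnetizations at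
    the corresponding scale ([two_copy_separation]). The normalization of the
    statistic is adapted to this scale, and the spins outside the clique
    disturb it by [n k ^ (- (4 tau - 3) / (2 tau - 1))], which tends to zero
    exactly in the second regime. Thus [E exp (- kappa D ^ 2)], with [D] the
    difference of the sums of two samples and [kappa] the normalization, is at
    most [exp (- w)] with [w > 0] ([pair_statistic_separation]), and by
    independence a miss over [m] pairs has probability at most
    [exp (m (tau_delta - w))] ([pair_test_miss]). Under the null the mean of
    the statistic tends to zero ([pair_test_null]). *)

(** * Bounded measurable functions of an i.i.d. field *)

(** Observables of finitely many spins are bounded, and this class is closed
    under the operations that build them, which settles their integrability. *)
Definition bounded_mfun {d} {T : measurableType d} {R : realType} (f : T -> R) : Prop :=
  measurable_fun setT f /\ exists M, forall x, `|f x| <= M.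

Section bounded_measurable.
Context {d} {T : measurableType d} {R : realType}.
Implicit Types (f g : T -> R).

Lemma bm_cst (c : R) : bounded_mfun (fun _ : T => c).
Proof. by split; [exact: measurable_cst|exists `|c|]. Qed.

Lemma bmD {f g} : bounded_mfun f -> bounded_mfun g -> bounded_mfun (fun x => f x + g x).
Proof.
move=> [mf [M hM]] [mg [N hN]]; split; first exact: measurable_funD.
by exists (M + N) => x; rewrite (le_trans (ler_normD _ _))// lerD.
Qed.

Lemma bmM {f g} : bounded_mfun f -> bounded_mfun g -> bounded_mfun (fun x => f x * g x).
Proof.
move=> [mf [M hM]] [mg [N hN]]; split; first exact: measurable_funM.
by exists (M * N) => x; rewrite normrM ler_pM.
Qed.

Lemma bmZ (c : R) {f} : bounded_mfun f -> bounded_mfun (fun x => c * f x).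
Proof. by move=> bf; apply: bmM (bm_cst c) bf. Qed.

Lemma bmN {f} : bounded_mfun f -> bounded_mfun (fun x => - f x).
Proof.
move=> bf; have := bmZ (-1) bf; congr bounded_mfun.
by apply/funext => x; rewrite mulN1r.
Qed.

Lemma bmB {f g} : bounded_mfun f -> bounded_mfun g -> bounded_mfun (fun x => f x - g x).
Proof. by move=> bf bg; exact: bmD bf (bmN bg). Qed.

Lemma bmX {f} n : bounded_mfun f -> bounded_mfun (fun x => f x ^+ n).
Proof.
move=> bf; elim: n => [|n IH].
  by have := bm_cst 1; congr bounded_mfun; apply/funext => x; rewrite expr0.
have := bmM bf IH; congr bounded_mfun; apply/funext => x; by rewrite exprS.
Qed.

Lemma bm_norm {f} : bounded_mfun f -> bounded_mfun (fun x => `|f x|).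
Proof.
move=> [mf [M hM]]; split; first exact: measurableT_comp.
by exists M => x; rewrite normr_id.
Qed.

Lemma bm_sum (I : Type) (r : seq I) (p : pred I) (F : I -> T -> R) :
  (forall i, p i -> bounded_mfun (F i)) -> bounded_mfun (fun x => \sum_(i <- r | p i) F i x).
Proof.
move=> bF; elim: r => [|i r IH].
  by have := bm_cst 0; congr bounded_mfun; apply/funext => x; rewrite big_nil.
case pi: (p i); last first.
  by move: IH; congr bounded_mfun; apply/funext => x; rewrite big_cons pi.
have := bmD (bF i pi) IH; congr bounded_mfun; apply/funext => x; by rewrite big_cons pi.
Qed.

Lemma bm_prod (I : Type) (r : seq I) (p : pred I) (F : I -> T -> R) :
  (forall i, p i -> bounded_mfun (F i)) -> bounded_mfun (fun x => \prod_(i <- r | p i) F i x).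
Proof.
move=> bF; elim: r => [|i r IH].
  by have := bm_cst 1; congr bounded_mfun; apply/funext => x; rewrite big_nil.
case pi: (p i); last first.
  by move: IH; congr bounded_mfun; apply/funext => x; rewrite big_cons pi.
have := bmM (bF i pi) IH; congr bounded_mfun; apply/funext => x; by rewrite big_cons pi.
Qed.

Lemma bm_comp_continuous {f} (g : R -> R) (C : R) :
  continuous g -> (forall x, `|g x| <= C) -> measurable_fun setT f ->
  bounded_mfun (fun x => g (f x)).
Proof.
move=> cg gC mf; split; last by exists C => x.
by apply: measurableT_comp => //; exact: continuous_measurable_fun.
Qed.

Lemma bm_expR {f} : bounded_mfun f -> bounded_mfun (fun x => expR (f x)).
Proof.
move=> [mf [M hM]]; split; first exact: measurableT_comp.
exists (expR M) => x; rewrite ger0_norm ?expR_ge0// ler_expR.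
by rewrite (le_trans (ler_norm _)).
Qed.

Variable P : probability T R.

Lemma bm_integrable {f} : bounded_mfun f -> P.-integrable setT (EFin \o f).
Proof.
move=> [mf [M hM]]; apply: measurable_bounded_integrable => //.
- by rewrite [X in (X < _)%E]probability_setT ltry.
- exists M; split; first by rewrite num_real.
  by move=> x Mx y _ /=; rewrite (le_trans (hM y))// ltW.
Qed.

Lemma Rint_cst (c : R) : (\int[P]_x c)%R = c.
Proof. by rewrite Rintegral_cst// [fine _](_ : _ = 1) ?mulr1// [X in fine X]probability_setT. Qed.

Lemma RintD {f g} : bounded_mfun f -> bounded_mfun g ->
  (\int[P]_x (f x + g x) = \int[P]_x f x + \int[P]_x g x)%R.
Proof. by move=> bf bg; rewrite RintegralD//; exact: bm_integrable. Qed.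

Lemma RintB {f g} : bounded_mfun f -> bounded_mfun g ->
  (\int[P]_x (f x - g x) = \int[P]_x f x - \int[P]_x g x)%R.
Proof. by move=> bf bg; rewrite RintegralB//; exact: bm_integrable. Qed.

Lemma RintZ (c : R) {f} : bounded_mfun f -> (\int[P]_x (c * f x) = c * \int[P]_x f x)%R.
Proof. by move=> bf; rewrite RintegralZl//; exact: bm_integrable. Qed.

Lemma le_Rint {f g} : bounded_mfun f -> bounded_mfun g -> (forall x, f x <= g x) ->
  (\int[P]_x f x <= \int[P]_x g x)%R.
Proof. by move=> bf bg fg; apply: le_Rintegral => //; exact: bm_integrable. Qed.

Lemma Rint_sum (I : Type) (r : seq I) (p : pred I) (F : I -> T -> R) :
  (forall i, p i -> bounded_mfun (F i)) ->
  (\int[P]_x \sum_(i <- r | p i) F i x = \sum_(i <- r | p i) \int[P]_x F i x)%R.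
Proof.
move=> bF; elim: r => [|i r IH].
  rewrite big_nil -[RHS]Rint_cst; congr Rintegral; apply/funext => x; by rewrite big_nil.
rewrite big_cons; case pi: (p i); last first.
  rewrite -IH; congr Rintegral; apply/funext => x; by rewrite big_cons pi.
rewrite -IH -RintD; [|exact: bF|exact: bm_sum].
by congr Rintegral; apply/funext => x; rewrite big_cons pi.
Qed.

Lemma Rint_norm_le {f} (M : R) : bounded_mfun f -> (forall x, `|f x| <= M) ->
  `|(\int[P]_x f x)%R| <= M.
Proof.
move=> bf fM; rewrite (le_trans (le_normr_Rintegral _ (bm_integrable bf)))//.
by rewrite -[leRHS]Rint_cst; apply: le_Rint => //; [exact: bm_norm|exact: bm_cst].
Qed.

End bounded_measurable.

(** An integral that vanishes would make the function vanish almost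
    everywhere, hence the whole space negligible. *)
Lemma Rint_gt0 {d} {T : measurableType d} {R : realType} (P : probability T R)
  (f : T -> R) : bounded_mfun f -> (forall x, 0 < f x) -> 0 < (\int[P]_x f x)%R.
Proof.
move=> bf f0; rewrite lt_def Rintegral_ge0 ?andbT; last by move=> x _; exact: ltW.
apply/eqP => If0.
have fi := bm_integrable P bf.
have : (\int[P]_(x in setT) `|(EFin \o f) x| = 0)%E.
  under eq_integral do rewrite /= ger0_norm ?(ltW (f0 _))//.
  have := integrable_fin_num measurableT fi.
  by move/fineK => <-; rewrite -/(Rintegral P setT f) If0.
have mf : measurable_fun setT (EFin \o f) by apply/measurable_EFinP; case: bf.
move/(ae_eq_integral_abs P measurableT mf).1 => [N [mN N0 sN]].
have : P setT = 0%E.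
  apply/eqP; rewrite eq_le measure_ge0 andbT -N0 le_measure ?inE//.
  move=> x _; apply: sN => /= /(_ I) [] fx0; have := f0 x; by rewrite fx0 ltxx.
by rewrite probability_setT => /eqP; rewrite onee_eq0.
Qed.

Section iid_product.
Context {R : realType} (mu : probability (measurableTypeR R) R).

Lemma bm_tnth {n} (i : 'I_n) (f : measurableTypeR R -> R) : bounded_mfun f ->
  bounded_mfun (fun h : n.-tuple (measurableTypeR R) => f (tnth h i)).
Proof.
move=> [mf [M hM]]; split; last by exists M => x.
by apply: measurableT_comp => //; exact: measurable_tnth.
Qed.

(** Peel off one coordinate and use Fubini. Expectations of products of
    bounded functions of single coordinates are the form in which the
    independence of the field is used. *)
Lemma Rint_iid_prod (n : nat) (f : 'I_n -> measurableTypeR R -> R) :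
  (forall i, bounded_mfun (f i)) ->
  (\int[iid_law mu n]_h \prod_(i < n) f i (tnth h i) =
   \prod_(i < n) \int[mu]_x f i x)%R.
Proof.
elim: n f => [|n IH] f bf.
  rewrite big_ord0 -[RHS](Rint_cst (iid_law mu 0)).
  by congr Rintegral; apply/funext => h; rewrite big_ord0.
rewrite big_ord_recl -IH; last by move=> i; exact: bf.
set F := fun h : n.-tuple (measurableTypeR R) => _.
have bF : bounded_mfun F by apply: bm_prod => i _; apply: bm_tnth.
set G := fun h : n.+1.-tuple (measurableTypeR R) => _.
have bG : bounded_mfun G by apply: bm_prod => i _; apply: bm_tnth.
have cG : G \o @tuple_cons R n = fun p => f ord0 p.1 * F p.2.
  apply/funext => -[x h] /=; rewrite /G /F big_ord_recl /=; congr (_ * _).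
  by apply: eq_bigr => i _; rewrite tnthS.
rewrite /Rintegral /= integral_distribution/=; last 2 first.
- by apply/measurable_EFinP; case: bG.
- have : bounded_mfun (G \o @tuple_cons R n).
    case: bG => mG [M hM]; split; last by exists M => x; exact: hM.
    by apply: measurableT_comp => //; exact: measurable_tuple_cons.
  by move/bm_integrable.
rewrite [X in integral _ _ X](_ : _ = fun p => (f ord0 p.1 * F p.2)%:E); last first.
  by apply/funext => p; rewrite /= -[G _]/((G \o @tuple_cons R n) p) cG.
rewrite -integral12_prod_meas1; last first.
  have b2 : bounded_mfun (fun p : measurableTypeR R * n.-tuple (measurableTypeR R) => f ord0 p.1 * F p.2).
    have [[mf [M hM]] [mF [N hN]]] := (bf ord0, bF).
    apply: bmM; split.
    - by apply: measurableT_comp => //.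
    - by exists M => x; exact: hM.
    - by apply: measurableT_comp => //.
    - by exists N => x; exact: hN.
  exact: (bm_integrable _ b2).
rewrite -/(Rintegral _ _ _) -/(Rintegral _ _ _).
rewrite mulrC -RintegralZl//; last exact/bm_integrable.
congr fine; apply: eq_integral => x _ /=.
rewrite /fubini_F /=.
under eq_integral do rewrite EFinM.
rewrite integralZl//; last exact/bm_integrable.
rewrite muleC [in RHS]EFinM; congr (_ * _)%E.
rewrite /Rintegral fineK//; apply: integrable_fin_num => //.
exact/bm_integrable.
Qed.

End iid_product.

(** * Elementary inequalities *)

Lemma le_of_eq {R : realType} (x y : R) : x = y -> x <= y.
Proof. by move=> ->. Qed.

Section real_lemmas.
Context {R : realType}.
Implicit Types (x y z a b : R).

Lemma expR_le_quadratic y : y <= 1 / 2 -> expR y <= 1 + y + 2 * y ^+ 2.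
Proof.
move=> y2.
have h : expR (- y) * (1 + y + 2 * y ^+ 2) >= 1.
  have q0 : 0 <= 1 + y + 2 * y ^+ 2 by nra.
  have := ler_wpM2r q0 (expR_ge1Dx (- y)).
  apply: le_trans; have : 0 <= y ^+ 2 * (1 - 2 * y) by apply: mulr_ge0; [exact: sqr_ge0|lra].
  rewrite !exprS expr0; lra.
have -> : expR y = expR y * 1 by rewrite mulr1.
apply: (le_trans (ler_wpM2l (expR_ge0 y) h)).
by rewrite mulrA -expRD subrr expR0 mul1r.
Qed.

Lemma expr4_le_expR y : y ^+ 4 <= 256 * (expR y + expR (- y)).
Proof.
wlog y0 : y / 0 <= y.
  move=> H; have [/H//|/ltW y0] := leP 0 y.
  by have := H (- y); rewrite oppr_ge0 opprK addrC (exprNn y 4) -signr_odd expr0 mul1r; apply.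
(* [expR y = expR (y / 4) ^+ 4], whence the constant [4 ^ 4] *)
have h : (y / 4) ^+ 4 <= expR y.
  have -> : expR y = expR (y / 4) ^+ 4.
    by rewrite -expRM_natl; congr expR; lra.
  rewrite ler_pXn2r ?nnegrE ?expR_ge0//; last by rewrite divr_ge0.
  by have := expR_ge1Dx (y / 4); lra.
have := expR_ge0 (- y).
move: h; rewrite expr_div_n; have -> : (4 : R) ^+ 4 = 256 by rewrite -natrX.
by rewrite ler_pdivrMr//; lra.
Qed.

Lemma mvt_between (f df : R -> R) :
  (forall x, is_derive x 1 f (df x)) ->
  forall x y, exists2 c, `|c - x| <= `|y - x| & f y - f x = df c * (y - x).
Proof.
move=> fdf x y.
have cf z : {for z, continuous f}.
  by apply/differentiable_continuous/derivable1_diffP; case: (fdf z).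
have [xy|yx] := leP x y.
  have [c] := MVT_segment xy (fun z _ => fdf z) (continuous_subspaceT cf).
  rewrite in_itv /= => /andP[xc cy] e; exists c => //.
  by rewrite !ger0_norm ?subr_ge0// lerB.
have [c] := MVT_segment (ltW yx) (fun z _ => fdf z) (continuous_subspaceT cf).
rewrite in_itv /= => /andP[yc cx] e; exists c; last by rewrite -[LHS]opprB e; ring.
rewrite ler0_norm ?subr_le0// ler0_norm; last by rewrite subr_le0 ltW.
by lra.
Qed.

Lemma lipschitz_of_derive (f df : R -> R) (B : R) :
  (forall x, is_derive x 1 f (df x)) -> (forall x, `|df x| <= B) ->
  forall x y, `|f y - f x| <= B * `|y - x|.
Proof.
move=> fdf dfB x y; have [c _ ->] := mvt_between fdf x y.
by rewrite normrM ler_wpM2r.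
Qed.

Lemma quadratic_of_derive (f df ddf : R -> R) (B : R) :
  (forall x, is_derive x 1 f (df x)) -> (forall x, is_derive x 1 df (ddf x)) ->
  (forall x, `|ddf x| <= B) ->
  forall x d, `|f (x + d) - f x - d * df x| <= B * d ^+ 2.
Proof.
move=> fdf dfd ddB x d.
have B0 : 0 <= B by apply: le_trans (ddB 0).
have [c] := mvt_between fdf x (x + d).
rewrite (_ : x + d - x = d); last by ring.
move=> hc ->.
have -> : df c * d - d * df x = (df c - df x) * d by ring.
rewrite normrM; apply: le_trans (_ : (B * `|c - x|) * `|d| <= _).
  by rewrite ler_wpM2r//; exact: lipschitz_of_derive dfd ddB _ _.
by rewrite -mulrA ler_wpM2l// -real_normK ?num_real// expr2 ler_wpM2r.
Qed.

Lemma is_derive_of_quadratic (f : R -> R) (x l C : R) :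
  (forall d, `|f (x + d) - f x - d * l| <= C * d ^+ 2) -> is_derive x 1 f l.
Proof.
move=> H.
have C0 : 0 <= C.
  have := H 1; rewrite expr1n mulr1; apply: le_trans; exact: normr_ge0.
have cv : h^-1 *: (f (h *: 1 + x) - f x) @[h --> (0 : R)^'] --> l.
  apply/cvgrPdist_le => e e0; near=> h.
  have h0 : h != 0 by near: h; exact: nbhs_dnbhs_neq.
  have -> : l - h^-1 *: (f (h *: 1 + x) - f x) = - (h^-1 * (f (x + h) - f x - h * l)).
    rewrite /GRing.scale /= mulr1 [h + x]addrC; field; exact: h0.
  rewrite normrN normrM normfV ler_pdivrMl ?normr_gt0//.
  apply: le_trans (H h) _.
  rewrite -real_normK ?num_real// expr2 mulrA mulrC ler_wpM2l//.
  have he : `|h| < e / (C + 1).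
    near: h; apply: dnbhs0_lt; apply: divr_gt0 => //; lra.
  have : C * `|h| <= (C + 1) * (e / (C + 1)).
    by apply: ler_pM => //; [lra|exact: ltW].
  have C1 : C + 1 != 0 by rewrite gt_eqF// ltr_wpDl.
  by rewrite (_ : (C + 1) * (e / (C + 1)) = e) ?[`|h| * C]mulrC//; field.
apply: DeriveDef; first by apply/cvg_ex; exists l.
exact/cvg_lim.
Unshelve. all: by end_near. Qed.

(** Induction on the order: the derivative of the remainder is the remainder
    of the shifted tower, and the mean value theorem integrates the bound.
    This loses the factorial in the remainder, but applies to any sequence of
    functions each of which differentiates to the next. *)
Lemma taylor_tower (N : nat) (f : nat -> R -> R) (B a : R) :
  (forall j x, is_derive x 1 (f j) (f j.+1 x)) ->
  (forall x, `|f N x| <= B) ->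
  forall x, `|f 0%N x - \sum_(j < N) f j a / j`!%:R * (x - a) ^+ j|
            <= B * `|x - a| ^+ N.
Proof.
elim: N f => [|N IH] f fd fB x.
  by rewrite big_ord0 subr0 expr0 mulr1.
have B0 : 0 <= B by apply: le_trans (fB 0).
pose g y := f 0%N y - \sum_(j < N.+1) f j a / j`!%:R * (y - a) ^+ j.
pose dg y := f 1%N y - \sum_(j < N) f j.+1 a / j`!%:R * (y - a) ^+ j.
have gd y : is_derive y 1 g (dg y).
  rewrite /g; have -> : (fun y => f 0%N y - \sum_(j < N.+1) f j a / j`!%:R * (y - a) ^+ j)
     = f 0%N - (\sum_(j < N.+1) (fun y => f j a / j`!%:R * (y - a) ^+ j)).
    by apply/funext => z; rewrite fctE fct_sumE.
  have -> : dg y = f 1%N y - \sum_(j < N.+1) (f j a / j`!%:R * (j%:R * (y - a) ^+ j.-1)).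
    rewrite /dg; congr (_ - _); rewrite big_ord_recl /= mul0r mulr0 add0r.
    apply: eq_bigr => j _; rewrite /bump /= add1n factS natrM.
    field; rewrite pnatr_eq0 -lt0n fact_gt0 /=; by rewrite (_ : 1 + j%:R = j.+1%:R) ?pnatr_eq0// -natr1 addrC.
  apply: is_deriveB.
  apply: is_derive_sum => j.
  have -> : (fun y => f j a / j`!%:R * (y - a) ^+ j) = (f j a / j`!%:R) *: (fun y => (y - a)) ^+ j.
    by apply/funext => z; rewrite fctE.
  have d1 : is_derive y 1 (fun y => y - a) 1.
    have -> : (fun y => y - a) = id - cst a by [].
    by apply: is_derive_eq; rewrite subr0.
  apply: is_derive_eq; rewrite /GRing.scale /= mulr1 mulr_natl.
  done.
have dgB y : `|dg y| <= B * `|y - a| ^+ N.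
  by apply: (IH (fun j => f j.+1)).
have ga : g a = 0.
  rewrite /g big_ord_recl /= expr0 fact0 divr1 mulr1 big1 ?addr0 ?subrr// => j _.
  by rewrite /bump /= add1n expr0n /= mulr0.
have [c hc gxa] := mvt_between gd a x.
rewrite -/(g x) -[g x]subr0 -ga gxa normrM exprSr mulrA ler_wpM2r//.
apply: (le_trans (dgB c)); rewrite ler_wpM2l//.
by apply: lerXn2r; rewrite ?nnegrE.
Qed.

End real_lemmas.

(** From [b (k + 1) <= expR (b (k + 1))] with [b = a / m], raised to the power
    [m]. *)
Lemma poly_expR_bounded {R : realType} (a : R) (m : nat) : 0 < a ->
  exists2 C : R, 0 < C & forall k : nat, k.+1%:R ^+ m * expR (- a * k%:R) <= C.
Proof.
move=> a0; case: m => [|m].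
  by exists 1 => // k; rewrite expr0 mul1r -expR0 ler_expR mulNr oppr_le0 mulr_ge0// ltW.
pose b := a / m.+1%:R; have b0 : 0 < b by rewrite divr_gt0.
exists (expR a / b ^+ m.+1); first by rewrite divr_gt0 ?expR_gt0 ?exprn_gt0.
move=> k; rewrite ler_pdivlMr ?exprn_gt0// mulrAC -exprMn.
have h : (k.+1%:R * b) ^+ m.+1 <= expR (a * k.+1%:R).
  have -> : a * k.+1%:R = m.+1%:R * (k.+1%:R * b).
    have M0 : m.+1%:R != 0 :> R by rewrite pnatr_eq0.
    by rewrite /b; move: (m.+1%:R : R) M0 => M M0; field.
  have kb0 : 0 <= k.+1%:R * b by rewrite mulr_ge0// ltW.
  rewrite expRM_natl; apply: lerXn2r; rewrite ?nnegrE ?expR_ge0//.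
  by have := expR_ge1Dx (k.+1%:R * b); lra.
apply: (le_trans (ler_wpM2r (expR_ge0 _) h)).
by rewrite -expRD ler_expR -natr1; lra.
Qed.

Lemma poly_expR_small {R : realType} (a e : R) (m : nat) : 0 < a -> 0 < e ->
  exists k0, forall k : nat, (k0 <= k)%N -> k.+1%:R ^+ m * expR (- a * k%:R) <= e.
Proof.
move=> a0 e0; have [C C0 hC] := poly_expR_bounded m.+1 a0.
exists (Num.trunc (C / e)) => k hk.
have k1 : C / e <= k.+1%:R.
  by rewrite (le_trans (ltW (truncnS_gt _)))// ler_nat ltnS.
have := hC k; rewrite exprS -mulrA => h.
rewrite ler_pdivrMr// in k1.
have : k.+1%:R * (k.+1%:R ^+ m * expR (- a * k%:R)) <= k.+1%:R * e by exact: le_trans h k1.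
by rewrite ler_pM2l.
Qed.

Lemma sqr_sum_le {R : realType} (p : nat) (a : 'I_p -> R) :
  (\sum_j `|a j|) ^+ 2 <= p%:R * \sum_j a j ^+ 2.
Proof.
rewrite expr2 mulr_suml.
apply: (@le_trans _ _ (\sum_(i < p) \sum_(j < p) (a i ^+ 2 / 2 + a j ^+ 2 / 2))).
  apply: ler_sum => i _; rewrite mulr_sumr; apply: ler_sum => j _.
  rewrite -[a i ^+ 2]real_normK ?num_real// -[a j ^+ 2]real_normK ?num_real//.
  by have := sqr_ge0 (`|a i| - `|a j|); lra.
under eq_bigr do rewrite big_split /= sumr_const card_ord -mulr_suml -[_ *+ p]mulr_natl.
rewrite big_split /= sumr_const card_ord -mulr_sumr -[_ *+ p]mulr_natl -mulr_suml.
lra.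
Qed.

Lemma trinomial_power_le {R : realType} (m : nat) (a b : R) : 0 <= a -> 0 <= b ->
  (1 + a + b) ^+ m <= 3 ^+ m * (1 + a ^+ m + b ^+ m).
Proof.
move=> a0 b0; pose M := Num.max 1 (Num.max a b).
have M0 : 0 <= M by rewrite le_max ler01.
have h : 1 + a + b <= 3 * M.
  have : 1 <= M by rewrite le_max lexx.
  have : a <= M by rewrite !le_max lexx !orbT.
  have : b <= M by rewrite !le_max lexx !orbT.
  lra.
apply: (@le_trans _ _ ((3 * M) ^+ m)).
  by apply: lerXn2r => //; rewrite nnegrE ?mulr_ge0// !addr_ge0.
rewrite exprMn ler_wpM2l ?exprn_ge0//.
have am : 0 <= a ^+ m by rewrite exprn_ge0.
have bm' : 0 <= b ^+ m by rewrite exprn_ge0.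
rewrite /M /Order.max; case: ifP => _; last by rewrite expr1n -addrA lerDl addr_ge0.
by case: ifP => _; lra.
Qed.

(** From [expR (- y) <= 1 / (1 + y)]. *)
Lemma expRN_le_min {R : realType} (y : R) : 0 <= y ->
  expR (- y) <= 1 - Num.min y 1 / 2.
Proof.
move=> y0; have y1 : 0 < 1 + y by lra.
have h : expR (- y) <= (1 + y)^-1.
  by rewrite expRN lef_pV2 ?posrE ?expR_gt0// expR_ge1Dx.
apply: (le_trans h); rewrite -[leLHS]mul1r ler_pdivrMr// /Order.min.
by case: ifP => [|/negbT]; [|rewrite -leNgt]; nra.
Qed.

Lemma bin_le_exp n k : ('C(n, k) <= n ^ k)%N.
Proof.
elim: n k => [|n IH] [|k]; rewrite ?bin0 ?expn0//.
rewrite binS (leq_trans (leq_add (IH k.+1) (IH k)))//.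
rewrite [(n ^ k.+1)%N]expnS -mulSnr expnS leq_mul//.
by case: k => // k; rewrite leq_exp2r.
Qed.

(** * The hyperbolic tangent *)

Section tanh_theory.
Context {R : realType}.
Implicit Types (x y z : R).

Lemma cosh_gt0 x : 0 < cosh x.
Proof. by rewrite /cosh divr_gt0// addr_gt0 ?expR_gt0. Qed.

Lemma is_derive_expRN x : is_derive x 1 (fun y : R => expR (- y)) (- expR (- x)).
Proof.
have := is_derive1_comp (is_derive_expR (- x)) (is_deriveNid x (1 : R)).
by rewrite mulrN1.
Qed.

Lemma is_derive_cosh x : is_derive x 1 (@cosh R) ((expR x - expR (- x)) / 2).
Proof.
have -> : @cosh R = (2^-1 : R) *: (expR + (fun y => expR (- y))).
  by apply/funext => y; rewrite /cosh fctE mulrC.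
have := is_derive_expRN x => ?.
by apply: is_derive_eq; rewrite /GRing.scale /= mulrC.
Qed.

Lemma is_derive_lncosh x : is_derive x 1 (fun y => ln (cosh y)) (tanh x).
Proof.
have h := is_derive_cosh x.
have := @is_derive1_comp R (@ln R) (@cosh R) x _ _ (is_derive1_ln (cosh_gt0 x)) h.
move/is_derive_eq; apply; rewrite /tanh /cosh.
field; rewrite gt_eqF//; apply: addr_gt0; exact: expR_gt0.
Qed.

Lemma is_derive_tanh x : is_derive x 1 (@tanh R) (1 - tanh x ^+ 2).
Proof.
have -> : @tanh R = (fun y => (cosh y)^-1) * ((2^-1 : R) *: (expR - (fun y => expR (- y)))).
  apply/funext => y; rewrite /tanh /cosh !fctE /GRing.scale /=.
  field; rewrite gt_eqF//; apply: addr_gt0; exact: expR_gt0.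
have h1 := is_derive_expRN x; have h2 := is_derive_cosh x.
have h3 := is_deriveV (lt0r_neq0 (cosh_gt0 x)) h2.
apply: is_derive_eq; rewrite /GRing.scale /= !fctE /tanh /cosh /GRing.scale /=.
set a := expR x; set b := expR (- x); have -> : (2^-1 : R) *: (a - b) = 2^-1 * (a - b) by [].
field; rewrite gt_eqF//; apply: addr_gt0; exact: expR_gt0.
Qed.

Lemma norm_tanh_lt1 x : `|tanh x| < 1.
Proof.
have [p0 n0] := (expR_gt0 x, expR_gt0 (- x)).
have d0 : 0 < expR x + expR (- x) by exact: addr_gt0.
by rewrite /tanh ltr_norml ltr_pdivrMr// ltr_pdivlMr//; apply/andP; split; lra.
Qed.

Lemma norm_tanh_le1 x : `|tanh x| <= 1.
Proof. exact/ltW/norm_tanh_lt1. Qed.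

Lemma sqr_tanh_lt1 x : tanh x ^+ 2 < 1.
Proof. by rewrite -real_normK ?num_real// expr_lt1 ?norm_tanh_lt1. Qed.

Lemma tanh_lipschitz x y : `|tanh y - tanh x| <= `|y - x|.
Proof.
rewrite -[leRHS]mul1r.
apply: (lipschitz_of_derive is_derive_tanh) => z.
have := sqr_tanh_lt1 z; have := sqr_ge0 (tanh z) => h0 h1.
by rewrite ger0_norm; lra.
Qed.

Lemma tanh_increasing x y : x < y -> tanh x < tanh y.
Proof.
move=> xy; have [c _ e] := mvt_between is_derive_tanh x y.
by rewrite -subr_gt0 e mulr_gt0 ?subr_gt0//; exact: sqr_tanh_lt1.
Qed.

Lemma continuous_tanh : continuous (@tanh R).
Proof.
by move=> x; apply/differentiable_continuous/derivable1_diffP; case: (is_derive_tanh x).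
Qed.

Lemma lncosh_lipschitz x y : `|ln (cosh y) - ln (cosh x)| <= `|y - x|.
Proof.
rewrite -[leRHS]mul1r.
by apply: (lipschitz_of_derive is_derive_lncosh) => z; exact: norm_tanh_le1.
Qed.

Lemma lncosh0 : ln (cosh (0 : R)) = 0.
Proof. by rewrite /cosh oppr0 expR0 (_ : (1 + 1) / 2 = 1) ?ln1//; lra. Qed.

Lemma norm_lncosh_le x : `|ln (cosh x)| <= `|x|.
Proof. by have := lncosh_lipschitz 0 x; rewrite lncosh0 !subr0. Qed.

(** The derivatives of [tanh] are polynomials in [tanh], because
    [tanh' = 1 - tanh ^ 2]; this operator is the derivation it induces. *)
Definition dtanh (p : {poly R}) : {poly R} := p^`() * (1 - 'X^2).

Lemma is_derive_poly_tanh (p : {poly R}) x :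
  is_derive x 1 (fun y => p.[tanh y]) (dtanh p).[tanh x].
Proof.
have h := is_derive_tanh x.
have := @is_derive1_comp R (horner p) (@tanh R) x _ _ (is_derive_poly p (tanh x)) h.
by move/is_derive_eq; apply; rewrite /dtanh !hornerE.
Qed.

Lemma poly_tanh_bounded (p : {poly R}) : exists B, forall x, `|p.[tanh x]| <= B.
Proof.
exists (\sum_(i < size p) `|p`_i|) => x.
rewrite horner_coef (le_trans (ler_norm_sum _ _ _))// ler_sum// => i _.
by rewrite normrM normrX ler_piMr// exprn_ile1// norm_tanh_le1.
Qed.

Lemma continuous_poly_tanh (p : {poly R}) : continuous (fun y => p.[tanh y]).
Proof.
move=> x; apply/differentiable_continuous/derivable1_diffP.
by case: (is_derive_poly_tanh p x).
Qed.

End tanh_theory.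

(** * Derivatives of the free energy *)

Section real_integrable.
Context {d} {T : measurableType d} {R : realType}.
Variable mu : {measure set T -> \bar R}.
Implicit Types (f g : T -> R).

Local Notation integrable f := (mu.-integrable setT (EFin \o f)).

Lemma rintegrableD f g : integrable f -> integrable g ->
  integrable (fun x => f x + g x).
Proof.
move=> fi gi; exact: (integrableD measurableT fi gi).
Qed.

Lemma rintegrableZ (c : R) f : integrable f -> integrable (fun x => c * f x).
Proof.
move=> fi; exact: (integrableZl measurableT c fi).
Qed.

Lemma rintegrableB f g : integrable f -> integrable g ->
  integrable (fun x => f x - g x).
Proof.
move=> fi gi; exact: (integrableB measurableT fi gi).
Qed.

End real_integrable.

Section smoothing.
Context {R : realType} (mu : probability (measurableTypeR R) R).

Lemma measurable_translate (a : R) :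
  measurable_fun setT (fun h : measurableTypeR R => a + h : measurableTypeR R).
Proof. by apply: measurable_funD => //; exact: measurable_cst. Qed.

Lemma bm_translate (f : R -> R) (C a : R) : continuous f ->
  (forall x, `|f x| <= C) -> bounded_mfun (fun h : measurableTypeR R => f (a + h)).
Proof. by move=> cf fC; exact: (bm_comp_continuous cf fC (measurable_translate a)). Qed.

Lemma bm_poly_tanh (p : {poly R}) (a : R) :
  bounded_mfun (fun h : measurableTypeR R => p.[tanh (a + h)]).
Proof.
have [B pB] := poly_tanh_bounded p.
exact: (bm_translate a (continuous_poly_tanh (p := p)) pB).
Qed.

(** A bounded second derivative makes the first-order remainder quadratic in
    the increment, uniformly in [h]; integrating this remainder gives the
    derivative of the integral. *)
Lemma is_derive_smoothing (f df ddf : R -> R) (s B : R) :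
  (forall x : R, is_derive x 1 f (df x)) -> (forall x : R, is_derive x 1 df (ddf x)) ->
  (forall x, `|ddf x| <= B) ->
  (forall a, mu.-integrable setT (EFin \o (fun h => f (a + h)))) ->
  (forall a, mu.-integrable setT (EFin \o (fun h => df (a + h)))) ->
  forall x : R, is_derive x 1 (fun x => (\int[mu]_h f (s * x + h))%R)
                          (s * (\int[mu]_h df (s * x + h))%R).
Proof.
move=> fd dfd ddB fi dfi x; apply: (@is_derive_of_quadratic _ _ _ _ (B * s ^+ 2)) => d.
have q h := quadratic_of_derive fd dfd ddB (s * x + h) (s * d).
have fi' : mu.-integrable setT (EFin \o (fun h => f (s * x + h + s * d))).
  have -> : (fun h => f (s * x + h + s * d)) = (fun h => f (s * (x + d) + h)).
    by apply/funext => h; congr f; ring.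
  exact: fi.
have ii1 := rintegrableB fi' (fi (s * x)).
have ii2 := rintegrableZ (s * d) (dfi (s * x)).
have ii := rintegrableB ii1 ii2.
have -> : (\int[mu]_h f (s * (x + d) + h) - \int[mu]_h f (s * x + h)
    - d * (s * \int[mu]_h df (s * x + h)) =
  \int[mu]_h (f (s * x + h + s * d) - f (s * x + h) - s * d * df (s * x + h)))%R.
  rewrite RintegralB// RintegralB// RintegralZl//; congr (_ - _ - _); last by ring.
  by congr Rintegral; apply/funext => h; congr f; ring.
apply: le_trans (le_normr_Rintegral measurableT ii) _.
rewrite -mulrA -exprMn -[leRHS](Rint_cst mu); apply: le_Rintegral => //.
- exact: integrable_norm.
- exact: bm_integrable (bm_cst _).
Qed.

(** Smoothings of polynomials in [tanh] are stable under differentiation, by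
    [is_derive_smooth_tanh]. *)
Definition smooth_tanh (s : R) (p : {poly R}) (x : R) : R :=
  (\int[mu]_h p.[tanh (s * x + h)])%R.

Lemma is_derive_smooth_tanh (s : R) (p : {poly R}) (x : R) :
  is_derive x 1 (smooth_tanh s p) (s * smooth_tanh s (dtanh p) x).
Proof.
have [B ?] := poly_tanh_bounded (dtanh (dtanh p)).
apply: (is_derive_smoothing _ (is_derive_poly_tanh p) (is_derive_poly_tanh (dtanh p))) => //.
- by move=> a; apply: bm_integrable; exact: bm_poly_tanh.
- by move=> a; apply: bm_integrable; exact: bm_poly_tanh.
Qed.

Lemma smooth_tanh_bounded (s : R) (p : {poly R}) :
  exists B, forall x, `|smooth_tanh s p x| <= B.
Proof.
have [B pB] := poly_tanh_bounded p; exists B => x.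
by apply: Rint_norm_le => [|h]; [exact: bm_poly_tanh|exact: pB].
Qed.

End smoothing.

Section free_energy_theory.
Context {R : realType} (mu : probability (measurableTypeR R) R) (theta1 : R).
Hypothesis mu_int : mu.-integrable setT (EFin \o (fun h : R => h)).
Hypothesis theta1_gt0 : 0 < theta1.

Let s := Num.sqrt theta1.
Let s_gt0 : 0 < s. Proof. by rewrite sqrtr_gt0. Qed.
Let H := free_energy mu theta1.

Lemma integrable_lncosh (a : R) :
  mu.-integrable setT (EFin \o (fun h : measurableTypeR R => ln (cosh (a + h)))).
Proof.
apply: (@le_integrable _ _ _ mu setT measurableT _ (fun h => (`|a| + `|h|)%:E)).
- apply/measurable_EFinP.
  apply: (measurableT_comp (f := fun y : measurableTypeR R => ln (cosh y))
    _ (measurable_translate a)).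
  apply: continuous_measurable_fun => x.
  by apply/differentiable_continuous/derivable1_diffP; case: (is_derive_lncosh x).
- move=> h _ /=; rewrite lee_fin [leRHS]ger0_norm ?addr_ge0//.
  by rewrite (le_trans (norm_lncosh_le _))// ler_normD.
- apply: (@rintegrableD _ _ _ mu (fun=> `|a|) (fun h => `|h|)).
    exact: bm_integrable (bm_cst _).
  exact: integrable_norm.
Qed.

(** The free energy is a quadratic minus a smoothing of [ln cosh], so all its
    derivatives are explicit, and bounded from the second one on. *)
Definition square_deriv (j : nat) (x : R) : R :=
  match j with 0 => x ^+ 2 / 2 | 1 => x | 2 => 1 | _ => 0 end.

Definition lncosh_deriv (j : nat) (x : R) : R :=
  match j with
  | 0 => (\int[mu]_h ln (cosh (s * x + h)))%R
  | j'.+1 => s ^+ j * smooth_tanh mu s (iter j' dtanh 'X) x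
  end.

Definition free_energy_deriv (j : nat) (x : R) : R :=
  square_deriv j x - lncosh_deriv j x.
Local Notation Hd := free_energy_deriv.

Lemma is_derive_free_energy_deriv j (x : R) : is_derive x 1 (Hd j) (Hd j.+1 x).
Proof.
have -> : Hd j = square_deriv j - lncosh_deriv j by [].
have h1 : is_derive x 1 (square_deriv j) (square_deriv j.+1 x).
  case: j => [|[|[|j]]] /=.
  - rewrite (_ : square_deriv 0 = (2^-1 : R) *: (id ^+ 2)); last first.
      by apply/funext => y; rewrite /= !fctE mulrC.
    by apply: is_derive_eq; rewrite /GRing.scale /= expr1 mulr1; field.
  - exact: is_derive_id.
  - exact: is_derive_cst.
  - exact: is_derive_cst.
have h2 : is_derive x 1 (lncosh_deriv j) (lncosh_deriv j.+1 x).
  case: j {h1} => [|j] /=.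
  - rewrite expr1 (_ : smooth_tanh _ _ _ _ = (\int[mu]_h tanh (s * x + h))%R); last first.
      by congr Rintegral; apply/funext => h; rewrite hornerX.
    have tX (y : R) : is_derive y 1 (@tanh R) (1 - tanh y ^+ 2) by exact: is_derive_tanh.
    apply: (is_derive_smoothing _ is_derive_lncosh tX (B := 1)).
    + move=> y; have := sqr_tanh_lt1 y; have := sqr_ge0 (tanh y) => y0 y1.
      by rewrite ger0_norm; lra.
    + exact: integrable_lncosh.
    + move=> a; apply: bm_integrable; apply: (@bm_translate _ _ 1).
        exact: continuous_tanh.
      exact: norm_tanh_le1.
  - have h := is_derive_smooth_tanh mu s (iter j dtanh 'X) x.
    rewrite (_ : lncosh_deriv j.+1 = s ^+ j.+1 *: smooth_tanh mu s (iter j dtanh 'X))//.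
    by apply: is_derive_eq; rewrite /GRing.scale /= mulrA -exprSr.
exact: is_deriveB.
Qed.

Lemma free_energy_deriv_bounded j : exists B, forall x, `|Hd j.+2 x| <= B.
Proof.
have [B hB] := smooth_tanh_bounded mu s (iter j.+1 dtanh 'X).
exists (1 + s ^+ j.+2 * B) => x; rewrite /free_energy_deriv.
apply: (le_trans (ler_normB _ _)); apply: lerD.
  by case: j {hB} => [|j] /=; rewrite ?normr1// normr0.
by rewrite /= normrM ger0_norm ?exprn_ge0 ?(ltW s_gt0)// ler_wpM2l ?exprn_ge0 ?(ltW s_gt0).
Qed.

Lemma derive1n_free_energy j : derive1n j H = Hd j.
Proof.
elim: j => [|j IH] //; rewrite derive1nS IH; apply/funext => x.
by rewrite derive1E; case: (is_derive_free_energy_deriv j x).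
Qed.

Lemma continuous_free_energy : continuous H.
Proof.
move=> x; apply/differentiable_continuous/derivable1_diffP.
by case: (is_derive_free_energy_deriv 0 x).
Qed.

End free_energy_theory.

(** * Flatness of the minimum *)

Section flat_minimum.
Context {R : realType} (mu : probability (measurableTypeR R) R) (theta1 : R).
Hypothesis mu_int : mu.-integrable setT (EFin \o (fun h : R => h)).
Hypothesis theta1_gt0 : 0 < theta1.
Variables (tau : nat) (xs : R).
Hypothesis xs_flat : has_flatness (free_energy mu theta1) xs tau.

Local Notation H := (free_energy mu theta1).
Local Notation Hd := (free_energy_deriv mu theta1).

Let tau_ge1 : (1 <= tau)%N. Proof. by case: xs_flat. Qed.

Lemma flat_leading_gt0 : 0 < Hd (2 * tau) xs.
Proof. by case: xs_flat => _ _; rewrite derive1n_free_energy. Qed.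

Lemma flat_bigO : exists K rho : R, [/\ 0 <= K, 0 < rho & forall x, `|xs - x| < rho ->
  `|H x - (H xs + Hd (2 * tau) xs / (2 * tau)`!%:R * (x - xs) ^+ (2 * tau))|
   <= K * `|x - xs| ^+ (2 * tau + 1)].
Proof.
have [_ _ _] := xs_flat; rewrite derive1n_free_energy// => /eqOP.
move=> [M [_ hM]].
have /hM/nbhs_ballP[rho /= rho0 hr] : M < `|M| + 1 by rewrite ltr_pwDr// ler_norm.
exists (`|M| + 1), rho; split => // x xr.
by have := hr x xr; rewrite /= normrX.
Qed.

(** A first nonzero derivative of order [j < 2 tau] would make [H x - H xs] of
    exact order [|x - xs| ^ j], against the expansion in the definition of
    flatness. *)
Lemma flat_derivs_zero j : (1 <= j < 2 * tau)%N -> Hd j xs = 0.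
Proof.
elim/ltn_ind: j => j IH /andP[j1 jt]; apply/eqP/negPn/negP => nz.
have [K [rho [K0 rho0 hK]]] := flat_bigO.
set c := Hd (2 * tau) xs / (2 * tau)`!%:R in hK.
pose a := Hd j xs / j`!%:R.
have a0 : 0 < `|a|.
  by rewrite normr_gt0 mulf_neq0// invr_eq0 pnatr_eq0 -lt0n fact_gt0.
have [B hB] : exists B, forall x, `|Hd j.+1 x| <= B.
  by case: j j1 {IH jt nz a a0} => // j _; exact: free_energy_deriv_bounded.
have B0 : 0 <= B by apply: le_trans (hB 0).
have taylor x : `|H x - H xs - a * (x - xs) ^+ j| <= B * `|x - xs| ^+ j.+1.
  have := taylor_tower xs (is_derive_free_energy_deriv theta1 mu_int) hB x.
  rewrite big_ord_recr /=.
  case: j IH j1 jt {nz a0 hB} @a => // j IH _ jt a.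
  rewrite big_ord_recl /= big1 ?addr0; last first.
    by move=> i _; rewrite IH ?mul0r//= /bump /= add1n ?ltnS// (ltn_trans _ jt)// ltnS.
  by rewrite fact0 divr1 expr0 mulr1 opprD addrA.
(* at this distance the term of order [j] would exceed all the others *)
pose e := Num.min (rho / 2) (Num.min 1 (`|a| / (2 * (B + K + `|c| + 1)))).
have D0 : 0 < B + K + `|c| + 1 by rewrite ltr_wpDl// !addr_ge0.
have e0 : 0 < e by rewrite !lt_min divr_gt0// ltr01 divr_gt0// mulr_gt0.
have e1 : e <= 1 by rewrite !ge_min lexx !orbT.
have er : e < rho.
  apply: le_lt_trans (_ : rho / 2 < _); first by rewrite ge_min lexx.
  by lra.
have ea : e * (2 * (B + K + `|c| + 1)) <= `|a|.
  by rewrite -ler_pdivlMr ?mulr_gt0// !ge_min lexx !orbT.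
have h1 := taylor (xs + e); have h2 := hK (xs + e).
have xe : xs + e - xs = e by ring.
rewrite xe (ger0_norm (ltW e0)) in h1 h2.
have {}h2 := h2 _.
have {h2} : `|H (xs + e) - (H xs + c * e ^+ (2 * tau))| <= K * e ^+ (2 * tau + 1).
  by apply: h2; rewrite opprD addrA subrr sub0r normrN ger0_norm// ltW.
have p1 : e ^+ (2 * tau) <= e ^+ j.+1 by rewrite ler_wiXn2l// ltW.
have p2 : e ^+ (2 * tau + 1) <= e ^+ j.+1.
  by rewrite ler_wiXn2l// ?(ltW e0)// addn1 ltnS ltnW.
have ej : 0 < e ^+ j by rewrite exprn_gt0.
move=> h2.
have : `|a| * e ^+ j <= (B + K + `|c|) * e ^+ j.+1.
  have -> : `|a| * e ^+ j = `|a * e ^+ j| by rewrite [in RHS]normrM (ger0_norm (ltW ej)).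
  have -> : a * e ^+ j = - (H (xs + e) - H xs - a * e ^+ j) +
     (H (xs + e) - (H xs + c * e ^+ (2 * tau))) + c * e ^+ (2 * tau) by ring.
  rewrite !mulrDl; apply: le_trans (ler_normD _ _) _; apply: lerD; last first.
    by rewrite normrM ler_wpM2l// ger0_norm// exprn_ge0// ltW.
  apply: le_trans (ler_normD _ _) _; apply: lerD; first by rewrite normrN.
  by apply: le_trans h2 _; rewrite ler_wpM2l.
rewrite exprSr mulrA mulrAC ler_pM2r// => h3.
have : (B + K + `|c|) * e <= (B + K + `|c| + 1) * e.
  by rewrite ler_wpM2r ?(ltW e0)// lerDl.
by rewrite [e * _]mulrC in ea; lra.
Qed.

(** The Taylor expansion of [H'] at [xs] starts at degree [2 tau - 1], with a
    positive coefficient. *)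
Lemma free_energy_deriv1_growth : exists c r : R, [/\ 0 < c, 0 < r &
  forall x, `|x - xs| <= r -> c * `|x - xs| ^+ (2 * tau).-1 <= `|Hd 1 x|].
Proof.
have [t tE] : exists t, (2 * tau)%N = t.+1.
  by exists (2 * tau).-1; rewrite prednK// muln_gt0.
have [B hB] := free_energy_deriv_bounded mu theta1_gt0 t.
have B0 : 0 <= B by apply: le_trans (hB 0).
pose c := Hd t.+1 xs / t`!%:R.
have c0 : 0 < c by rewrite divr_gt0 ?ltr0n ?fact_gt0// -tE flat_leading_gt0.
have taylor x : `|Hd 1 x - c * (x - xs) ^+ t| <= B * `|x - xs| ^+ t.+1.
  have := taylor_tower xs (fun j => is_derive_free_energy_deriv theta1 mu_int j.+1) (N := t.+1) hB x.
  rewrite big_ord_recr /= big1 ?add0r// => i _.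
  by rewrite flat_derivs_zero ?mul0r// tE /= ltnS.
clearbody c.
(* within this radius the remainder is at most half of the leading term *)
exists (c / 2), (c / (2 * (B + 1))); split; rewrite ?divr_gt0 ?mulr_gt0 ?ltr_wpDl// => x.
rewrite ler_pdivlMr ?mulr_gt0 ?ltr_wpDl// => xr; rewrite tE /=.
have := taylor x; set d := `|x - xs| in xr *; rewrite exprSr mulrA => h.
have d0 : 0 <= d by exact: normr_ge0.
have dt0 : 0 <= d ^+ t by rewrite exprn_ge0.
have h' : c * d ^+ t <= `|Hd 1 x| + B * d ^+ t * d.
  have -> : c * d ^+ t = `|Hd 1 x - (Hd 1 x - c * (x - xs) ^+ t)|.
    by rewrite opprD addNKr opprK normrM normrX (ger0_norm (ltW c0)).
  by apply: le_trans (ler_normB _ _) _; rewrite lerD2l.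
have : B * d * d ^+ t <= c / 2 * d ^+ t.
  by rewrite ler_wpM2r//; nra.
by rewrite (mulrAC B) in h'; lra.
Qed.

(** The Taylor expansion of [H''] at [xs] starts at degree [2 tau - 2]; the
    mean value theorem turns this into a modulus for [H']. *)
Lemma free_energy_deriv1_lipschitz : exists2 C : R, 0 < C & forall x y,
  `|Hd 1 y - Hd 1 x| <= C * (`|x - xs| + `|y - xs|) ^+ (2 * tau).-2 * `|y - x|.
Proof.
have [t tE] : exists t, (2 * tau)%N = t.+2.
  by exists (2 * tau).-2; case: tau tau_ge1 => // ? _; rewrite mul2n.
have [B hB] := free_energy_deriv_bounded mu theta1_gt0 t.
have B0 : 0 <= B by apply: le_trans (hB 0).
have taylor x : `|Hd 2 x| <= B * `|x - xs| ^+ t.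
  have := taylor_tower xs (fun j => is_derive_free_energy_deriv theta1 mu_int j.+2) (N := t) hB x.
  rewrite big1 ?subr0// => i _.
  by rewrite flat_derivs_zero ?mul0r// tE !ltnS /=.
exists (B * 2 ^+ t + 1) => [|x y]; first by rewrite ltr_wpDl// mulr_ge0.
have [c hc ->] := mvt_between (is_derive_free_energy_deriv theta1 mu_int 1) x y.
rewrite normrM ler_wpM2r// (le_trans (taylor c))// tE /=.
apply: le_trans (_ : B * 2 ^+ t * (`|x - xs| + `|y - xs|) ^+ t <= _); last first.
  by rewrite ler_wpM2r ?lerDl// exprn_ge0// addr_ge0.
rewrite -mulrA -exprMn ler_wpM2l// lerXn2r ?nnegrE// ?mulr_ge0 ?addr_ge0//.
have h1 : `|c - xs| <= `|c - x| + `|x - xs|.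
  by rewrite (le_trans _ (ler_normD _ _))//; rewrite addrA subrK.
have h2 : `|y - x| <= `|y - xs| + `|x - xs|.
  by rewrite -[X in _ <= _ + X]normrN (le_trans _ (ler_normD _ _))// opprB addrA subrK.
by have := normr_ge0 (y - xs); lra.
Qed.

End flat_minimum.

(** * The limiting magnetization *)

Section magnetization.
Context {R : realType} (mu : probability (measurableTypeR R) R) (theta1 : R).
Hypothesis mu_int : mu.-integrable setT (EFin \o (fun h : R => h)).
Hypothesis theta1_gt0 : 0 < theta1.
Variables (tau : nat) (xs : R).
Hypothesis noncentered : (\int[mu]_h tanh h)%R <> 0.
Hypothesis xs_min : forall x : R, x <> xs ->
      free_energy mu theta1 xs < free_energy mu theta1 x.
Hypothesis xs_flat : has_flatness (free_energy mu theta1) xs tau.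

Local Notation H := (free_energy mu theta1).
Local Notation Hd := (free_energy_deriv mu theta1).
Let s := Num.sqrt theta1.
Let s_gt0 : 0 < s. Proof. by rewrite sqrtr_gt0. Qed.

Definition mean_tanh (a : R) : R := (\int[mu]_h tanh (a + h))%R.

Lemma bm_tanh_translate (a : R) : bounded_mfun (fun h : measurableTypeR R => tanh (a + h)).
Proof.
exact: (bm_translate a (@continuous_tanh R) (@norm_tanh_le1 R)).
Qed.

Lemma mean_tanh_increasing (a a' : R) : a < a' -> mean_tanh a < mean_tanh a'.
Proof.
move=> aa'; have [b1 b2] := (bm_tanh_translate a, bm_tanh_translate a').
rewrite -subr_gt0 -(RintB mu b2 b1); apply: Rint_gt0; first exact: bmB.
by move=> h; rewrite subr_gt0 tanh_increasing// ltrD2r.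
Qed.

Lemma norm_mean_tanh_le1 (a : R) : `|mean_tanh a| <= 1.
Proof.
by apply: Rint_norm_le; [exact: bm_tanh_translate|move=> h; exact: norm_tanh_le1].
Qed.

Lemma free_energy_deriv1E (x : R) : Hd 1 x = x - s * mean_tanh (s * x).
Proof.
rewrite /free_energy_deriv /= expr1; congr (_ - _ * _).
by congr Rintegral; apply/funext => h; rewrite hornerX.
Qed.

(** This is the equation [H' xs = 0]. *)
Lemma magnetization_fixpoint : xs = s * mean_tanh (s * xs).
Proof.
apply/eqP; rewrite -subr_eq0 -free_energy_deriv1E; apply/eqP.
apply: (flat_derivs_zero mu_int theta1_gt0 xs_flat).
by case: xs_flat; case: tau => // t _ _ _ _; rewrite mul2n.
Qed.

Lemma norm_minimizer_le : `|xs| <= s.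
Proof.
rewrite magnetization_fixpoint normrM (ger0_norm (ltW s_gt0)).
by rewrite ler_piMr ?(ltW s_gt0)// norm_mean_tanh_le1.
Qed.

(** At [xs = 0] the fixed point equation would read [0 = sqrt theta1 * E tanh
    h]. *)
Lemma minimizer_neq0 : xs != 0.
Proof.
apply/eqP => xs0; apply: noncentered; have := magnetization_fixpoint.
rewrite xs0 mulr0 => /esym/eqP; rewrite mulf_eq0 gt_eqF//= => /eqP <-.
by congr Rintegral; apply/funext => h; rewrite add0r.
Qed.

(** The two sides are the values of the strictly increasing function
    [mean_tanh] at [sqrt theta1 * xs] and at [0]. *)
Lemma magnetization_separated : xs / s != (\int[mu]_h tanh h)%R.
Proof.
have -> : (\int[mu]_h tanh h)%R = mean_tanh 0.
  by congr Rintegral; apply/funext => h; rewrite add0r.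
rewrite {1}magnetization_fixpoint mulrC mulKf ?(lt0r_neq0 s_gt0)//.
have : (s * xs < 0) || (0 < s * xs) by rewrite -neq_lt mulf_neq0 ?(lt0r_neq0 s_gt0) ?minimizer_neq0.
move=> /orP[] /mean_tanh_increasing h; first by rewrite lt_eqF.
by rewrite gt_eqF.
Qed.

(** If [tanh (s * xs + h)] were almost surely equal to its mean [M], its
    second and third moments would be [M ^ 2] and [M ^ 3]. For [tau >= 2] both
    [H''] and [H'''] vanish at [xs]; the former would give [theta1 (1 - M ^ 2)
    = 1], the latter [M (1 - M ^ 2) = 0]. Then [M = 0], against [xs <> 0]. *)
Lemma tanh_variance_gt0 : (2 <= tau)%N ->
  0 < (\int[mu]_h (tanh (s * xs + h) - xs / s) ^+ 2)%R.
Proof.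
move=> tau2; set M := xs / s.
pose t h := tanh (s * xs + h).
have bt : bounded_mfun (t : measurableTypeR R -> R) by exact: bm_tanh_translate.
have It : (\int[mu]_h t h)%R = M.
  by rewrite /M {1}magnetization_fixpoint mulrC mulKf ?gt_eqF.
have b1 (c : R) : bounded_mfun (fun _ : measurableTypeR R => c) by exact: bm_cst.
rewrite lt_def Rintegral_ge0 ?andbT; last by move=> x _; exact: sqr_ge0.
apply/eqP => V0.
have I2 : (\int[mu]_h (t h) ^+ 2)%R = M ^+ 2.
  have -> : (fun h => t h ^+ 2) = fun h => (t h - M) ^+ 2 + (2 * M * t h + - M ^+ 2).
    by apply/funext => h; ring.
  rewrite RintD; [|exact/bmX/bmB|by apply: bmD; [exact: bmZ|exact: b1]].
  by rewrite V0 RintD//; [rewrite RintZ// Rint_cst It; ring|exact: bmZ].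
have I3 : (\int[mu]_h (t h) ^+ 3)%R = M ^+ 3.
  have : (\int[mu]_h ((t h - M) ^+ 2 * (t h + 2 * M)))%R = 0.
    have bm1 : bounded_mfun (fun h : measurableTypeR R => (t h - M) ^+ 2) by exact/bmX/bmB.
    have bm2 : bounded_mfun (fun h : measurableTypeR R => t h + 2 * M) by exact: bmD.
    apply/eqP; rewrite -normr_le0.
    have ii := bm_integrable mu (bmM bm1 bm2).
    apply: le_trans (le_normr_Rintegral measurableT ii) _.
    rewrite -(mulr0 (1 + `|2 * M|)) -V0 -RintZ//.
    apply: le_Rint; [exact/bm_norm/bmM|exact: bmZ|move=> h].
    rewrite normrM mulrC [X in _ * X]ger0_norm ?sqr_ge0// ler_wpM2r ?sqr_ge0//.
    by rewrite (le_trans (ler_normD _ _))// lerD2r norm_tanh_le1.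
  have -> : (fun h => (t h - M) ^+ 2 * (t h + 2 * M)) =
            fun h => t h ^+ 3 + ((- 3 * M ^+ 2) * t h + 2 * M ^+ 3).
    by apply/funext => h; ring.
  have bX := bmX 3 bt; have bZ := bmZ (- 3 * M ^+ 2) bt.
  rewrite (RintD mu bX (bmD bZ (b1 _))) (RintD mu bZ (b1 _)) (RintZ mu _ bt) Rint_cst It => /eqP; rewrite addr_eq0 => /eqP ->; ring.
have fz := flat_derivs_zero mu_int theta1_gt0 xs_flat.
have tau4 : (4 <= 2 * tau)%N by rewrite -[4%N]/(2 * 2)%N leq_pmul2l.
have H2 : Hd 2 xs = 0 by apply: fz; rewrite /= (leq_trans _ tau4).
have H3 : Hd 3 xs = 0 by apply: fz; rewrite /= (leq_trans _ tau4).
have e2 : smooth_tanh mu s (dtanh 'X) xs = 1 - M ^+ 2.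
  rewrite /smooth_tanh -I2 -[1 in RHS](Rint_cst mu) -RintB//; last exact: bmX.
  congr Rintegral; apply/funext => h.
  by rewrite /dtanh derivX !hornerE.
have e3 : smooth_tanh mu s (dtanh (dtanh 'X)) xs = -2 * (M - M ^+ 3).
  rewrite /smooth_tanh -I3 -It -RintB//; last exact: bmX.
  rewrite -RintZ//; last by apply: bmB => //; exact: bmX.
  congr Rintegral; apply/funext => h.
  rewrite /dtanh derivX mul1r derivB derivXn -[1 in X in X^`()]/(1%:P) derivC.
  by rewrite !hornerE -/(t h); ring.
move: H2 H3; rewrite /free_energy_deriv /= e2 e3 => h2 h3.
have s3 : s ^+ 3 != 0 by rewrite expf_neq0// gt_eqF.
have s2 : s ^+ 2 != 0 by rewrite expf_neq0// gt_eqF.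
have M3 : M * (1 - M ^+ 2) = 0.
  move/eqP: h3; rewrite sub0r oppr_eq0 mulf_eq0 (negbTE s3) /= mulf_eq0.
  by move=> /orP[|/eqP <-]; [rewrite oppr_eq0 pnatr_eq0|ring].
have M1 : 1 - M ^+ 2 != 0.
  by apply/eqP => z; move: h2; rewrite z mulr0 subr0 => /eqP; rewrite oner_eq0.
have : M = 0 by move/eqP: M3; rewrite mulf_eq0 (negbTE M1) orbF => /eqP.
move/eqP; rewrite mulf_eq0 (negbTE minimizer_neq0) /= invr_eq0.
by rewrite gt_eqF.
Qed.

Lemma free_energy_gap (r : R) : 0 < r -> exists2 eta : R, 0 < eta &
  forall y, `|y| <= s -> r <= `|y - xs| -> eta <= H y - H xs.
Proof.
move=> r0.
have cH : continuous H by exact: continuous_free_energy.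
have half (a b : R) : (forall y, a <= y <= b -> y <> xs) ->
    exists2 eta : R, 0 < eta & forall y, a <= y <= b -> eta <= H y - H xs.
  move=> ab; have [le_ab|lt_ba] := leP a b; last first.
    exists 1 => // y /andP[ay yb]; have := le_trans ay yb; by rewrite leNgt lt_ba.
  have [c hc cmin] := EVT_min le_ab (continuous_subspaceT cH).
  move: hc; rewrite in_itv /= => hc.
  exists (H c - H xs); first by rewrite subr_gt0; apply: xs_min; exact: ab.
  by move=> y hy; rewrite lerD2r cmin// in_itv.
(* the points at distance at least [r] from [xs] form two compact intervals
   once restricted to [- s <= y <= s] *)
have [e1 e10 h1] : exists2 eta : R, 0 < eta & forall y, - s <= y <= xs - r -> eta <= H y - H xs.
  by apply: half => y /andP[_ h] e; move: h; rewrite e; lra.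
have [e2 e20 h2] : exists2 eta : R, 0 < eta & forall y, xs + r <= y <= s -> eta <= H y - H xs.
  by apply: half => y /andP[h _] e; move: h; rewrite e; lra.
exists (Num.min e1 e2); first by rewrite lt_min e10.
move=> y; rewrite ler_norml => /andP[sy ys]; rewrite ler_normr => /orP[h|h].
  by rewrite ge_min h2 ?orbT// ys andbT; lra.
by rewrite ge_min h1// sy /=; lra.
Qed.

End magnetization.

(** * The Gibbs law for a fixed field *)

Section quenched.
Context {R : realType} {n : nat}.
Implicit Types (e : config n -> R) (s : config n) (i j : 'I_n).

Definition flip i s : config n := [ffun j => if j == i then ~~ s j else s j].

Lemma flipK i : involutive (flip i).
Proof. by move=> s; apply/ffunP => j; rewrite !ffunE; case: eqP => //; rewrite negbK. Qed.

Lemma spin_flip i s : spin R (flip i s i) = - spin R (s i).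
Proof. by rewrite ffunE eqxx /spin; case: (s i); rewrite ?opprK. Qed.

Lemma spin_flip_neq i j s : j != i -> spin R (flip i s j) = spin R (s j).
Proof. by move=> ji; rewrite ffunE (negbTE ji). Qed.

Lemma norm_spin (b : bool) : `|spin R b| = 1.
Proof. by case: b; rewrite /spin ?normrN normr1. Qed.

Lemma partition_gt0 e : 0 < \sum_(s : config n) expR (e s).
Proof.
rewrite (bigD1 [ffun=> true])//= ltr_pwDl ?expR_gt0// sumr_ge0//.
Qed.

Lemma gibbs_ge0 e s : 0 <= gibbs e s.
Proof. by rewrite divr_ge0 ?expR_ge0// ltW// partition_gt0. Qed.

Lemma sum_gibbs e : \sum_s gibbs e s = 1.
Proof. by rewrite -mulr_suml divff// gt_eqF// partition_gt0. Qed.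

Lemma gibbs_le1 e s : gibbs e s <= 1.
Proof.
rewrite -(sum_gibbs e) (bigD1 s)//= lerDl sumr_ge0// => t _; exact: gibbs_ge0.
Qed.

(** Pair each configuration with the one where the spin at [i] is flipped:
    given the other spins, a spin with local field [a] has mean [tanh a]. *)
Lemma gibbs_local_mean e (a f : config n -> R) i :
  (forall s, e s - e (flip i s) = 2 * spin R (s i) * a s) ->
  (forall s, a (flip i s) = a s) -> (forall s, f (flip i s) = f s) ->
  \sum_s gibbs e s * ((spin R (s i) - tanh (a s)) * f s) = 0.
Proof.
move=> ea af ff; set S := LHS.
suff : S + S = 0 by move=> h; lra.
rewrite {1}/S (reindex_inj (inv_inj (flipK i))) /= /S -big_split big1//= => s _.
rewrite spin_flip af ff /gibbs.
have -> : e s = e (flip i s) + 2 * spin R (s i) * a s by rewrite -ea; ring.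
rewrite expRD; set E := expR (e _); set Z := \sum_ _ _.
have Z0 : Z != 0 by rewrite gt_eqF// partition_gt0.
have k0 : expR (a s) + expR (- a s) != 0 by rewrite gt_eqF// addr_gt0 ?expR_gt0.
have n0 : expR (a s) != 0 by rewrite gt_eqF ?expR_gt0.
suff : - spin R (s i) - tanh (a s) +
   expR (2 * spin R (s i) * a s) * (spin R (s i) - tanh (a s)) = 0.
  move=> h; transitivity (E / Z * f s * (- spin R (s i) - tanh (a s) +
     expR (2 * spin R (s i) * a s) * (spin R (s i) - tanh (a s)))).
    by field.
  by rewrite h mulr0.
rewrite /tanh expRN; have := expR_gt0 (a s).
have e2 : expR (2 * a s) = expR (a s) ^+ 2 by rewrite expRM_natl.
case: (s i); rewrite /spin ?mulr1 ?mulrN1 ?mulNr ?expRN e2; move: (expR (a s)) => x x0.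
  by field; apply/andP; split; rewrite gt_eqF//; nra.
by field; apply/andP; split; rewrite gt_eqF//; nra.
Qed.

(** The diagonal contributes [4 #|A|] and the pairs at most [eps #|A| ^ 2]. *)
Lemma gibbs_second_moment e (D : 'I_n -> config n -> R) (A : {set 'I_n}) (eps : R) :
  (forall i s, `|D i s| <= 2) ->
  (forall i j, i \in A -> j \in A -> i != j ->
     \sum_s gibbs e s * (D i s * D j s) <= eps) -> 0 <= eps ->
  \sum_s gibbs e s * (\sum_(i in A) D i s) ^+ 2 <= 4 * #|A|%:R + eps * #|A|%:R ^+ 2.
Proof.
move=> D2 Deps eps0.
have -> : \sum_s gibbs e s * (\sum_(i in A) D i s) ^+ 2 =
   \sum_(i in A) \sum_(j in A) \sum_s gibbs e s * (D i s * D j s).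
  under [RHS]eq_bigr do rewrite exchange_big.
  rewrite exchange_big /=; apply: eq_bigr => s _.
  rewrite expr2 mulr_suml mulr_sumr; apply: eq_bigr => i _.
  by rewrite mulr_sumr mulr_sumr; apply: eq_bigr => j _.
have -> : 4 * #|A|%:R + eps * #|A|%:R ^+ 2 =
    \sum_(i in A) (4 + \sum_(j in A) eps) :> R.
  by rewrite big_split /= !sumr_const -[4 *+ _]mulr_natr -[eps *+ _ *+ _]mulr_natr -[eps *+ _]mulr_natr expr2 mulrA.
apply: ler_sum => i iA.
rewrite (bigD1 i)//=; apply: lerD.
  apply: (@le_trans _ _ (\sum_s gibbs e s * 4)); last by rewrite -mulr_suml sum_gibbs mul1r.
  apply: ler_sum => s _; rewrite ler_wpM2l ?gibbs_ge0// -expr2 -real_normK ?num_real//.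
  by have := D2 i s; have := normr_ge0 (D i s); nra.
rewrite [leRHS](bigD1 i)//= -[leLHS]add0r lerD// ler_sum// => j /andP[jA ji].
by apply: Deps => //; rewrite eq_sym.
Qed.

End quenched.

Section clique.
Context {R : realType} {n : nat} (theta1 : R) (S : {set 'I_n}) (h : n.-tuple R).
Hypothesis theta1_gt0 : 0 < theta1.
Implicit Types (s : config n) (i j : 'I_n).
Local Notation k := (#|S|%:R : R).
Local Notation e := (clique_energy theta1 S h).

Definition clique_sum s : R := \sum_(i in S) spin R (s i).
Definition cavity_sum i s : R := \sum_(j in S | j != i) spin R (s j).

Definition local_field i s : R :=
  (if i \in S then theta1 / k * cavity_sum i s else 0) + tnth h i.

Lemma clique_energyE s :
  e s = theta1 / (2 * k) * clique_sum s ^+ 2 + field_energy h s.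
Proof.
rewrite /clique_energy; congr (_ * _ + _).
rewrite expr2 /clique_sum mulr_suml; apply: eq_bigr => i _; by rewrite mulr_sumr.
Qed.

Lemma clique_sumD1 i s : i \in S -> clique_sum s = spin R (s i) + cavity_sum i s.
Proof. by move=> iS; rewrite /clique_sum (bigD1 i). Qed.

Lemma cavity_sum_flip i s : cavity_sum i (flip i s) = cavity_sum i s.
Proof. by apply: eq_bigr => j /andP[_ ji]; rewrite spin_flip_neq. Qed.

Lemma local_field_flip i s : local_field i (flip i s) = local_field i s.
Proof. by rewrite /local_field cavity_sum_flip. Qed.

Lemma field_energy_flip i s :
  field_energy h s - field_energy h (flip i s) = 2 * spin R (s i) * tnth h i.
Proof.
rewrite /field_energy (bigD1 i)//= [X in _ - X](bigD1 i)//= spin_flip.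
under [in X in _ - X]eq_bigr => j ji do rewrite spin_flip_neq//.
by ring.
Qed.

Lemma clique_energy_flip i s : e s - e (flip i s) = 2 * spin R (s i) * local_field i s.
Proof.
rewrite !clique_energyE /local_field; have := field_energy_flip i s.
case: ifP => iS hf.
  rewrite (clique_sumD1 s iS) (clique_sumD1 (flip i s) iS) spin_flip cavity_sum_flip.
  have -> : field_energy h s = field_energy h (flip i s) + 2 * spin R (s i) * tnth h i.
    by rewrite -hf; ring.
  by rewrite invfM; move: (k^-1) => ik; field.
have -> : clique_sum (flip i s) = clique_sum s.
  apply: eq_bigr => j jS; rewrite spin_flip_neq//; by apply: contraFneq iS => <-.
by rewrite add0r -hf; ring.
Qed.

Definition spin_defect i s : R := spin R (s i) - tanh (local_field i s).

Lemma norm_spin_defect i s : `|spin_defect i s| <= 2.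
Proof.
rewrite (le_trans (ler_normB _ _))// norm_spin.
by have := norm_tanh_le1 (local_field i s); lra.
Qed.

Definition clique_defect s : R := \sum_(i in S) spin_defect i s.

(** Each defect is centered given the other spins. *)
Lemma mean_clique_defect : \sum_s gibbs e s * clique_defect s = 0.
Proof.
under eq_bigr do rewrite mulr_sumr.
rewrite exchange_big big1//= => i _.
rewrite -[RHS](gibbs_local_mean (i := i) (f := fun=> 1) (clique_energy_flip i) (local_field_flip i))//.
by apply: eq_bigr => s _; rewrite mulr1.
Qed.

(** The field acting on [j] depends on another single spin [i] only through a
    term of size [theta1 / k], so that distinct defects are almost
    uncorrelated. *)
Lemma clique_defect_second_moment :
  \sum_s gibbs e s * clique_defect s ^+ 2 <= (4 + 2 * theta1) * k.
Proof.
have [S0|S0] := eqVneq #|S| 0%N.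
  rewrite S0 mulr0 big1// => s _; rewrite /clique_defect.
  by move/cards0_eq: S0 => ->; rewrite big_set0 expr0n mulr0.
have k0 : 0 < k by rewrite ltr0n lt0n.
have -> : (4 + 2 * theta1) * k = 4 * k + (2 * (theta1 / k)) * k ^+ 2.
  by field; rewrite gt_eqF.
apply: gibbs_second_moment.
- exact: norm_spin_defect.
- move=> i j iS jS ij.
  pose c s := \sum_(l in S | (l != j) && (l != i)) spin R (s l).
  pose t s := tanh (theta1 / k * c s + tnth h j).
  have cf s : c (flip i s) = c s.
    by apply: eq_bigr => l /and3P[_ _ li]; rewrite spin_flip_neq.
  have -> : \sum_s gibbs e s * (spin_defect i s * spin_defect j s) =
    \sum_s gibbs e s * (spin_defect i s * (t s - tanh (local_field j s))).
    apply/eqP; rewrite -subr_eq0 -sumrB; apply/eqP.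
    rewrite -[RHS](gibbs_local_mean (i := i) (f := fun s => spin R (s j) - t s) (clique_energy_flip i) (local_field_flip i))//.
      by apply: eq_bigr => s _; rewrite /spin_defect; ring.
    by move=> s; rewrite /t cf spin_flip_neq// eq_sym.
  apply: (@le_trans _ _ (\sum_s gibbs e s * (2 * (theta1 / k)))); last first.
    by rewrite -mulr_suml sum_gibbs mul1r.
  apply: ler_sum => s _; rewrite ler_wpM2l ?gibbs_ge0// (le_trans (ler_norm _))//.
  rewrite normrM ler_pM// ?norm_spin_defect// (le_trans (tanh_lipschitz _ _))//.
  rewrite /local_field jS /cavity_sum (bigD1 i)//=; last by rewrite iS.
  rewrite (_ : _ - _ = - (theta1 / k * spin R (s i))); last first.
    rewrite /c; under [X in _ - (_ * (_ + X) + _)]eq_bigl => l do rewrite -andbA.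
    by ring.
  by rewrite normrN normrM norm_spin mulr1 ger0_norm// divr_ge0// ltW.
- by rewrite mulr_ge0// divr_ge0// ltW.
Qed.

(** Outside the clique the local field is [tnth h i] and the defects are
    uncorrelated. *)
Lemma outside_defect_second_moment :
  \sum_s gibbs e s * (\sum_(i in ~: S) (spin R (s i) - tanh (tnth h i))) ^+ 2
  <= 4 * n%:R.
Proof.
apply: (@le_trans _ _ (4 * #|~: S|%:R + 0 * #|~: S|%:R ^+ 2)); last first.
  rewrite mul0r addr0 ler_wpM2l// ler_nat.
  by rewrite -[leqRHS](card_ord n) max_card.
have -> : \sum_s gibbs e s * (\sum_(i in ~: S) (spin R (s i) - tanh (tnth h i))) ^+ 2 =
   \sum_s gibbs e s * (\sum_(i in ~: S) spin_defect i s) ^+ 2.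
  apply: eq_bigr => s _; congr (_ * _ ^+ 2); apply: eq_bigr => i.
  by rewrite inE /spin_defect /local_field => /negbTE ->; rewrite add0r.
apply: gibbs_second_moment => //; first exact: norm_spin_defect.
move=> i j iS jS ij.
rewrite (gibbs_local_mean (i := i) (clique_energy_flip i) (local_field_flip i))//.
move=> s; move: jS; rewrite inE /spin_defect /local_field => /negbTE ->.
by rewrite spin_flip_neq// eq_sym.
Qed.

Definition tilted_partition (lam : R) : R :=
  \sum_s expR (lam * clique_sum s + field_energy h s).

Lemma tilted_partitionE (lam : R) : tilted_partition lam =
  (\prod_(i in S) (2 * cosh (lam + tnth h i))) *
  (\prod_(i in ~: S) (2 * cosh (tnth h i))).
Proof.
pose a i := (if i \in S then lam else 0) + tnth h i.
transitivity (\prod_(i < n) (2 * cosh (a i))).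
  have -> : \prod_(i < n) (2 * cosh (a i)) = \prod_(i < n) \sum_(b : bool) expR (a i * spin R b).
    by apply: eq_bigr => i _; rewrite big_bool /= mulr1 mulrN1 /cosh; field.
  rewrite bigA_distr_bigA; apply: eq_bigr => s _; rewrite -expR_sum; congr expR.
  under [RHS]eq_bigr do rewrite mulrDl.
  rewrite big_split /=; congr (_ + _).
  rewrite mulr_sumr big_mkcond /=; apply: eq_bigr => i _.
  by case: ifP => _; rewrite ?mul0r.
rewrite (bigID (mem S)) /=; congr (_ * _).
  by apply: eq_bigr => i iS; rewrite /a iS.
apply: eq_big => [i|i iS]; first by rewrite inE.
by rewrite /a (negbTE iS) add0r.
Qed.

(** Both partition sums are compared with those of independent spins. On the
    level [clique_sum = x] the quadratic energy equals its tangent at [x]; in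
    the denominator it lies above its tangent at [ys]. *)
Lemma gibbs_level_le (x ys : R) (y := Num.sqrt theta1 * x / k) : (0 < #|S|)%N ->
  \sum_(s | clique_sum s == x) gibbs e s <=
  expR (\sum_(i in S) - ((y ^+ 2 - ys ^+ 2) / 2 -
      (ln (cosh (Num.sqrt theta1 * y + tnth h i)) -
       ln (cosh (Num.sqrt theta1 * ys + tnth h i))))).
Proof.
move=> S0; set sq := Num.sqrt theta1.
have k0 : 0 < k by rewrite ltr0n.
have ssq : sq ^+ 2 = theta1 by rewrite sqr_sqrtr// ltW.
have sq0 : 0 < sq by rewrite sqrtr_gt0.
(* the difference of the two exponents is a square over [2 * k] *)
have lower : expR (- (k * ys ^+ 2 / 2)) * tilted_partition (sq * ys) <=
             \sum_(s : config n) expR (e s).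
  rewrite /tilted_partition mulr_sumr; apply: ler_sum => s _.
  rewrite -expRD ler_expR clique_energyE addrA lerD2r -ssq.
  rewrite -subr_ge0 (_ : _ - _ = (sq * clique_sum s - k * ys) ^+ 2 / (2 * k)).
    by rewrite divr_ge0 ?sqr_ge0// mulr_ge0.
  by field; rewrite gt_eqF.
have upper : \sum_(s | clique_sum s == x) expR (e s) <=
   expR (- (k * y ^+ 2 / 2)) * tilted_partition (sq * y).
  rewrite /tilted_partition mulr_sumr [leRHS](bigID (fun s => clique_sum s == x)) /=.
  apply: ler_wpDr; first by apply: sumr_ge0 => s _; rewrite mulr_ge0 ?expR_ge0.
  apply: ler_sum => s /eqP xs; rewrite -expRD ler_expR clique_energyE xs addrA lerD2r.
  apply: le_of_eq; rewrite /y -/sq -ssq.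
  by field; rewrite gt_eqF.
have tp0 lam : 0 < tilted_partition lam by exact: partition_gt0.
rewrite /gibbs -mulr_suml ler_pdivrMr ?partition_gt0//.
apply: (le_trans upper); apply: le_trans (ler_wpM2l (expR_ge0 _) lower).
apply: le_of_eq.
rewrite !tilted_partitionE.
have pE (lam : R) : \prod_(i in S) (2 * cosh (lam + tnth h i)) =
   2 ^+ #|S| * expR (\sum_(i in S) ln (cosh (lam + tnth h i))).
  rewrite big_split /= prodr_const expR_sum; congr (_ * _).
  by apply: eq_bigr => i _; rewrite lnK// posrE cosh_gt0.
rewrite !pE sumrN !sumrB sumr_const -[(_ / 2) *+ _]mulr_natl.
set P := \prod_(i in ~: S) _; set A := \sum_(i in S) _; set B := \sum_(i in S) _.
have -> : - (k * ((y ^+ 2 - ys ^+ 2) / 2) - (A - B)) =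
   - (k * y ^+ 2 / 2) + A + (k * ys ^+ 2 / 2) - B by ring.
move: (k * y ^+ 2 / 2) (k * ys ^+ 2 / 2) (2 ^+ #|S|) => u v w.
rewrite !expRD !expRN; field.
by rewrite !gt_eqF ?expR_gt0.
Qed.

End clique.

(** * Sums over the field *)

Section iid_sums.
Context {R : realType} (mu : probability (measurableTypeR R) R).
Local Notation field n := (n.-tuple (measurableTypeR R)).

Lemma Rint_iid_prod_on {n} (A : {set 'I_n}) (f : measurableTypeR R -> R) : bounded_mfun f ->
  (\int[iid_law mu n]_h \prod_(i in A) f (tnth h i) = (\int[mu]_x f x) ^+ #|A|)%R.
Proof.
move=> bf; have := @Rint_iid_prod R mu n (fun i => if i \in A then f else fun=> 1).
have -> : (fun h : field n => \prod_(i < n) (if i \in A then f else fun=> 1) (tnth h i)) =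
   (fun h : field n => \prod_(i in A) f (tnth h i)).
  apply/funext => h; rewrite [RHS]big_mkcond; apply: eq_bigr => i _; by case: ifP.
move=> ->; last by move=> i; case: ifP => // _; exact: bm_cst.
rewrite -prodr_const [RHS]big_mkcond; apply: eq_bigr => i _; case: ifP => // _.
exact: Rint_cst.
Qed.

Lemma Rint_tnth {n} (i : 'I_n) (f : measurableTypeR R -> R) : bounded_mfun f ->
  (\int[iid_law mu n]_h f (tnth h i) = \int[mu]_x f x)%R.
Proof.
move=> bf; have := Rint_iid_prod_on [set i] bf.
rewrite cards1 expr1 => <-; congr Rintegral.
by apply/funext => h; rewrite big_set1.
Qed.

Section centered.
Variables (xi : measurableTypeR R -> R) (B : R).
Hypotheses (B0 : 0 < B) (bxi : bounded_mfun xi) (xiB : forall x, `|xi x| <= B).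
Hypothesis xi0 : (\int[mu]_x xi x)%R = 0.

Lemma exp_moment_centered (lam : R) : `|lam| * B <= 1 / 2 ->
  (\int[mu]_x expR (lam * xi x) <= expR (2 * (lam * B) ^+ 2))%R.
Proof.
move=> lB.
have bl := bmZ lam bxi.
apply: (@le_trans _ _ (\int[mu]_x (1 + (lam * xi x + 2 * (lam * B) ^+ 2)))%R).
  apply: le_Rint; [exact: bm_expR| |move=> x].
    by apply: bmD; [exact: bm_cst|apply: bmD => //; exact: bm_cst].
  have lx : `|lam * xi x| <= `|lam| * B by rewrite normrM ler_wpM2l.
  have h := expR_le_quadratic (le_trans (ler_norm _) (le_trans lx lB)).
  apply: (le_trans h); rewrite -addrA lerD2l lerD2l ler_wpM2l//.
  rewrite -real_normK ?num_real// -[leRHS]real_normK ?num_real//.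
  by rewrite [X in _ <= X ^+ 2]normrM (ger0_norm (ltW B0)) lerXn2r// nnegrE mulr_ge0// ltW.
have bc (c : R) : bounded_mfun (fun _ : measurableTypeR R => c) by exact: bm_cst.
rewrite (RintD mu (bc 1) (bmD bl (bc _))) (RintD mu bl (bc _)) (RintZ mu lam bxi).
by rewrite xi0 !Rint_cst mulr0 add0r expR_ge1Dx.
Qed.

Lemma exp_moment_iid_sum {n} (A : {set 'I_n}) (lam : R) : `|lam| * B <= 1 / 2 ->
  (\int[iid_law mu n]_h expR (lam * \sum_(i in A) xi (tnth h i))
   <= expR (2 * (lam * B) ^+ 2 * #|A|%:R))%R.
Proof.
move=> lB; have := Rint_iid_prod_on A (bm_expR (bmZ lam bxi)).
have -> : (fun h : field n => \prod_(i in A) expR (lam * xi (tnth h i))) =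
   (fun h : field n => expR (lam * \sum_(i in A) xi (tnth h i))).
  by apply/funext => h; rewrite mulr_sumr expR_sum.
move=> ->; rewrite mulrC expRM_natl lerXn2r ?nnegrE ?expR_ge0//.
  by apply: Rintegral_ge0 => x _; exact: expR_ge0.
exact: exp_moment_centered.
Qed.

(** The fourth power is dominated by an exponential, at the scale [sqrt k]
    where the exponential moment of the sum is bounded. *)
Lemma fourth_moment_iid_sum {n} (A : {set 'I_n}) :
  (\int[iid_law mu n]_h (\sum_(i in A) xi (tnth h i)) ^+ 4
   <= 8192 * B ^+ 4 * expR 1 * #|A|%:R ^+ 2)%R.
Proof.
have bS : bounded_mfun (fun h : field n => \sum_(i in A) xi (tnth h i)).
  by apply: bm_sum => i _; exact: bm_tnth.
have [A0|A0] := eqVneq #|A| 0%N.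
  move/cards0_eq: (A0) => ->; rewrite cards0 expr0n /= mulr0.
  under eq_Rintegral do rewrite big_set0 expr0n /=.
  by rewrite Rint_cst.
set k : R := #|A|%:R.
have k0 : 1 <= k by rewrite ler1n lt0n.
set q := Num.sqrt k.
have q0 : 0 < q by rewrite sqrtr_gt0; lra.
have q1 : 1 <= q by rewrite -[X in X <= _]sqrtr1 ler_sqrt//; lra.
have qq : q ^+ 2 = k by rewrite sqr_sqrtr//; lra.
(* this choice gives [2 * (lam * B) ^ 2 * k = 1 / 2] *)
pose lam := (2 * B * q)^-1.
have l0 : 0 < lam by rewrite invr_gt0 !mulr_gt0.
have lBq : lam * B * q = 1 / 2.
  by rewrite /lam; field; rewrite !gt_eqF.
have lB : `|lam| * B <= 1 / 2.
  rewrite ger0_norm ?(ltW l0)// -lBq ler_peMr// mulr_ge0// ltW//.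
have lB' : `|- lam| * B <= 1 / 2 by rewrite normrN.
have E1 := exp_moment_iid_sum A lB; have E2 := exp_moment_iid_sum A lB'.
have e1 : expR (2 * (lam * B) ^+ 2 * #|A|%:R) <= expR 1.
  rewrite ler_expR -/k -qq -mulrA -exprMn lBq; lra.
have {}E2 := le_trans E2 _; have {}E1 := le_trans E1 e1.
have {}E2 : (\int[iid_law mu n]_h expR (- lam * \sum_(i in A) xi (tnth h i)) <= expR 1)%R.
  by apply: E2; rewrite mulNr sqrrN.
have l4 : lam ^+ 4 * (16 * B ^+ 4 * k ^+ 2) = 1.
  by rewrite -qq /lam; field; rewrite !gt_eqF.
have -> : 8192 * B ^+ 4 * expR 1 * k ^+ 2 = (16 * B ^+ 4 * k ^+ 2) * (256 * (expR 1 + expR 1)) by ring.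
apply: (@le_trans _ _ ((16 * B ^+ 4 * k ^+ 2) *
   \int[iid_law mu n]_h (256 * (expR (lam * \sum_(i in A) xi (tnth h i)) +
   expR (- lam * \sum_(i in A) xi (tnth h i)))))%R).
  have b2 : bounded_mfun (fun h : field n => 256 * (expR (lam * \sum_(i in A) xi (tnth h i)) +
   expR (- lam * \sum_(i in A) xi (tnth h i)))).
    by apply: bmZ; apply: bmD; apply: bm_expR; exact: bmZ.
  rewrite -(RintZ _ _ b2); apply: le_Rint; [exact: bmX|exact: bmZ|move=> h].
  set x := \sum_(i in A) _.
  have := expr4_le_expR (lam * x); rewrite -mulNr exprMn => hx.
  have c0 : 0 <= 16 * B ^+ 4 * k ^+ 2.
    by rewrite !mulr_ge0 ?exprn_ge0// ltW// (lt_le_trans _ k0).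
  have := ler_wpM2l c0 hx; apply: le_trans.
  by rewrite mulrA [X in _ <= X * _]mulrC l4 mul1r.
rewrite ler_wpM2l//; first by rewrite !mulr_ge0 ?exprn_ge0 ?(ltW B0)// ltW// (lt_le_trans _ k0).
have b1 := bm_expR (bmZ lam bS); have b2 := bm_expR (bmZ (- lam) bS).
by rewrite (RintZ _ _ (bmD b1 b2)) (RintD _ b1 b2) ler_wpM2l// lerD.
Qed.

Lemma second_moment_iid_sum {n} (A : {set 'I_n}) :
  (\int[iid_law mu n]_h (\sum_(i in A) xi (tnth h i)) ^+ 2
   = #|A|%:R * \int[mu]_x (xi x) ^+ 2)%R.
Proof.
have cov (i j : 'I_n) : (\int[iid_law mu n]_h (xi (tnth h i) * xi (tnth h j)) =
    (i == j)%:R * \int[mu]_x (xi x) ^+ 2)%R.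
  have [<-|ij] := eqVneq i j.
    rewrite mul1r -(Rint_tnth i (bmX 2 bxi)).
    by congr Rintegral; apply/funext => h; rewrite expr2.
  rewrite mul0r; pose f (l : 'I_n) := if (l == i) || (l == j) then xi else fun=> 1.
  have bf l : bounded_mfun (f l) by rewrite /f; case: ifP => _ //; exact: bm_cst.
  have := Rint_iid_prod mu bf.
  rewrite [RHS](bigD1 i)//= {2}/f eqxx /= xi0 mul0r => <-.
  congr Rintegral; apply/funext => h.
  rewrite (bigD1 i)//= (bigD1 j) 1?eq_sym//= big1 ?mulr1.
    by rewrite /f !eqxx orbT.
  by move=> l /andP[li lj]; rewrite /f (negbTE li) (negbTE lj).
have b1 (i j : 'I_n) : bounded_mfun (fun h : field n => xi (tnth h i) * xi (tnth h j)).
  by apply: bmM; exact: bm_tnth.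
transitivity (\sum_(i in A) \sum_(j in A) (\int[iid_law mu n]_h (xi (tnth h i) * xi (tnth h j))))%R.
  under [RHS]eq_bigr do rewrite -Rint_sum//.
  rewrite -Rint_sum; last by move=> i _; exact: bm_sum.
  congr Rintegral; apply/funext => h; rewrite expr2 mulr_suml.
  by apply: eq_bigr => i _; rewrite mulr_sumr.
rewrite (eq_bigr (fun=> (\int[mu]_x (xi x) ^+ 2)%R)).
  by rewrite sumr_const -[LHS]mulr_natl.
move=> i iA; rewrite (bigD1 i)//= cov eqxx mul1r big1 ?addr0// => j /andP[_ ji].
by rewrite cov eq_sym (negbTE ji) mul0r.
Qed.

End centered.
End iid_sums.

(** * Concentration of the magnetization *)

Section averaged.
Context {R : realType} (mu : probability (measurableTypeR R) R) (theta1 : R).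
Context {n : nat} (S : {set 'I_n}).
Local Notation field := (n.-tuple (measurableTypeR R)).
Local Notation e := (clique_energy theta1 S).
Implicit Types (F G : field -> config n -> R).

Lemma bm_gibbs (s : config n) : bounded_mfun (fun h : field => gibbs (e h) s).
Proof.
have me t : measurable_fun setT (fun h : field => e h t).
  rewrite /clique_energy /field_energy; apply: measurable_funD.
    exact: measurable_cst.
  apply: measurable_sum => i; apply: measurable_funM; last exact: measurable_cst.
  exact: measurable_tnth.
split; last first.
  by exists 1 => h; rewrite ger0_norm ?gibbs_ge0// gibbs_le1.
have -> : (fun h : field => gibbs (e h) s) =
   (fun h : field => expR (e h s - ln (\sum_t expR (e h t)))).
  by apply/funext => h; rewrite expRD expRN lnK// posrE partition_gt0.
apply: measurableT_comp => //; apply: measurable_funB => //.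
apply: measurableT_comp; first exact: measurable_ln.
by apply: measurable_sum => t; apply: measurableT_comp.
Qed.

(** Expectation of observables of the field and the configuration together:
    the force of a configuration has to be tested against the disorder. *)
Definition avg F : R :=
  (\int[iid_law mu n]_h \sum_s gibbs (e h) s * F h s)%R.

Definition bounded_obs F : Prop := forall s, bounded_mfun (fun h => F h s).

Lemma bm_quenched F : bounded_obs F -> bounded_mfun (fun h => \sum_s gibbs (e h) s * F h s).
Proof. by move=> bF; apply: bm_sum => s _; apply: bmM; [exact: bm_gibbs|exact: bF]. Qed.

Lemma avgD F G : bounded_obs F -> bounded_obs G -> avg (fun h s => F h s + G h s) = avg F + avg G.
Proof.
move=> bF bG; rewrite /avg -RintD; [|exact: bm_quenched|exact: bm_quenched].
congr Rintegral; apply/funext => h; rewrite -big_split; apply: eq_bigr => s _.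
by rewrite mulrDr.
Qed.

Lemma avgZ (c : R) F : bounded_obs F -> avg (fun h s => c * F h s) = c * avg F.
Proof.
move=> bF; rewrite /avg -RintZ; last exact: bm_quenched.
congr Rintegral; apply/funext => h; rewrite mulr_sumr; apply: eq_bigr => s _.
by rewrite mulrCA.
Qed.

Lemma le_avg F G : bounded_obs F -> bounded_obs G -> (forall h s, F h s <= G h s) -> avg F <= avg G.
Proof.
move=> bF bG FG; apply: le_Rint; [exact: bm_quenched|exact: bm_quenched|move=> h].
by apply: ler_sum => s _; rewrite ler_wpM2l ?gibbs_ge0.
Qed.

Lemma avg_field (g : field -> R) : avg (fun h _ => g h) = (\int[iid_law mu n]_h g h)%R.
Proof.
congr Rintegral; apply/funext => h.
by rewrite -mulr_suml sum_gibbs mul1r.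
Qed.

Lemma avg_cst (c : R) : avg (fun _ _ => c) = c.
Proof. by rewrite avg_field Rint_cst. Qed.

Lemma avg_quenched_le F (g : field -> R) : bounded_obs F -> bounded_mfun g ->
  (forall h, \sum_s gibbs (e h) s * F h s <= g h) ->
  avg F <= (\int[iid_law mu n]_h g h)%R.
Proof. by move=> bF bg Fg; apply: le_Rint => //; exact: bm_quenched. Qed.

Lemma bounded_obs_config (f : config n -> R) : bounded_obs (fun _ s => f s).
Proof. by move=> s; exact: bm_cst. Qed.

Lemma PS_expect (f : config n -> R) :
  \sum_s PS mu theta1 S s * f s = avg (fun _ s => f s).
Proof.
rewrite /avg Rint_sum; last by move=> s _; apply: bmM; [exact: bm_gibbs|exact: bm_cst].
apply: eq_bigr => s _; rewrite mulrC -RintZ; last exact: bm_gibbs.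
by congr Rintegral; apply/funext => h; rewrite mulrC.
Qed.

Lemma PS_ge0 s : 0 <= PS mu theta1 S s.
Proof. by apply: Rintegral_ge0 => h _; exact: gibbs_ge0. Qed.

Lemma sum_PS : \sum_s PS mu theta1 S s = 1.
Proof.
rewrite -(avg_cst 1) -PS_expect; by apply: eq_bigr => s _; rewrite mulr1.
Qed.

End averaged.

(** The null law is the law of an empty clique, so that what is proved for the
    spins outside a clique covers the null. *)
Lemma P0E {R : realType} (mu : probability (measurableTypeR R) R) (theta1 : R) n
  (s : config n) : P0 mu s = PS mu theta1 (finset.set0 : {set _}) s.
Proof.
have e (h : n.-tuple R) : clique_energy theta1 (finset.set0 : {set 'I_n}) h = field_energy h.
  by apply/funext => t; rewrite /clique_energy big_set0 mulr0 add0r.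
rewrite /P0 /PS; apply: eq_Rintegral => h _.
by rewrite e.
Qed.

Section concentration.
Context {R : realType} (mu : probability (measurableTypeR R) R) (theta1 : R).
Hypothesis mu_int : mu.-integrable setT (EFin \o (fun h : R => h)).
Hypothesis theta1_gt0 : 0 < theta1.
Variables (tau : nat) (xs : R).
Hypothesis xs_min : forall x : R, x <> xs ->
      free_energy mu theta1 xs < free_energy mu theta1 x.
Hypothesis xs_flat : has_flatness (free_energy mu theta1) xs tau.
Local Notation H := (free_energy mu theta1).
Let sq := Num.sqrt theta1.
Let sq_gt0 : 0 < sq. Proof. by rewrite sqrtr_gt0. Qed.
Let sqq : sq ^+ 2 = theta1. Proof. by rewrite sqr_sqrtr// ltW. Qed.

(** The scaling for which the limit is the minimizer of [free_energy]. *)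
Definition scaled_mag {n} (S : {set 'I_n}) (s : config n) : R :=
  Num.sqrt theta1 * clique_sum S s / #|S|%:R.

Lemma norm_clique_sum_le {n} (S : {set 'I_n}) (s : config n) :
  `|clique_sum S s| <= #|S|%:R :> R.
Proof.
rewrite /clique_sum (le_trans (ler_norm_sum _ _ _))//.
under eq_bigr do rewrite norm_spin.
by rewrite sumr_const -[_ *+ _]mulr_natl mulr1.
Qed.

Lemma norm_scaled_mag_le {n} (S : {set 'I_n}) (s : config n) :
  `|scaled_mag S s| <= sq.
Proof.
rewrite /scaled_mag normrM normrM (ger0_norm (ltW sq_gt0)) normfV normr_nat.
have [->|S0] := eqVneq #|S| 0%N; first by rewrite invr0 mulr0 ltW.
rewrite -mulrA ler_piMr ?(ltW sq_gt0)// ler_pdivrMr ?ltr0n ?lt0n// mul1r.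
exact: norm_clique_sum_le.
Qed.

Lemma clique_sum_count {n} (S : {set 'I_n}) (s : config n) :
  clique_sum S s = 2 * #|[set i in S | s i]|%:R - #|S|%:R :> R.
Proof.
rewrite /clique_sum -sum1dep_card -[in X in _ - X]sum1_card !natr_sum mulr_sumr.
rewrite big_mkcondr /= -sumrB; apply: eq_bigr => i _.
by rewrite /spin; case: (s i) => /=; lra.
Qed.

(** The loss of a single site in [gibbs_level_le]; its mean is
    [H y - H xs]. *)
Let zeta (y z : R) : R := (y ^+ 2 - xs ^+ 2) / 2 -
  (ln (cosh (sq * y + z)) - ln (cosh (sq * xs + z))).

Let measurable_lncosh (a : R) :
  measurable_fun setT (fun z : measurableTypeR R => ln (cosh (a + z))).
Proof.
by have /measurable_int/measurable_EFinP := integrable_lncosh mu_int a.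
Qed.

Let norm_zeta (y : R) : `|y| <= sq -> forall z, `|zeta y z| <= 3 * theta1.
Proof.
move=> ys z; have xss : `|xs| <= sq by exact: norm_minimizer_le xs_flat.
have h1 : `|ln (cosh (sq * y + z)) - ln (cosh (sq * xs + z))| <= 2 * theta1.
  apply: le_trans (lncosh_lipschitz _ _) _.
  rewrite (_ : _ - _ = sq * (y - xs)); last by ring.
  rewrite normrM (ger0_norm (ltW sq_gt0)) -sqq.
  have := le_trans (ler_normB y xs) (lerD ys xss); have := normr_ge0 (y - xs).
  by move: sq_gt0; nra.
have h2 : `|(y ^+ 2 - xs ^+ 2) / 2| <= theta1.
  have q0 (x : R) : `|x| <= sq -> x ^+ 2 <= theta1.
    by move=> hx; rewrite -sqq -real_normK ?num_real// lerXn2r// nnegrE ltW.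
  have := q0 _ ys; have := q0 _ xss; have := sqr_ge0 y; have := sqr_ge0 xs.
  by move=> a1 a2 a3 a4; rewrite ler_norml; apply/andP; split; lra.
by apply: le_trans (ler_normB _ _) _; lra.
Qed.

Let bm_zeta (y : R) : `|y| <= sq -> bounded_mfun (zeta y : measurableTypeR R -> R).
Proof.
move=> ys; split; last by exists (3 * theta1) => z; exact: norm_zeta.
apply: measurable_funB; first exact: measurable_cst.
by apply: measurable_funB; exact: measurable_lncosh.
Qed.

Let mean_zeta (y : R) : `|y| <= sq -> (\int[mu]_z zeta y z)%R = H y - H xs.
Proof.
move=> ys; have i1 := integrable_lncosh mu_int (sq * y).
have i2 := integrable_lncosh mu_int (sq * xs).
rewrite RintegralB//; last 2 first.
- exact: bm_integrable (bm_cst _).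
- exact: rintegrableB.
rewrite Rint_cst RintegralB// /free_energy -/sq.
set I1 := (\int[mu]_x ln (cosh (sq * y + x)))%R.
set I2 := (\int[mu]_x ln (cosh (sq * xs + x)))%R.
by move: I1 I2 => I1 I2; lra.
Qed.

(** Each of the [k + 1] values of the clique sum away from the minimizer is
    exponentially unlikely: [gibbs_level_le] bounds it by the exponential of
    an i.i.d. sum of positive mean, and [expR (- u * zeta)] has mean below one
    for small [u]. *)
Lemma scaled_mag_concentration (r : R) : 0 < r -> exists2 a : R, 0 < a &
  forall n (S : {set 'I_n}), (0 < #|S|)%N ->
  \sum_s PS mu theta1 S s * (r <= `|scaled_mag S s - xs|)%R%:R <=
  #|S|.+1%:R * expR (- a * #|S|%:R).
Proof.
move=> r0; have [eta eta0 gap] := free_energy_gap mu_int xs_min r0.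
pose B := 3 * theta1; have B0 : 0 < B by rewrite mulr_gt0.
(* [u * B <= 1 / 2] allows the quadratic bound on the exponential, and the
   gain [u * eta] is at least twice the quadratic error *)
pose u := Num.min 1 (Num.min (1 / (2 * B)) (eta / (4 * B ^+ 2))).
have u0 : 0 < u by rewrite !lt_min ltr01 !divr_gt0// ?mulr_gt0// exprn_gt0.
have u1 : u <= 1 by rewrite ge_min lexx.
have uB : u * B <= 1 / 2.
  have : u <= 1 / (2 * B) by rewrite !ge_min lexx !orbT.
  by rewrite ler_pdivlMr ?mulr_gt0//; lra.
have uB2 : 2 * u ^+ 2 * B ^+ 2 <= u * eta / 2.
  have : u <= eta / (4 * B ^+ 2) by rewrite !ge_min lexx !orbT.
  rewrite ler_pdivlMr ?mulr_gt0 ?exprn_gt0// => h.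
  have := ler_wpM2l (ltW u0) h; lra.
exists (u * eta / 2); first by rewrite divr_gt0// mulr_gt0.
move=> n S S0; set k := #|S|.
have mgf (y : R) : `|y| <= sq -> r <= `|y - xs| ->
    (\int[mu]_z expR (- u * zeta y z) <= expR (- (u * eta / 2)))%R.
  move=> ys ry.
  have bz := bm_zeta ys; have bu := bmZ (- u) bz.
  have bc (c : R) : bounded_mfun (fun _ : measurableTypeR R => c) by exact: bm_cst.
  apply: (@le_trans _ _ (\int[mu]_z (1 + (- u * zeta y z + 2 * u ^+ 2 * B ^+ 2)))%R).
    apply: le_Rint; [exact: bm_expR| |move=> z].
      by apply: bmD => //; apply: bmD.
    have zB := norm_zeta ys z; rewrite -/B in zB.
    have h : `|- u * zeta y z| <= u * B.
      by rewrite normrM normrN (ger0_norm (ltW u0)) ler_wpM2l// ltW.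
    apply: (le_trans (expR_le_quadratic (le_trans (ler_norm _) (le_trans h uB)))).
    rewrite -addrA lerD2l lerD2l -mulrA ler_wpM2l// -exprMn.
    by rewrite -real_normK ?num_real// lerXn2r// nnegrE mulr_ge0// ltW.
  rewrite (RintD mu (bc 1) (bmD bu (bc _))) (RintD mu bu (bc _)) (RintZ mu (- u) bz).
  rewrite mean_zeta// !Rint_cst.
  have := expR_ge1Dx (- (u * eta / 2)); apply: le_trans.
  have := ler_wpM2l (ltW u0) (gap y ys ry); move: (H y - H xs) => D; lra.
rewrite PS_expect.
pose x (j : nat) : R := 2 * j%:R - k%:R; pose y j := sq * x j / k%:R.
pose G (j : 'I_k.+1) (h : n.-tuple (measurableTypeR R)) :=
  (r <= `|y j - xs|)%R%:R * expR (- u * \sum_(i in S) zeta (y j) (tnth h i)).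
have k0 : 0 < k%:R :> R by rewrite ltr0n.
have ysq (j : 'I_k.+1) : `|y j| <= sq.
  rewrite /y normrM normrM (ger0_norm (ltW sq_gt0)) normfV normr_nat.
  rewrite -mulrA ler_piMr ?(ltW sq_gt0)// ler_pdivrMr// mul1r /x.
  have : (j%:R : R) <= k%:R by rewrite ler_nat -ltnS.
  have : 0 <= (j%:R : R) by [].
  by move=> a b; rewrite ler_norml; apply/andP; split; lra.
have bZ (j : 'I_k.+1) : bounded_mfun (fun h : n.-tuple (measurableTypeR R) =>
    \sum_(i in S) zeta (y j) (tnth h i)).
  by apply: bm_sum => i _; apply: bm_tnth; exact: bm_zeta.
have bG j : bounded_mfun (G j) by apply: bmZ; apply: bm_expR; exact: bmZ.
apply: (@le_trans _ _ (\int[iid_law mu n]_h \sum_j G j h)%R).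
  apply: avg_quenched_le; [exact: bounded_obs_config|exact: bm_sum|move=> h].
  (* the values of the clique sum are indexed by the number of positive spins *)
  pose N (s : config n) : 'I_k.+1 := inord #|[set i in S | s i]|.
  have NE s : N s = #|[set i in S | s i]| :> nat.
    rewrite /N inordK// ltnS; apply: subset_leq_card; apply/fintype.subsetP => i.
    by rewrite inE => /andP[].
  rewrite (partition_big N xpredT)//=; apply: ler_sum => j _.
  have Nj s : N s == j -> clique_sum S s = x j.
    by move=> /eqP <-; rewrite clique_sum_count /x NE.
  rewrite /G; have [rj|rj] := boolP (r <= `|y j - xs|); last first.
    rewrite mul0r big1// => s /Nj xj.
    by rewrite /scaled_mag xj -/sq -/k -/(y j) (negbTE rj) mulr0.
  rewrite mul1r; set E := expR _.
  apply: (@le_trans _ _ (\sum_(s | clique_sum S s == x j) gibbs (clique_energy theta1 S h) s)).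
    rewrite [leRHS](bigID (fun s => N s == j)) /= ler_wpDr//.
      by apply: sumr_ge0 => s _; exact: gibbs_ge0.
    rewrite [leRHS](eq_bigl (fun s => N s == j)); last first.
      by move=> s; rewrite andb_idl// => /Nj ->.
    by apply: ler_sum => s _; rewrite ler_piMr ?gibbs_ge0// lern1 leq_b1.
  set L := leLHS.
  have L1 : L <= 1.
    rewrite -(sum_gibbs (clique_energy theta1 S h)) [leRHS](bigID (fun s => clique_sum S s == x j)) /=.
    by rewrite lerDl sumr_ge0// => s _; exact: gibbs_ge0.
  have L2 : L <= expR (- \sum_(i in S) zeta (y j) (tnth h i)).
    by have := gibbs_level_le h theta1_gt0 (x j) xs S0; rewrite sumrN.
  (* [min 1 (expR (- Z)) <= expR (- u * Z)] for [0 <= u <= 1], whatever the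
     sign of [Z] *)
  rewrite /E; have [A0|A0] := leP 0 (\sum_(i in S) zeta (y j) (tnth h i)).
    apply: (le_trans L2); rewrite ler_expR mulNr lerN2.
    by rewrite ler_piMl.
  apply: (le_trans L1); rewrite -expR0 ler_expR mulNr oppr_ge0.
  by rewrite mulr_ge0_le0// ltW.
rewrite Rint_sum//.
apply: (@le_trans _ _ (\sum_(j < k.+1) expR (- (u * eta / 2) * k%:R))); last first.
  by rewrite sumr_const card_ord -[leLHS]mulr_natl.
apply: ler_sum => j _.
rewrite RintZ; last by apply: bm_expR; exact: bmZ.
have [rj|rj] := boolP (r <= `|y j - xs|); last by rewrite mul0r expR_ge0.
rewrite mul1r.
have := Rint_iid_prod_on mu S (bm_expR (bmZ (- u) (bm_zeta (ysq j)))).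
have -> : (fun h : n.-tuple (measurableTypeR R) => \prod_(i in S) expR (- u * zeta (y j) (tnth h i))) =
   (fun h => expR (- u * \sum_(i in S) zeta (y j) (tnth h i))).
  by apply/funext => h; rewrite mulr_sumr expR_sum.
move=> ->; rewrite mulrC expRM_natl lerXn2r ?nnegrE ?expR_ge0//.
  by apply: Rintegral_ge0 => z _; exact: expR_ge0.
exact: mgf.
Qed.

End concentration.

(** * The random mean-field equation *)

Section fluctuation_expansion.
Context {R : realType} (mu : probability (measurableTypeR R) R) (theta1 : R).
Hypothesis theta1_gt0 : 0 < theta1.
Let sq := Num.sqrt theta1.
Let sq_gt0 : 0 < sq. Proof. by rewrite sqrtr_gt0. Qed.
Let sqq : sq ^+ 2 = theta1. Proof. by rewrite sqr_sqrtr// ltW. Qed.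

(** The centered contribution of a site with field [z] to the random
    mean-field equation, and its derivatives in the magnetization. *)
Definition site_residual (j : nat) (z x : R) : R :=
  Num.sqrt theta1 ^+ j * ((iter j dtanh 'X).[tanh (Num.sqrt theta1 * x + z)] -
    smooth_tanh mu (Num.sqrt theta1) (iter j dtanh 'X) x).

Lemma is_derive_site_residual j (z x : R) :
  is_derive x 1 (site_residual j z) (site_residual j.+1 z x).
Proof.
pose p : {poly R} := iter j dtanh 'X.
have h1 : is_derive x 1 (fun y : R => p.[tanh (sq * y + z)])
    (sq * (dtanh p).[tanh (sq * x + z)]).
  have ha : is_derive x 1 (fun y : R => sq * y + z) sq.
    rewrite (_ : (fun y : R => sq * y + z) = sq *: (id : R -> R) + cst z)//.
    by apply: is_derive_eq; rewrite /GRing.scale /= mulr1 addr0.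
  have := @is_derive1_comp R (fun y => p.[tanh y]) (fun y : R => sq * y + z) x _ _
    (is_derive_poly_tanh p (sq * x + z)) ha.
  by move/is_derive_eq; apply; rewrite mulrC.
have h2 := is_derive_smooth_tanh mu sq p x.
rewrite (_ : site_residual j z = sq ^+ j *:
  ((fun y : R => p.[tanh (sq * y + z)]) - smooth_tanh mu sq p))//.
apply: is_derive_eq; rewrite /GRing.scale /= /site_residual iterS -/p -/sq exprSr; ring.
Qed.

Lemma site_residual_bounded j : exists2 B : R, 0 < B &
  forall z x, `|site_residual j z x| <= B.
Proof.
have [B1 h1] := poly_tanh_bounded (R := R) (iter j dtanh 'X).
have [B2 h2] := smooth_tanh_bounded mu sq (iter j dtanh 'X).
have B10 : 0 <= B1 by apply: le_trans (h1 0).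
have B20 : 0 <= B2 by apply: le_trans (h2 0).
have s0 : 0 <= sq ^+ j by rewrite exprn_ge0// ltW.
exists (sq ^+ j * (B1 + B2) + 1); first by rewrite ltr_wpDl// mulr_ge0// addr_ge0.
move=> z x; rewrite /site_residual -/sq normrM (ger0_norm s0).
rewrite (@le_trans _ _ (sq ^+ j * (B1 + B2)))//; last by rewrite lerDl.
by rewrite ler_wpM2l// (le_trans (ler_normB _ _))// lerD.
Qed.

Lemma bm_site_residual j (x : R) :
  bounded_mfun (fun z : measurableTypeR R => site_residual j z x).
Proof.
by apply: bmZ; apply: bmB; [exact: bm_poly_tanh|exact: bm_cst].
Qed.

Lemma mean_site_residual j (x : R) : (\int[mu]_z site_residual j z x = 0)%R.
Proof.
have b1 := bm_poly_tanh (iter j dtanh 'X) (sq * x).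
rewrite /site_residual -/sq RintZ; last by apply: bmB => //; exact: bm_cst.
rewrite RintB//; last exact: bm_cst.
by rewrite Rint_cst /smooth_tanh subrr mulr0.
Qed.

Variables (xs : R).

(** The Taylor coefficients at [xs] of the sum of the site residuals. The
    coefficient of order zero is the disorder in the mean-field equation. *)
Definition residual_coef {n} (S : {set 'I_n}) (j : nat)
    (h : n.-tuple (measurableTypeR R)) : R :=
  \sum_(i in S) site_residual j (tnth h i) xs / j`!%:R.

Lemma bm_residual_coef {n} (S : {set 'I_n}) j : bounded_mfun (residual_coef S j).
Proof.
apply: bm_sum => i _.
apply: (@bm_tnth _ _ i (fun z => site_residual j z xs / j`!%:R)).
by apply: bmM; [exact: bm_site_residual|exact: bm_cst].
Qed.

Lemma residual_coef_moments j : exists2 C : R, 0 < C &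
  forall n (S : {set 'I_n}), [/\
   forall h, `|residual_coef S j h| <= C * #|S|%:R,
   (\int[iid_law mu n]_h residual_coef S j h = 0)%R,
   (\int[iid_law mu n]_h residual_coef S j h ^+ 2 <= C * #|S|%:R)%R &
   (\int[iid_law mu n]_h residual_coef S j h ^+ 4 <= C * #|S|%:R ^+ 2)%R].
Proof.
have [B B0 hB] := site_residual_bounded j.
pose xi (z : measurableTypeR R) := site_residual j z xs / j`!%:R.
have bxi : bounded_mfun xi by apply: bmM; [exact: bm_site_residual|exact: bm_cst].
have f1 : 1 <= j`!%:R :> R by rewrite ler1n fact_gt0.
have xiB z : `|xi z| <= B.
  rewrite /xi normrM normfV normr_nat (le_trans _ (hB z xs))//.
  by rewrite ler_pdivrMr ?ler_peMr// (lt_le_trans _ f1).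
have xi0 : (\int[mu]_z xi z = 0)%R.
  rewrite /xi; under eq_Rintegral do rewrite mulrC.
  by rewrite RintZ ?mean_site_residual ?mulr0//; exact: bm_site_residual.
have [K K0 hK] : exists2 K : R, 0 <= K & forall n (S : {set 'I_n}),
    (\int[iid_law mu n]_h (\sum_(i in S) xi (tnth h i)) ^+ 4 <= K * #|S|%:R ^+ 2)%R.
  exists (8192 * B ^+ 4 * expR 1); last exact: fourth_moment_iid_sum.
  apply: mulr_ge0; last exact: expR_ge0.
  by apply: mulr_ge0; [exact: ler0n|apply: exprn_ge0; exact: ltW].
exists (B + B ^+ 2 + K).
  by rewrite ltr_wpDr// addr_gt0// exprn_gt0.
move=> n S; have k0 : 0 <= #|S|%:R :> R by [].
have q2 : 0 <= B ^+ 2 by rewrite exprn_ge0// ltW.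
split.
- move=> h; apply: (@le_trans _ _ (B * #|S|%:R)); last first.
    by rewrite ler_wpM2r// -addrA lerDl addr_ge0.
  rewrite (le_trans (ler_norm_sum _ _ _))// (@le_trans _ _ (\sum_(i in S) B))//.
    by apply: ler_sum => i _; exact: xiB.
  by rewrite sumr_const -[leLHS]mulr_natr.
- rewrite Rint_sum; last by move=> i _; exact: bm_tnth bxi.
  by rewrite big1// => i _; rewrite (Rint_tnth mu i bxi).
- rewrite (second_moment_iid_sum bxi xi0) mulrC ler_wpM2r//.
  apply: (@le_trans _ _ (B ^+ 2)); last by rewrite -addrA addrCA lerDl addr_ge0// ltW.
  rewrite -[leRHS](Rint_cst mu); apply: le_Rint; [exact: bmX|exact: bm_cst|move=> z].
  by rewrite -real_normK ?num_real// lerXn2r// nnegrE// ltW.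
- apply: le_trans (hK n S) _.
  rewrite ler_wpM2r ?exprn_ge0// lerDr addr_ge0// ltW//.
Qed.

(** The force minus [clique_defect] is the sum of the conditional means of the
    clique spins, the [tanh] of their local fields, minus [k] times [mean_tanh
    mu (sq * x)]. Replacing each local field by the common one [sq * x + tnth
    h i] costs a bounded error; what remains is the sum of the site residuals
    at [x], expanded at [xs]. The terms of positive order carry a factor [|x -
    xs|]. *)
Lemma mean_field_expansion (N : nat) : exists2 C : R, 0 < C &
  forall n (S : {set 'I_n}) (h : n.-tuple (measurableTypeR R)) (s : config n),
  (0 < #|S|)%N -> `|xs| <= sq ->
  let D := `|scaled_mag theta1 S s - xs| in
  `|#|S|%:R / sq * free_energy_deriv mu theta1 1 (scaled_mag theta1 S s)
    - clique_defect theta1 S h s - residual_coef S 0 h|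
  <= theta1 + C * D * ((\sum_(j < N) `|residual_coef S j.+1 h|) + #|S|%:R * D ^+ N).
Proof.
have [B B0 hB] := site_residual_bounded N.+1.
pose c := (1 + 2 * sq) ^+ N.
have c1 : 1 <= c by rewrite exprn_ege1// lerDl mulr_ge0// ltW.
exists (c + B); first by rewrite addr_gt0// (lt_le_trans ltr01).
move=> n S h s S0 xss; rewrite /=; set D := `|scaled_mag theta1 S s - xs|.
set x := scaled_mag theta1 S s; set k : R := #|S|%:R.
have k0 : 0 < k by rewrite ltr0n.
have D0 : 0 <= D by exact: normr_ge0.
have D2 : D <= 1 + 2 * sq.
  have := le_trans (ler_normB x xs) (lerD (norm_scaled_mag_le theta1_gt0 S s) xss).
  by rewrite -/sq -/D; lra.
have sx : sq * x = theta1 / k * clique_sum S s.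
  by rewrite /x /scaled_mag -/sq -/k -sqq; field; rewrite gt_eqF.
have -> : k / sq * free_energy_deriv mu theta1 1 x - clique_defect theta1 S h s
    - residual_coef S 0 h =
  \sum_(i in S) (tanh (local_field theta1 S h i s) - tanh (sq * x + tnth h i)) +
  \sum_(i in S) (site_residual 0 (tnth h i) x - site_residual 0 (tnth h i) xs).
  rewrite free_energy_deriv1E -/sq.
  have -> : k / sq * (x - sq * mean_tanh mu (sq * x)) =
      clique_sum S s - k * mean_tanh mu (sq * x).
    by rewrite /x /scaled_mag -/sq -/k; field; rewrite !gt_eqF.
  rewrite /clique_defect /residual_coef /clique_sum /spin_defect /site_residual.
  have -> : k * mean_tanh mu (sq * x) = \sum_(i in S) mean_tanh mu (sq * x).
    by rewrite sumr_const -[RHS]mulr_natl.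
  rewrite -!sumrB -big_split /=; apply: eq_bigr => i _.
  rewrite !expr0 !mul1r !hornerX fact0 divr1 -/sq.
  have -> : smooth_tanh mu sq 'X x = mean_tanh mu (sq * x).
    by apply: eq_Rintegral => z _; rewrite hornerX.
  by ring.
apply: le_trans (ler_normD _ _) _; apply: lerD.
  rewrite (le_trans (ler_norm_sum _ _ _))//.
  (* the self-interaction excluded from a local field is of size [theta1 / k] *)
  apply: (@le_trans _ _ (\sum_(i in S) theta1 / k)); last first.
    by rewrite sumr_const -[leLHS]mulr_natl -/k mulrCA divff ?mulr1// gt_eqF.
  apply: ler_sum => i iS; apply: le_trans (tanh_lipschitz _ _) _.
  rewrite /local_field iS sx (clique_sumD1 s iS) -/k.
  rewrite (_ : _ - _ = - (theta1 / k * spin R (s i))); last by ring.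
  by rewrite normrN normrM norm_spin mulr1 ger0_norm// divr_ge0// ltW.
have taylor i : `|site_residual 0 (tnth h i) x - site_residual 0 (tnth h i) xs
   - \sum_(j < N) site_residual j.+1 (tnth h i) xs / j.+1`!%:R * (x - xs) ^+ j.+1|
   <= B * D ^+ N.+1.
  have := taylor_tower xs (fun j => is_derive_site_residual j (tnth h i)) (hB (tnth h i)) x.
  by rewrite big_ord_recl /= fact0 divr1 expr0 mulr1 opprD addrA.
have -> : \sum_(i in S) (site_residual 0 (tnth h i) x - site_residual 0 (tnth h i) xs) =
  \sum_(i in S) (site_residual 0 (tnth h i) x - site_residual 0 (tnth h i) xs
   - \sum_(j < N) site_residual j.+1 (tnth h i) xs / j.+1`!%:R * (x - xs) ^+ j.+1)
  + \sum_(j < N) residual_coef S j.+1 h * (x - xs) ^+ j.+1.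
  rewrite [in RHS]sumrB -addrA; apply/eqP; rewrite eq_sym -subr_eq0 addrAC subrr add0r; apply/eqP.
  rewrite exchange_big /= -sumrN -big_split big1//= => j _.
  by rewrite /residual_coef mulr_suml addNr.
apply: le_trans (ler_normD _ _) _.
have -> : (c + B) * D * (\sum_(j < N) `|residual_coef S j.+1 h| + k * D ^+ N) =
  (c + B) * D * (k * D ^+ N) + (c + B) * D * \sum_(j < N) `|residual_coef S j.+1 h| by ring.
apply: lerD.
  rewrite (le_trans (ler_norm_sum _ _ _))//.
  apply: (@le_trans _ _ (\sum_(i in S) B * D ^+ N.+1)); first exact: ler_sum.
  rewrite sumr_const -[leLHS]mulr_natl -/k exprS.
  rewrite (_ : k * (B * (D * D ^+ N)) = B * (D * (k * D ^+ N))); last by ring.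
  by rewrite -mulrA ler_wpM2r ?lerDr ?(le_trans _ c1)// !mulr_ge0 ?exprn_ge0// ltW.
rewrite (le_trans (ler_norm_sum _ _ _))// mulr_sumr; apply: ler_sum => j _.
rewrite normrM normrX -/D mulrC ler_wpM2r//.
rewrite exprS mulrC ler_wpM2r//.
apply: (@le_trans _ _ c); last by rewrite lerDl ltW.
apply: (@le_trans _ _ ((1 + 2 * sq) ^+ j)); first by rewrite lerXn2r// nnegrE (le_trans D0).
by rewrite ler_weXn2l ?lerDl ?mulr_ge0 ?(ltW sq_gt0)// ltnW.
Qed.

End fluctuation_expansion.

(** * The scale of the fluctuations *)

Section disorder_fluctuations.
Context {R : realType} (mu : probability (measurableTypeR R) R) (theta1 : R).
Hypothesis mu_int : mu.-integrable setT (EFin \o (fun h : R => h)).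
Hypothesis theta1_gt0 : 0 < theta1.
Variables (tau : nat) (xs : R).
Hypothesis noncentered : (\int[mu]_h tanh h)%R <> 0.
Hypothesis xs_min : forall x : R, x <> xs ->
      free_energy mu theta1 xs < free_energy mu theta1 x.
Hypothesis xs_flat : has_flatness (free_energy mu theta1) xs tau.
Hypothesis tau_ge2 : (2 <= tau)%N.
Let sq := Num.sqrt theta1.
Let sq_gt0 : 0 < sq. Proof. by rewrite sqrtr_gt0. Qed.
Let xss : `|xs| <= sq. Proof. exact: norm_minimizer_le xs_flat. Qed.
Local Notation p := (2 * tau).-1.
Local Notation field n := (n.-tuple (measurableTypeR R)).
Local Notation E := (avg mu theta1).

Definition mag_dev {n} (S : {set 'I_n}) (s : config n) : R :=
  `|scaled_mag theta1 S s - xs|.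

(** The derivative of the free energy, in the normalization that makes it
    comparable with [clique_defect] and [residual_coef]. *)
Definition mag_force {n} (S : {set 'I_n}) (s : config n) : R :=
  #|S|%:R / Num.sqrt theta1 * free_energy_deriv mu theta1 1 (scaled_mag theta1 S s).

Definition mag_power {n} (S : {set 'I_n}) (s : config n) : R :=
  #|S|%:R * mag_dev S s ^+ p.

Definition residual_corrections {n} (S : {set 'I_n}) (h : field n) : R :=
  \sum_(j < p) `|residual_coef mu theta1 xs S j.+1 h|.

Local Notation A S := (residual_coef mu theta1 xs S 0).
Local Notation T S h s := (clique_defect theta1 S h s).
Local Notation W S := (residual_corrections S).
Local Notation V S := (mag_power S).
Local Notation G S := (mag_force S).

Lemma mag_dev_ge0 {n} (S : {set 'I_n}) s : 0 <= mag_dev S s.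
Proof. exact: normr_ge0. Qed.

Lemma mag_dev_le {n} (S : {set 'I_n}) s : mag_dev S s <= 2 * sq.
Proof.
have := le_trans (ler_normB (scaled_mag theta1 S s) xs) (lerD (norm_scaled_mag_le theta1_gt0 S s) xss).
by rewrite /mag_dev -/sq; lra.
Qed.

Lemma mag_power_ge0 {n} (S : {set 'I_n}) s : 0 <= V S s.
Proof. by rewrite mulr_ge0// exprn_ge0// mag_dev_ge0. Qed.

Lemma mag_power_le {n} (S : {set 'I_n}) s : V S s <= (2 * sq) ^+ p * #|S|%:R.
Proof.
rewrite /mag_power mulrC ler_wpM2r// lerXn2r ?nnegrE ?mag_dev_ge0 ?mag_dev_le//.
by rewrite mulr_ge0// ltW.
Qed.

Lemma residual_corrections_ge0 {n} (S : {set 'I_n}) h : 0 <= W S h.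
Proof. by apply: sumr_ge0. Qed.

Lemma bounded_obs_clique_defect {n} (S : {set 'I_n}) : bounded_obs (fun h s => T S h s).
Proof.
move=> s; apply: bm_sum => i _; apply: bmB; first exact: bm_cst.
apply: (bm_comp_continuous (@continuous_tanh R) (@norm_tanh_le1 R)).
by apply: measurable_funD; [exact: measurable_cst|exact: measurable_tnth].
Qed.

Lemma bm_residual_corrections {n} (S : {set 'I_n}) : bounded_mfun (W S).
Proof. by apply: bm_sum => j _; apply: bm_norm; exact: bm_residual_coef. Qed.

Lemma residual_corrections_moments : exists2 C : R, 0 < C &
  forall n (S : {set 'I_n}),
   (forall h, W S h <= C * #|S|%:R) /\
   (\int[iid_law mu n]_h W S h ^+ 2 <= C * #|S|%:R)%R.
Proof.
have /choice[C hC] : forall j : 'I_p, exists C : R, 0 < C /\ forall n (S : {set 'I_n}),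
    (forall h, `|residual_coef mu theta1 xs S j.+1 h| <= C * #|S|%:R) /\
    (\int[iid_law mu n]_h residual_coef mu theta1 xs S j.+1 h ^+ 2 <= C * #|S|%:R)%R.
  move=> j; have [C C0 hC] := residual_coef_moments mu theta1_gt0 xs j.+1.
  by exists C; split => // n S; have [] := hC n S.
pose Ct := \sum_j C j.
have Ct0 : 0 <= Ct by apply: sumr_ge0 => j _; apply: ltW; case: (hC j).
exists ((1 + p%:R) * Ct + 1); first by rewrite ltr_wpDl// mulr_ge0// addr_ge0.
move=> n S; have k0 : 0 <= #|S|%:R :> R by [].
have le1 : Ct * #|S|%:R <= ((1 + p%:R) * Ct + 1) * #|S|%:R.
  rewrite ler_wpM2r// mulrDl mul1r -addrA lerDl addr_ge0// mulr_ge0//.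
split => [h|].
  apply: le_trans le1; rewrite mulr_suml; apply: ler_sum => j _.
  by have [_ /(_ n S)[h1 _]] := hC j; exact: h1.
apply: (@le_trans _ _ (\int[iid_law mu n]_h (p%:R * \sum_(j < p) residual_coef mu theta1 xs S j.+1 h ^+ 2))%R).
  apply: le_Rint => [||h]; [apply: bmX; exact: bm_residual_corrections| |exact: sqr_sum_le].
  by apply: bmZ; apply: bm_sum => j _; apply: bmX; exact: bm_residual_coef.
have bC (j : 'I_p) : bounded_mfun (fun h : field n => residual_coef mu theta1 xs S j.+1 h ^+ 2).
  by apply: bmX; exact: bm_residual_coef.
rewrite RintZ; last exact: bm_sum.
rewrite Rint_sum//; apply: (@le_trans _ _ (p%:R * (Ct * #|S|%:R))).
  rewrite ler_wpM2l// mulr_suml; apply: ler_sum => j _.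
  by have [_ /(_ n S)[_ h2]] := hC j; exact: h2.
by rewrite mulrA ler_wpM2r// mulrDl mul1r [Ct + _]addrC -addrA lerDl addr_ge0.
Qed.

Lemma clique_defect_moment {n} (S : {set 'I_n}) :
  E S (fun h s => T S h s ^+ 2) <= (4 + 2 * theta1) * #|S|%:R.
Proof.
have := @avg_quenched_le R mu theta1 n S (fun h s => T S h s ^+ 2)
  (fun=> (4 + 2 * theta1) * #|S|%:R).
rewrite Rint_cst; apply.
- by move=> s; apply: bmX; exact: bounded_obs_clique_defect.
- exact: bm_cst.
- by move=> h; exact: clique_defect_second_moment.
Qed.

Lemma avg_far (r : R) : 0 < r -> exists2 a : R, 0 < a &
  forall n (S : {set 'I_n}), (0 < #|S|)%N ->
  E S (fun _ s => (r <= mag_dev S s)%R%:R) <=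
  #|S|.+1%:R * expR (- a * #|S|%:R).
Proof.
move=> r0; have [a a0 ha] := scaled_mag_concentration mu_int theta1_gt0 xs_min xs_flat r0.
by exists a => // n S S0; rewrite -PS_expect; exact: ha.
Qed.

(** Near [xs] the growth of [H'] bounds [k |x - xs| ^ (2 tau - 1)] by the
    force, hence by [T], [A] and corrections of order [sqrt k]; away from [xs]
    the exponential concentration beats every power of [k]. *)
Lemma mag_power_moment : exists2 C : R, 0 < C &
  forall n (S : {set 'I_n}), (0 < #|S|)%N ->
  E S (fun _ s => V S s ^+ 2) <= C * #|S|%:R.
Proof.
have [c [r0 [c0 r00 growth]]] := free_energy_deriv1_growth mu_int theta1_gt0 xs_flat.
have [C C0 hexp] := mean_field_expansion mu theta1_gt0 xs p.
have [CA CA0 hA] := residual_coef_moments mu theta1_gt0 xs 0.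
have [CW CW0 hW] := residual_corrections_moments.
(* for [|x - xs| <= r] the correction in [V] is at most half of the lower
   bound on the force *)
pose r := Num.min r0 (c / (2 * sq * C)).
have r_gt0 : 0 < r by rewrite lt_min r00 divr_gt0// !mulr_gt0.
have rr0 : r <= r0 by rewrite ge_min lexx.
have rC : C * r <= c / (2 * sq).
  have : r <= c / (2 * sq * C) by rewrite ge_min lexx orbT.
  rewrite !ler_pdivlMr ?mulr_gt0//; by rewrite (_ : r * (2 * sq * C) = C * r * (2 * sq))//; ring.
have [a a0 hfar] := avg_far r_gt0.
have [C3 C30 hC3] := poly_expR_bounded 3 a0.
pose K := 2 * sq / c * (1 + theta1 + C * r).
have K0 : 0 < K.
  by rewrite mulr_gt0 ?divr_gt0 ?mulr_gt0// !addr_gt0// mulr_gt0.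
exists (4 * K ^+ 2 * (4 + 2 * theta1 + CA + CW + 1) + (2 * sq) ^+ p ^+ 2 * C3).
  rewrite ltr_pwDl//; last by rewrite mulr_ge0 ?sqr_ge0// ltW.
  have t0 : 0 < 4 + 2 * theta1 + CA + CW + 1 by move: theta1_gt0; lra.
  by apply: mulr_gt0 => //; apply: mulr_gt0 => //; exact: exprn_gt0.
move=> n S S0; have k1 : 1 <= #|S|%:R :> R by rewrite ler1n.
set k : R := #|S|%:R in k1 *.
have k0 : 0 < k by exact: lt_le_trans k1.
have pw (h : field n) s : V S s ^+ 2 <=
    4 * K ^+ 2 * (T S h s ^+ 2 + (A S h ^+ 2 + (W S h ^+ 2 + 1))) +
    (2 * sq) ^+ p ^+ 2 * k ^+ 2 * (r <= mag_dev S s)%R%:R.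
  have V0 := mag_power_ge0 S s; have W0 := residual_corrections_ge0 S h.
  have [far|/ltW near] := leP r (mag_dev S s).
    rewrite mulr1 ler_wpDl//.
      apply: mulr_ge0; first by rewrite mulr_ge0 ?sqr_ge0.
      by rewrite !addr_ge0 ?sqr_ge0.
    by rewrite -exprMn lerXn2r ?nnegrE ?mag_power_le// !mulr_ge0 ?exprn_ge0 ?(ltW k0)// mulr_ge0// ltW.
  rewrite mulr0 addr0.
  have e1 := hexp n S h s S0 xss; rewrite /= -/sq -/(mag_dev S s) in e1.
  have e2 := growth _ (le_trans near rr0).
  have e3 : c / sq * V S s <= `|G S s|.
    rewrite /mag_force /mag_power -/sq -/k normrM (ger0_norm (_ : 0 <= k / sq)); last first.
      by rewrite divr_ge0// ltW.
    have kq : 0 <= k / sq by rewrite divr_ge0// ltW.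
    have := ler_wpM2l kq e2; apply: le_trans.
    by apply: le_of_eq; rewrite /mag_dev; field; rewrite gt_eqF.
  have e4 : `|G S s| <= `|T S h s| + `|A S h| + theta1 + C * r * W S h + c / (2 * sq) * V S s.
    have -> : G S s = T S h s + A S h + (G S s - T S h s - A S h) by ring.
    apply: le_trans (ler_normD _ _) _.
    rewrite -[leRHS]addrA -[leRHS]addrA; apply: lerD; first exact: ler_normD.
    apply: (le_trans e1); rewrite lerD2l -/(W S h) -/k -/(V S s) mulrDr; apply: lerD.
      by rewrite ler_wpM2r// ler_wpM2l// ltW.
    rewrite ler_wpM2r//; apply: le_trans rC; by rewrite ler_wpM2l// ltW.
  have e5 : V S s <= K * (`|T S h s| + `|A S h| + W S h + 1).
    have h1 : c / sq * V S s = c / (2 * sq) * V S s + c / (2 * sq) * V S s.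
      by field; rewrite gt_eqF.
    have h2 : c / (2 * sq) * V S s <= `|T S h s| + `|A S h| + theta1 + C * r * W S h.
      by move: e3 e4; rewrite h1; lra.
    have h3 : V S s <= 2 * sq / c * (`|T S h s| + `|A S h| + theta1 + C * r * W S h).
      have q0 : 0 <= 2 * sq / c by rewrite divr_ge0 ?mulr_ge0// ltW.
      have := ler_wpM2l q0 h2; apply: le_trans.
      by apply: le_of_eq; field; rewrite !gt_eqF.
    apply: (le_trans h3); rewrite /K; have : 0 <= 2 * sq / c.
      by rewrite divr_ge0 ?mulr_ge0// ltW.
    move: (2 * sq / c) => q q0; rewrite -[leRHS]mulrA ler_wpM2l//.
    have Cr0 : 0 <= C * r by rewrite mulr_ge0// ltW.
    have t0 := ltW theta1_gt0.
    have n1 := normr_ge0 (T S h s); have n2 := normr_ge0 (A S h).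
    move: (`|T S h s|) (`|A S h|) (W S h) (C * r) Cr0 n1 n2 W0 => tt aa ww cr cr0 n1 n2 W0.
    have m1 := mulr_ge0 t0 n1; have m2 := mulr_ge0 t0 n2; have m3 := mulr_ge0 t0 W0.
    have m4 := mulr_ge0 cr0 n1; have m5 := mulr_ge0 cr0 n2; lra.
  have n1 := normr_ge0 (T S h s); have n2 := normr_ge0 (A S h).
  apply: (@le_trans _ _ ((K * (`|T S h s| + `|A S h| + W S h + 1)) ^+ 2)).
    by rewrite lerXn2r ?nnegrE// mulr_ge0 ?(ltW K0)// !addr_ge0.
  rewrite exprMn [4 * K ^+ 2]mulrC -[leRHS]mulrA ler_wpM2l ?sqr_ge0//.
  rewrite -[T S h s ^+ 2]real_normK ?num_real// -[A S h ^+ 2]real_normK ?num_real//.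
  move: (`|T S h s|) (`|A S h|) (W S h) => tt aa ww.
  have := sqr_ge0 (tt - aa); have := sqr_ge0 (tt - ww); have := sqr_ge0 (tt - 1).
  have := sqr_ge0 (aa - ww); have := sqr_ge0 (aa - 1); have := sqr_ge0 (ww - 1).
  by lra.
have bT : bounded_obs (fun (h : field n) s => T S h s ^+ 2).
  by move=> s; apply: bmX; exact: bounded_obs_clique_defect.
have bA : bounded_obs (fun (h : field n) (s : config n) => A S h ^+ 2).
  by move=> s; apply: bmX; exact: bm_residual_coef.
have bW : bounded_obs (fun (h : field n) (s : config n) => W S h ^+ 2).
  by move=> s; apply: bmX; exact: bm_residual_corrections.
have b1 : bounded_obs (fun (h : field n) (s : config n) => 1 : R).
  exact: bounded_obs_config.
have bf := @bounded_obs_config R n (fun s => (r <= mag_dev S s)%R%:R).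
have bW1 : bounded_obs (fun h s => W S h ^+ 2 + 1) by move=> s; exact: bmD (bW s) (b1 s).
have bA1 : bounded_obs (fun h s => A S h ^+ 2 + (W S h ^+ 2 + 1)) by move=> s; exact: bmD (bA s) (bW1 s).
have bT1 : bounded_obs (fun h s => T S h s ^+ 2 + (A S h ^+ 2 + (W S h ^+ 2 + 1))).
  by move=> s; exact: bmD (bT s) (bA1 s).
have le1 : E S (fun _ s => V S s ^+ 2) <= E S (fun h s =>
    4 * K ^+ 2 * (T S h s ^+ 2 + (A S h ^+ 2 + (W S h ^+ 2 + 1))) +
    (2 * sq) ^+ p ^+ 2 * k ^+ 2 * (r <= mag_dev S s)%R%:R).
  apply: le_avg => //; first exact: bounded_obs_config.
  by move=> s; apply: bmD; apply: bmZ; [exact: bT1|exact: bf].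
apply: (le_trans le1).
rewrite avgD; [|by move=> s; apply: bmZ; exact: bT1|by move=> s; apply: bmZ; exact: bf].
rewrite !avgZ// (avgD mu theta1 S bT bA1) (avgD mu theta1 S bA bW1) (avgD mu theta1 S bW b1) avg_cst !avg_field.
rewrite [leRHS]mulrDl; apply: lerD.
  have c4 : 0 <= 4 * K ^+ 2 by apply: mulr_ge0; rewrite ?sqr_ge0.
  rewrite -[leRHS]mulrA ler_wpM2l//.
  have [_ _ mA _] := hA n S; have [_ mW] := hW n S; have mT := clique_defect_moment S.
  rewrite -/k in mA mW mT.
  move: (avg _ _ _ _) (Rintegral _ _ _) (Rintegral _ _ _) mA mW mT => t1 t2 t3 mA mW mT.
  rewrite !mulrDl in mT *; lra.
have e0 : 0 <= (2 * sq) ^+ p ^+ 2 by exact: sqr_ge0.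
move: ((2 * sq) ^+ p ^+ 2) e0 => w w0; rewrite -mulrA -[leRHS]mulrA ler_wpM2l//.
apply: (@le_trans _ _ (k ^+ 2 * (#|S|.+1%:R * expR (- a * k)))).
  by rewrite ler_wpM2l ?sqr_ge0//; exact: hfar.
apply: (@le_trans _ _ C3); last by rewrite ler_peMr// ltW.
apply: le_trans (hC3 #|S|); rewrite -/k.
have kS : k <= #|S|.+1%:R by rewrite ler_nat.
rewrite [leLHS](_ : _ = k ^+ 2 * #|S|.+1%:R * expR (- a * k)); last by ring.
rewrite ler_wpM2r ?expR_ge0// [leRHS]exprSr ler_wpM2r//.
by apply: lerXn2r; rewrite ?nnegrE// ltW.
Qed.

(** * Correlation between force and disorder *)

Local Notation dev S := (mag_dev S).

(** The disorder is an i.i.d. sum of copies of [tanh (sqrt theta1 * xs + h)]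
    minus its mean. *)
Lemma disorder_variance : exists2 V0 : R, 0 < V0 & forall n (S : {set 'I_n}),
  (\int[iid_law mu n]_h A S h ^+ 2 = V0 * #|S|%:R)%R.
Proof.
exists (\int[mu]_h (tanh (sq * xs + h) - xs / sq) ^+ 2)%R.
  exact: tanh_variance_gt0 xs_flat tau_ge2.
move=> n S; pose xi (z : measurableTypeR R) := site_residual mu theta1 0 z xs / 0`!%:R.
have bxi : bounded_mfun xi by apply: bmM; [exact: bm_site_residual|exact: bm_cst].
have xi0 : (\int[mu]_z xi z = 0)%R.
  rewrite -[RHS](mean_site_residual mu theta1 0 xs); apply: eq_Rintegral => z _.
  by rewrite /xi fact0 divr1.
rewrite -[LHS]/(\int[iid_law mu n]_h (\sum_(i in S) xi (tnth h i)) ^+ 2)%R.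
rewrite (second_moment_iid_sum bxi xi0) mulrC; congr (_ * _).
apply: eq_Rintegral => z _; rewrite /xi /site_residual fact0 divr1 expr0 mul1r hornerX -/sq.
congr ((_ - _) ^+ 2).
rewrite -[LHS]/(smooth_tanh mu sq 'X xs) (_ : smooth_tanh _ _ _ _ = mean_tanh mu (sq * xs)).
  by rewrite [in RHS](magnetization_fixpoint mu_int theta1_gt0 xs_flat) -/sq [RHS]mulrC mulKf// gt_eqF.
by apply: eq_Rintegral => y _; rewrite hornerX.
Qed.

(** The defect [T] has mean zero given the field, so that on average the
    product of the force and the disorder [A] reproduces [A ^ 2], of mean [V0
    * k]. *)
Lemma force_disorder_correlation : exists c : R, exists k0 : nat, 0 < c /\
  forall n (S : {set 'I_n}), (k0 <= #|S|)%N -> (0 < #|S|)%N ->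
  c * #|S|%:R <= E S (fun h s => G S s * A S h).
Proof.
have [V0 V00 hV0] := disorder_variance.
have [C C0 hexp] := mean_field_expansion mu theta1_gt0 xs p.
have [CA CA0 hA] := residual_coef_moments mu theta1_gt0 xs 0.
have [CW CW0 hW] := residual_corrections_moments.
have [CV CV0 hV] := mag_power_moment.
(* [dl], [r] and the lower bound on [k] make each of the four error terms at
   most [V0 / 8 * k] *)
pose dl := V0 / (8 * theta1 * CA).
have dl0 : 0 < dl by rewrite divr_gt0 ?mulr_gt0.
pose r := V0 / (8 * C * (CW + CV + CA)).
have r0 : 0 < r by rewrite divr_gt0 ?mulr_gt0 ?addr_gt0.
have [a a0 hfar] := avg_far r0.
pose K2 := C * (2 * sq) * (CW + (2 * sq) ^+ p) * CA.
have K20 : 0 < K2.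
  have e0 : 0 < CW + (2 * sq) ^+ p by rewrite addr_gt0 ?exprn_gt0 ?mulr_gt0.
  by rewrite /K2; move: (CW + _) e0 => e e0; rewrite !mulr_gt0.
have V08 : 0 < V0 / (8 * K2) by rewrite divr_gt0// mulr_gt0.
have [k1 hk1] := poly_expR_small 3 a0 V08.
pose k2 := Num.trunc (theta1 / dl / (V0 / 8)).
exists (V0 / 2), (maxn k1 k2.+1); split; first by rewrite divr_gt0.
move=> n S; rewrite geq_max => /andP[Sk1 Sk2] S0.
have k1' : 1 <= #|S|%:R :> R by rewrite ler1n.
have {}hk1 := hk1 _ Sk1.
have {}Sk2 : theta1 / dl <= V0 / 8 * #|S|%:R.
  rewrite [leRHS]mulrC -ler_pdivrMr ?divr_gt0//.
  by rewrite (le_trans (ltW (truncnS_gt _)))// ler_nat.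
set k : R := #|S|%:R in k1' hk1 Sk2 *.
have kp : 0 < k by exact: lt_le_trans k1'.
have pw (h : field n) s :
   T S h s * A S h + (A S h ^+ 2 + - (theta1 * dl * A S h ^+ 2 + (theta1 / dl +
     (C * r * (W S h ^+ 2 + (V S s ^+ 2 + A S h ^+ 2)) +
      K2 * k ^+ 2 * (r <= dev S s)%R%:R)))) <= G S s * A S h.
  have e1 := hexp n S h s S0 xss; rewrite /= -/sq -/(mag_dev S s) in e1.
  rewrite -/(W S h) -/k -/(V S s) in e1.
  have VV := mag_power_ge0 S s.
  have WW := residual_corrections_ge0 S h.
  have DD := mag_dev_ge0 S s.
  have e2 : `|G S s * A S h - (T S h s * A S h + A S h ^+ 2)| <=
     (theta1 + C * dev S s * (W S h + V S s)) * `|A S h|.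
    rewrite (_ : _ - _ = (G S s - T S h s - A S h) * A S h); last by ring.
    by rewrite normrM ler_wpM2r.
  have e3 : theta1 * `|A S h| <= theta1 * dl * A S h ^+ 2 + theta1 / dl.
    rewrite -[A S h ^+ 2]real_normK ?num_real//; move: (`|A S h|) (dl) dl0 => y d d0.
    rewrite -subr_ge0 (_ : _ - _ = theta1 / d * ((d * y - 1 / 2) ^+ 2 + 3 / 4)).
      apply: mulr_ge0; first by rewrite divr_ge0// ltW.
      by rewrite addr_ge0 ?sqr_ge0// divr_ge0.
    by field; rewrite gt_eqF.
  have e4 : C * dev S s * (W S h + V S s) * `|A S h| <=
     C * r * (W S h ^+ 2 + (V S s ^+ 2 + A S h ^+ 2)) + K2 * k ^+ 2 * (r <= dev S s)%R%:R.
    have [far|/ltW near] := leP r (dev S s).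
      rewrite mulr1 ler_wpDl//.
        by apply: mulr_ge0; [apply: mulr_ge0; exact: ltW|rewrite !addr_ge0 ?sqr_ge0].
      have [/(_ h) hAb _ _ _] := hA n S; have [/(_ h) hWb _] := hW n S.
      have hVb : V S s <= (2 * sq) ^+ p * #|S|%:R by exact: (mag_power_le S s).
      have hDb : dev S s <= 2 * sq by exact: (mag_dev_le S s).
      rewrite -/k in hAb hWb hVb.
      have -> : K2 * k ^+ 2 = (C * (2 * sq)) * (CW * k + (2 * sq) ^+ p * k) * (CA * k).
        by rewrite /K2; ring.
      apply: ler_pM => //; first by rewrite !mulr_ge0 ?addr_ge0// ltW.
      apply: ler_pM; rewrite ?mulr_ge0 ?addr_ge0 ?(ltW C0)//.
        by rewrite ler_wpM2l// ltW.
      exact: lerD.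
    rewrite mulr0 addr0.
    apply: (@le_trans _ _ (C * r * ((W S h + V S s) * `|A S h|))).
      rewrite -[leLHS]mulrA ler_wpM2r//; first by rewrite mulr_ge0// addr_ge0.
      by rewrite ler_wpM2l// ltW.
    apply: ler_wpM2l; first by apply: mulr_ge0; exact: ltW.
    rewrite -[A S h ^+ 2]real_normK ?num_real//; move: (`|A S h|) (W S h) (V S s) => y w z.
    have := sqr_ge0 (w - y); have := sqr_ge0 (z - y); have := sqr_ge0 w; have := sqr_ge0 z.
    lra.
  have := le_trans e2 (_ : _ <= theta1 * dl * A S h ^+ 2 + theta1 / dl +
    (C * r * (W S h ^+ 2 + (V S s ^+ 2 + A S h ^+ 2)) + K2 * k ^+ 2 * (r <= dev S s)%R%:R)).
  have -> : (theta1 + C * dev S s * (W S h + V S s)) * `|A S h| =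
     theta1 * `|A S h| + C * dev S s * (W S h + V S s) * `|A S h| by ring.
  move=> /(_ (lerD e3 e4)); rewrite ler_norml => /andP[+ _].
  have aux (u b c d e f y : R) : - (c + d + (e + f)) <= b - (u + y) ->
    u + (y + - (c + (d + (e + f)))) <= b by lra.
  exact: aux.
have bc (f : field n -> R) : bounded_mfun f -> bounded_obs (fun h (_ : config n) => f h) by move=> bf s.
have bA := bm_residual_coef mu theta1 xs S 0.
have bA2 := bc _ (bmX 2 bA); have bW2 := bc _ (bmX 2 (bm_residual_corrections S)).
have bT : bounded_obs (fun (h : field n) s => T S h s * A S h).
  by move=> s; apply: bmM bA; exact: bounded_obs_clique_defect.
have bV := @bounded_obs_config R n (fun s => V S s ^+ 2).
have bF := @bounded_obs_config R n (fun s => (r <= dev S s)%R%:R).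
have b1 := @bounded_obs_config R n (fun _ => theta1 / dl).
pose F1 := fun (h : field n) s => V S s ^+ 2 + A S h ^+ 2.
have bF1 : bounded_obs F1 by move=> s; exact: bmD (bV s) (bA2 s).
pose F2 := fun (h : field n) s => W S h ^+ 2 + F1 h s.
have bF2 : bounded_obs F2 by move=> s; exact: bmD (bW2 s) (bF1 s).
pose F2' := fun (h : field n) s => C * r * F2 h s.
have bF2' : bounded_obs F2' by move=> s; exact: bmZ (bF2 s).
pose F3' := fun (h : field n) s => K2 * k ^+ 2 * (r <= dev S s)%R%:R.
have bF3' : bounded_obs F3' by move=> s; exact: bmZ (bF s).
pose F3 := fun h s => F2' h s + F3' h s.
have bF3 : bounded_obs F3 by move=> s; exact: bmD (bF2' s) (bF3' s).
pose F4 := fun h s => theta1 / dl + F3 h s.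
have bF4 : bounded_obs F4 by move=> s; exact: bmD (b1 s) (bF3 s).
pose F5' := fun (h : field n) (s : config n) => theta1 * dl * A S h ^+ 2.
have bF5' : bounded_obs F5' by move=> s; exact: bmZ (bA2 s).
pose F5 := fun h s => F5' h s + F4 h s.
have bF5 : bounded_obs F5 by move=> s; exact: bmD (bF5' s) (bF4 s).
pose F5N := fun h s => -1 * F5 h s.
have bF5N : bounded_obs F5N by move=> s; exact: bmZ (bF5 s).
pose F6 := fun h s => A S h ^+ 2 + F5N h s.
have bF6 : bounded_obs F6 by move=> s; exact: bmD (bA2 s) (bF5N s).
have TA0 : E S (fun h s => T S h s * A S h) = 0.
  rewrite /avg -[RHS](Rint_cst (iid_law mu n)); apply: eq_Rintegral => h _.
  under eq_bigr do rewrite mulrA.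
  by rewrite -mulr_suml mean_clique_defect mul0r.
have low : E S (fun h s => T S h s * A S h + F6 h s) <=
           E S (fun h s => G S s * A S h).
  apply: le_avg; first by move=> s; exact: bmD (bT s) (bF6 s).
    by move=> s; exact: bmZ bA.
  by move=> h s; rewrite /F6 /F5N mulN1r; exact: pw.
apply: le_trans low.
rewrite (avgD mu theta1 S bT bF6) TA0 add0r (avgD mu theta1 S bA2 bF5N).
rewrite (avgZ mu theta1 S (-1) bF5) mulN1r (avgD mu theta1 S bF5' bF4).
rewrite (avgZ mu theta1 S (theta1 * dl) bA2) (avgD mu theta1 S b1 bF3).
rewrite (avgD mu theta1 S bF2' bF3') (avgZ mu theta1 S (C * r) bF2) (avgZ mu theta1 S (K2 * k ^+ 2) bF).
rewrite (avgD mu theta1 S bW2 bF1) (avgD mu theta1 S bV bA2).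
have eV : E S (fun h (_ : config n) => A S h ^+ 2) = V0 * k.
  by rewrite avg_field hV0.
have lA : E S (fun h (_ : config n) => A S h ^+ 2) <= CA * k.
  by rewrite avg_field; case: (hA n S).
have lW : E S (fun h (_ : config n) => W S h ^+ 2) <= CW * k.
  by rewrite avg_field; case: (hW n S).
have lV := hV n S S0; rewrite -/k in lV.
have lF : K2 * k ^+ 2 * E S (fun _ s => (r <= dev S s)%R%:R) <= V0 / 8 * k.
  apply: (@le_trans _ _ (K2 * (k ^+ 2 * (#|S|.+1%:R * expR (- a * k))))).
    rewrite mulrA ler_wpM2l//; first by rewrite mulr_ge0 ?sqr_ge0// ltW.
    exact: hfar.
  apply: (@le_trans _ _ (K2 * (V0 / (8 * K2)))).
    rewrite ler_wpM2l ?(ltW K20)//; apply: le_trans hk1.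
    have kS : k <= #|S|.+1%:R by rewrite ler_nat.
    rewrite [leLHS](_ : _ = k ^+ 2 * #|S|.+1%:R * expR (- a * k)); last by ring.
    rewrite ler_wpM2r ?expR_ge0// [leRHS]exprSr ler_wpM2r//.
    by apply: lerXn2r; rewrite ?nnegrE// ltW.
  rewrite (_ : K2 * (V0 / (8 * K2)) = V0 / 8); last by field; rewrite gt_eqF.
  by rewrite ler_peMr// divr_ge0// ltW.
have d1 : theta1 * dl * CA = V0 / 8.
  by rewrite /dl; field; rewrite !gt_eqF.
have d2 : C * r * (CW + CV + CA) = V0 / 8.
  by rewrite /r; field; rewrite !gt_eqF// !addr_gt0.
rewrite avg_cst [X in X + - _]eV.
have td0 : 0 <= theta1 * dl by rewrite mulr_ge0// ltW.
have cr0 : 0 <= C * r by rewrite mulr_ge0// ltW.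
have m1 := ler_wpM2l td0 lA.
have m2 := ler_wpM2l cr0 (lerD lW (lerD lV lA)).
have m3 : C * r * (CW * k + (CV * k + CA * k)) = V0 / 8 * k by rewrite -d2; ring.
have m4 : theta1 * dl * (CA * k) = V0 / 8 * k by rewrite -d1; ring.
rewrite m3 in m2; rewrite m4 in m1.
have aux (y1 y2 y3 y4 z : R) : y1 <= V0 / 8 * z -> y2 <= V0 / 8 * z ->
    y3 <= V0 / 8 * z -> y4 <= V0 / 8 * z ->
    V0 / 2 * z <= V0 * z + - (y1 + (y4 + (y2 + y3))) by lra.
exact: aux.
Qed.

(** * Separation of two independent copies *)

Local Notation x S := (scaled_mag theta1 S).

(** In the unit [1 / v] all quantities are of order one, and [v ^ (2 tau - 1)
    = sqrt k] makes [sqrt k] the unit of force. The difference of the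
    magnetizations in this unit is at most [v * dev S s + v * dev S s'], so
    replacing it by its minimum with [1] costs one more factor [1 + v * dev S
    s + v * dev S s']. *)
Lemma force_difference_le : exists2 C : R, 0 < C &
  forall n (S : {set 'I_n}) (v : R) s s', 0 < v -> v ^+ p = Num.sqrt #|S|%:R ->
  `|G S s - G S s'| <= C * Num.sqrt #|S|%:R *
    ((1 + v * dev S s + v * dev S s') ^+ p * Num.min (v * `|x S s - x S s'|) 1).
Proof.
have [C C0 hC] := free_energy_deriv1_lipschitz mu_int theta1_gt0 xs_flat.
exists (C / sq); first by rewrite divr_gt0.
move=> n S v s s' v0 vp; set q := Num.sqrt _ in vp *.
have q0 : 0 <= q by exact: sqrtr_ge0.
have qq : q ^+ 2 = #|S|%:R by rewrite sqr_sqrtr.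
have D0 := mag_dev_ge0 S s; have D0' := mag_dev_ge0 S s'.
have pS : p = (2 * tau).-2.+1 by case: tau tau_ge2 => [|[|t]].
set m := (2 * tau).-2 in hC pS.
have e1 : `|G S s - G S s'| <= #|S|%:R / sq * (C * (dev S s' + dev S s) ^+ m * `|x S s - x S s'|).
  rewrite /mag_force -/sq -mulrBr normrM ger0_norm ?divr_ge0 ?(ltW sq_gt0)//.
  by rewrite ler_wpM2l ?divr_ge0 ?(ltW sq_gt0)//; exact: hC.
apply: (le_trans e1).
have -> : #|S|%:R / sq * (C * (dev S s' + dev S s) ^+ m * `|x S s - x S s'|) =
   C / sq * q * ((v * dev S s + v * dev S s') ^+ m * (v * `|x S s - x S s'|)).
  rewrite -mulrDr exprMn -qq expr2 -{2}vp pS exprSr [dev S s + _]addrC; ring.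
rewrite ler_wpM2l//; first by rewrite mulr_ge0// divr_ge0// ltW.
have le_e : v * `|x S s - x S s'| <= v * dev S s + v * dev S s'.
  rewrite -mulrDr ler_wpM2l ?(ltW v0)// /mag_dev -[X in _ <= _ + X]normrN.
  by rewrite (le_trans _ (ler_normD _ _))// opprB addrA subrK.
have e0 : 0 <= v * `|x S s - x S s'| by rewrite mulr_ge0// ltW.
have u0 : 0 <= v * dev S s by rewrite mulr_ge0// ltW.
have u0' : 0 <= v * dev S s' by rewrite mulr_ge0// ltW.
move: (v * `|x S s - x S s'|) (v * dev S s) (v * dev S s') le_e e0 u0 u0' => e u u' le_e e0 u0 u0'.
have me : e <= (1 + u + u') * Num.min e 1.
  rewrite /Order.min; case: ifP => [_|/negbT]; last by rewrite -leNgt; lra.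
  by rewrite ler_peMl//; lra.
rewrite pS exprSr -[leRHS]mulrA.
apply: ler_pM => //; first by rewrite exprn_ge0// addr_ge0.
by apply: lerXn2r; rewrite ?nnegrE ?addr_ge0//; lra.
Qed.

(** If the magnetizations of two independent configurations were closer than
    [1 / v], their forces would nearly agree; but the force of the first one
    is correlated with its own disorder, of which the second one is
    independent. The moments of [V] and [A] control the event where the force
    difference is large in spite of a small separation. *)
Lemma two_copy_separation : exists w : R, exists k0 : nat, 0 < w /\
  forall n (S : {set 'I_n}), (k0 <= #|S|)%N -> (0 < #|S|)%N ->
  forall v : R, 0 < v -> v ^+ p = Num.sqrt #|S|%:R ->
  w <= \sum_s' PS mu theta1 S s' * \sum_s PS mu theta1 S s *
         (Num.min (v * `|x S s - x S s'|) 1) ^+ 2.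
Proof.
have [c [k0 [c0 hcorr]]] := force_disorder_correlation.
have [K K0 hdiff] := force_difference_le.
have [CA CA0 hA] := residual_coef_moments mu theta1_gt0 xs 0.
have [CV CV0 hV] := mag_power_moment.
pose cp : R := 3 ^+ (p + p) * (1 + 2 * CV).
have cp0 : 0 < cp.
  by apply: mulr_gt0; [exact: exprn_gt0|rewrite addr_gt0// mulr_gt0].
(* the weights in the two applications of Young's inequality, chosen so that
   the terms without [d] add up to at most [c / 2 * k] *)
pose al := c / (4 * K * cp).
have al0 : 0 < al by apply: divr_gt0 => //; apply: mulr_gt0 => //; apply: mulr_gt0.
pose be := al * c / (4 * K * CA).
have be0 : 0 < be.
  by apply: divr_gt0; [exact: mulr_gt0|apply: mulr_gt0 => //; exact: mulr_gt0].
exists (c / 2 / (K / (al * be))), k0; split.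
  by apply: divr_gt0; [exact: divr_gt0|apply: divr_gt0 => //; exact: mulr_gt0].
move=> n S Sk S0 v v0 vp.
set k : R := #|S|%:R; set q := Num.sqrt k.
have k1 : 1 <= k by rewrite ler1n.
have kp : 0 < k by exact: lt_le_trans k1.
have q0 : 0 < q by rewrite sqrtr_gt0.
have qq : q ^+ 2 = k by rewrite sqr_sqrtr// ltW.
pose d s s' : R := Num.min (v * `|x S s - x S s'|) 1.
have d01 s s' : 0 <= d s s' <= 1.
  by rewrite /d le_min ler01 andbT mulr_ge0 ?(ltW v0)//= ge_min lexx orbT.
have QV s : k * (v * dev S s) ^+ (p + p) = V S s ^+ 2.
  by rewrite exprD exprMn vp -/q /mag_power -/k -qq; ring.
have pw s' (h : field n) s : (G S s - G S s') * A S h <=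
   K * (al * 3 ^+ (p + p) * V S s ^+ 2 + (be / al / k * A S h ^+ 4 +
     (k / (al * be) * d s s' ^+ 2 + al * 3 ^+ (p + p) * (k + V S s' ^+ 2)))).
  have := hdiff n S v s s' v0 vp; rewrite -/k -/q -/(d s s').
  set Q := (1 + _ + _) ^+ p => hd.
  apply: le_trans (ler_norm _) _; rewrite normrM.
  apply: le_trans (ler_wpM2r (normr_ge0 _) hd) _.
  have Q0 : 0 <= Q.
    by rewrite exprn_ge0// !addr_ge0// mulr_ge0 ?(ltW v0)// mag_dev_ge0.
  have hQ2 : k * Q ^+ 2 <= 3 ^+ (p + p) * (k + V S s ^+ 2 + V S s' ^+ 2).
    rewrite -exprM mulnC mul2n -addnn.
    have := @trinomial_power_le R (p + p) _ _ (mulr_ge0 (ltW v0) (mag_dev_ge0 S s))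
      (mulr_ge0 (ltW v0) (mag_dev_ge0 S s')).
    move/(ler_wpM2l (ltW kp)) => /le_trans; apply.
    by rewrite -!QV; apply: le_of_eq; ring.
  have [/andP[dge0 dle1] a0] := (d01 s s', normr_ge0 (A S h)).
  have -> : A S h ^+ 4 = `|A S h| ^+ 4.
    by rewrite -[4%N]/(2 * 2)%N !exprM real_normK ?num_real.
  move: (d s s') (`|A S h|) dge0 dle1 a0 => dd a dge0 dle1 a0.
  have -> : K * q * (Q * dd) * a = K * (q * Q * (a * dd)) by ring.
  rewrite ler_wpM2l ?(ltW K0)//.
  have y1 : q * Q * (a * dd) <= al * (k * Q ^+ 2) + (a * dd) ^+ 2 / al.
    rewrite -qq -subr_ge0 (_ : _ - _ = ((al * q * Q - (a * dd) / 2) ^+ 2 + 3 / 4 * (a * dd) ^+ 2) / al).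
      by rewrite divr_ge0 ?(ltW al0)// addr_ge0 ?sqr_ge0// mulr_ge0 ?sqr_ge0// divr_ge0.
    by move: (al) al0 => l l0; field; rewrite gt_eqF.
  have y2 : (a * dd) ^+ 2 <= be / k * a ^+ 4 + k / be * dd ^+ 2.
    have : dd ^+ 4 <= dd ^+ 2 by rewrite ler_wiXn2l.
    have kb : 0 <= k / be by rewrite divr_ge0// ltW.
    move/(ler_wpM2l kb) => h1.
    have : (a * dd) ^+ 2 <= be / k * a ^+ 4 + k / be * dd ^+ 4.
      rewrite -subr_ge0 (_ : _ - _ = ((be * a ^+ 2 - k * dd ^+ 2 / 2) ^+ 2 + 3 / 4 * (k * dd ^+ 2) ^+ 2) / (be * k)).
        rewrite divr_ge0 ?addr_ge0 ?sqr_ge0//; first by rewrite mulr_ge0 ?sqr_ge0// divr_ge0.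
        by rewrite mulr_ge0// ltW.
      by move: (be) be0 => b b0; field; rewrite !gt_eqF.
    by move/le_trans; apply; rewrite lerD2l.
  apply: (le_trans y1).
  have z1 := ler_wpM2l (ltW al0) hQ2.
  have z2 : (a * dd) ^+ 2 / al <= (be / k * a ^+ 4 + k / be * dd ^+ 2) / al.
    by rewrite ler_wpM2r// invr_ge0 ltW.
  apply: (le_trans (lerD z1 z2)).
  apply: le_of_eq.
  by move: (al) (be) al0 be0 => l b l0 b0; field; rewrite !gt_eqF.
have bA := bm_residual_coef mu theta1 xs S 0.
have bG : bounded_obs (fun h s => G S s * A S h) by move=> s; exact: bmZ bA.
have bA1 : bounded_obs (fun h (_ : config n) => A S h) by move=> s.
have bA4 : bounded_obs (fun h (_ : config n) => A S h ^+ 4) by move=> s; exact: bmX.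
have bV := @bounded_obs_config R n (fun s => V S s ^+ 2).
have A0 : E S (fun h _ => A S h) = 0.
  by rewrite avg_field; case: (hA n S).
have lA : E S (fun h (_ : config n) => A S h ^+ 4) <= CA * k ^+ 2.
  by rewrite avg_field; case: (hA n S).
have lV := hV n S S0; rewrite -/k in lV.
have ineq s' : c * k <= K * (al * 3 ^+ (p + p) * (CV * k) + (be / al * CA * k +
     (k / (al * be) * (\sum_s PS mu theta1 S s * d s s' ^+ 2) +
      al * 3 ^+ (p + p) * (k + V S s' ^+ 2)))).
  have bd := @bounded_obs_config R n (fun s => d s s' ^+ 2).
  pose cst' := al * 3 ^+ (p + p) * (k + V S s' ^+ 2).
  have b0 := @bounded_obs_config R n (fun _ => cst').
  pose F0 := fun (h : field n) s => k / (al * be) * d s s' ^+ 2.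
  have bF0 : bounded_obs F0 by move=> s; exact: bmZ (bd s).
  pose F1 := fun h s => F0 h s + cst'.
  have bF1 : bounded_obs F1 by move=> s; exact: bmD (bF0 s) (b0 s).
  pose F2' := fun (h : field n) (s : config n) => be / al / k * A S h ^+ 4.
  have bF2' : bounded_obs F2' by move=> s; exact: bmZ (bA4 s).
  pose F2 := fun h s => F2' h s + F1 h s.
  have bF2 : bounded_obs F2 by move=> s; exact: bmD (bF2' s) (bF1 s).
  pose F3' := fun (h : field n) (s : config n) => al * 3 ^+ (p + p) * V S s ^+ 2.
  have bF3' : bounded_obs F3' by move=> s; exact: bmZ (bV s).
  pose F3 := fun h s => F3' h s + F2 h s.
  have bF3 : bounded_obs F3 by move=> s; exact: bmD (bF3' s) (bF2 s).
  (* for a fixed second copy its force is a constant against the centered [A] *)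
  have e1 : E S (fun h s => G S s * A S h + - G S s' * A S h) =
            E S (fun h s => G S s * A S h).
    have bN : bounded_obs (fun h (_ : config n) => - G S s' * A S h) by move=> s; exact: bmZ bA.
    by rewrite (avgD mu theta1 S bG bN) (avgZ mu theta1 S _ bA1) A0 mulr0 addr0.
  apply: le_trans (hcorr n S Sk S0) _; rewrite -e1.
  apply: (@le_trans _ _ (E S (fun h s => K * F3 h s))).
    apply: le_avg; [|by move=> s; exact: bmZ (bF3 s)|].
      by move=> s; apply: bmD; exact: bmZ bA.
    by move=> h s; rewrite -mulrDl; exact: pw.
  rewrite (avgZ mu theta1 S K bF3) ler_wpM2l ?(ltW K0)//.
  rewrite (avgD mu theta1 S bF3' bF2) (avgD mu theta1 S bF2' bF1) (avgD mu theta1 S bF0 b0).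
  rewrite (avgZ mu theta1 S _ bV) (avgZ mu theta1 S _ bA4) (avgZ mu theta1 S _ bd) avg_cst.
  rewrite -(PS_expect mu theta1 S (fun s => d s s' ^+ 2)) -/cst'.
  have a3 : 0 <= al * 3 ^+ (p + p) by rewrite mulr_ge0 ?exprn_ge0// ltW.
  have bak : 0 <= be / al / k by apply: divr_ge0; [apply: divr_ge0; exact: ltW|exact: ltW].
  apply: lerD; first by have := ler_wpM2l a3 lV.
  rewrite lerD2r; apply: le_trans (ler_wpM2l bak lA) _.
  apply: le_of_eq.
  by move: (al) al0 => l l0; field; rewrite !gt_eqF.
have PSd (f : config n -> R) (a b : R) : \sum_s' PS mu theta1 S s' * (a + b * f s') =
    a + b * \sum_s' PS mu theta1 S s' * f s'.
  rewrite -[in RHS](mul1r a) -(sum_PS mu theta1 S) mulr_suml mulr_sumr -big_split /=.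
  by apply: eq_bigr => s' _; ring.
have big : c * k <= \sum_s' PS mu theta1 S s' * (K * (al * 3 ^+ (p + p) * (CV * k) + (be / al * CA * k +
     (k / (al * be) * (\sum_s PS mu theta1 S s * d s s' ^+ 2) +
      al * 3 ^+ (p + p) * (k + V S s' ^+ 2))))).
  rewrite -[leLHS]mul1r -[X in X * _ <= _](sum_PS mu theta1 S) mulr_suml.
  apply: ler_sum => s' _.
  by apply: ler_wpM2l; [exact: PS_ge0|exact: ineq].
set X := \sum_s' _.
have {}big : c * k <= K * (al * 3 ^+ (p + p) * (CV * k + k + \sum_s' PS mu theta1 S s' * V S s' ^+ 2) +
    be / al * CA * k + k / (al * be) * X).
  apply: (le_trans big); apply: le_of_eq.
  rewrite /X -/d.
  transitivity (\sum_s' PS mu theta1 S s' * ((K * (al * 3 ^+ (p + p) * (CV * k + k) + be / al * CA * k)) + 1 *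
     (K * (k / (al * be)) * (\sum_s PS mu theta1 S s * d s s' ^+ 2) + K * (al * 3 ^+ (p + p)) * V S s' ^+ 2))).
    by apply: eq_bigr => s' _; congr (_ * _); ring.
  rewrite PSd mul1r.
  rewrite (_ : \sum_s' PS mu theta1 S s' * (K * (k / (al * be)) * _ + _) =
     K * (k / (al * be)) * \sum_s' PS mu theta1 S s' * (\sum_s PS mu theta1 S s * d s s' ^+ 2)
     + K * (al * 3 ^+ (p + p)) * \sum_s' PS mu theta1 S s' * V S s' ^+ 2); last first.
    by rewrite !mulr_sumr -big_split /=; apply: eq_bigr => s' _; ring.
  by ring.
rewrite PS_expect in big.
have a3 : 0 <= al * 3 ^+ (p + p) by rewrite mulr_ge0 ?exprn_ge0// ltW.
have {}big : c * k <= K * (al * 3 ^+ (p + p) * (CV * k + k + CV * k) +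
    be / al * CA * k + k / (al * be) * X).
  apply: (le_trans big); rewrite ler_wpM2l ?(ltW K0)// lerD2r lerD2r ler_wpM2l//.
  by rewrite lerD2l.
have i1 : K * (al * 3 ^+ (p + p) * (CV * k + k + CV * k)) = c / 4 * k.
  have -> : al * 3 ^+ (p + p) * (CV * k + k + CV * k) = al * cp * k by rewrite /cp; ring.
  by rewrite /al; move: (cp) cp0 => y y0; field; rewrite !gt_eqF.
have i2 : K * (be / al * CA * k) = c / 4 * k.
  by rewrite /be; move: (al) al0 => l l0; field; rewrite !gt_eqF.
rewrite (mulrDr K) (mulrDr K) i1 i2 in big.
have kk : 0 < K / (al * be) by apply: divr_gt0 => //; exact: mulr_gt0.
rewrite ler_pdivrMr//.
have i3 : K * (k / (al * be) * X) = (X * (K / (al * be))) * k by ring.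
rewrite i3 in big.
have : c / 2 * k <= X * (K / (al * be)) * k by move: (X * (K / (al * be)) * k) big => z; lra.
by rewrite ler_pM2r.
Qed.

End disorder_fluctuations.

(** * Product laws and the spins outside the clique *)

Section product_law.
Context {R : realType} {T : finType}.

Lemma sum_tuple_prod (N : nat) (f : 'I_N -> T -> R) :
  \sum_(s : N.-tuple T) \prod_(j < N) f j (tnth s j) = \prod_(j < N) \sum_x f j x.
Proof.
rewrite bigA_distr_bigA (reindex (fun g : {ffun 'I_N -> T} => [tuple g i | i < N])) /=.
  by apply: eq_bigr => g _; apply: eq_bigr => j _; rewrite tnth_mktuple.
exists (fun s : N.-tuple T => [ffun i => tnth s i]) => [g _|s _].
  by apply/ffunP => i; rewrite ffunE tnth_mktuple.
by apply: eq_from_tnth => i; rewrite tnth_mktuple ffunE.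
Qed.

Lemma prod_nat_pairs (m : nat) (G : nat -> R) :
  \prod_(0 <= l < 2 * m) G l = \prod_(0 <= j < m) (G (2 * j)%N * G (2 * j).+1).
Proof.
elim: m => [|m IH]; first by rewrite muln0 !big_nil.
rewrite [RHS]big_nat_recr//= -IH mulnS -[(2 + 2 * m)%N]/((2 * m).+2).
by rewrite !big_nat_recr//= mulrA.
Qed.

Lemma prod_pairs (m : nat) (F : 'I_(2 * m) -> R) :
  \prod_(l < 2 * m) F l = \prod_(j < m) (F (pair_fst j) * F (pair_snd j)).
Proof.
pose G (l : nat) : R := if insub l is Some i then F i else 1.
have GE (i : 'I_(2 * m)) : G i = F i by rewrite /G valK.
transitivity (\prod_(0 <= l < 2 * m) G l).
  by rewrite big_mkord; apply: eq_bigr => i _; rewrite GE.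
rewrite prod_nat_pairs big_mkord; apply: eq_bigr => j _.
by rewrite -(GE (pair_fst j)) -(GE (pair_snd j)).
Qed.

(** A tuple of [2 m] samples is the same as a family of [m] pairs. *)
Lemma sum_tuple_prod_pairs (m : nat) (p : T -> R) (g : T -> T -> R) :
  \sum_(s : (2 * m).-tuple T) (\prod_(l < 2 * m) p (tnth s l)) *
     \prod_(j < m) g (tnth s (pair_fst j)) (tnth s (pair_snd j)) =
  (\sum_a \sum_b p a * p b * g a b) ^+ m.
Proof.
have half_lt (l : 'I_(2 * m)) : (l./2 < m)%N by rewrite ltn_half_double -mul2n.
pose half l : 'I_m := Ordinal (half_lt l).
have half_fst (j : 'I_m) : half (pair_fst j) = j.
  by apply: val_inj; rewrite /= mul2n doubleK.
have half_snd (j : 'I_m) : half (pair_snd j) = j.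
  by apply: val_inj; rewrite /= mul2n uphalf_double.
pose t (f : {ffun 'I_m -> T * T}) : (2 * m).-tuple T :=
  [tuple (if odd l then (f (half l)).2 else (f (half l)).1) | l < 2 * m].
have t_fst f j : tnth (t f) (pair_fst j) = (f j).1.
  by rewrite tnth_mktuple half_fst /= mul2n odd_double.
have t_snd f j : tnth (t f) (pair_snd j) = (f j).2.
  by rewrite tnth_mktuple half_snd /= mul2n odd_double.
rewrite (reindex t) /=; last first.
  exists (fun s : (2 * m).-tuple T => [ffun j => (tnth s (pair_fst j), tnth s (pair_snd j))]).
    by move=> f _; apply/ffunP => j; rewrite ffunE t_fst t_snd; case: (f j).
  move=> s _; apply: eq_from_tnth => l; rewrite tnth_mktuple !ffunE /=.
  case: ifP => ol; congr tnth; apply: val_inj => /=.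
    by rewrite -[RHS](odd_double_half l) ol mul2n.
  by rewrite -[RHS](odd_double_half l) ol mul2n.
transitivity (\sum_(f : {ffun 'I_m -> T * T}) \prod_(j < m)
    (p (f j).1 * p (f j).2 * g (f j).1 (f j).2)).
  apply: eq_bigr => f _; rewrite prod_pairs -big_split /=.
  by apply: eq_bigr => j _; rewrite t_fst t_snd.
rewrite -(bigA_distr_bigA (fun (_ : 'I_m) (x : T * T) => p x.1 * p x.2 * g x.1 x.2)).
by rewrite prodr_const card_ord pair_bigA.
Qed.

Variables (p : T -> R).
Hypotheses (p0 : forall x, 0 <= p x) (p1 : \sum_x p x = 1).

Lemma tuple_weight_ge0 (N : nat) (s : N.-tuple T) : 0 <= \prod_(j < N) p (tnth s j).
Proof. by apply: prodr_ge0 => j _. Qed.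

Lemma tuple_marginal (N : nat) (j0 : 'I_N) (g : T -> R) :
  \sum_(s : N.-tuple T) (\prod_(j < N) p (tnth s j)) * g (tnth s j0) = \sum_x p x * g x.
Proof.
have := sum_tuple_prod (fun j x => p x * (if j == j0 then g x else 1)).
have -> : \prod_(j < N) \sum_x p x * (if j == j0 then g x else 1) = \sum_x p x * g x.
  rewrite (bigD1 j0)//= eqxx [X in _ * X]big1 ?mulr1// => j /negbTE jj.
  by rewrite -[RHS]p1; apply: eq_bigr => x _; rewrite jj mulr1.
move=> <-; apply: eq_bigr => s _; rewrite big_split /=; congr (_ * _).
by rewrite (bigD1 j0)//= eqxx [X in _ * X]big1 ?mulr1// => j /negbTE ->.
Qed.

Lemma tuple_markov (N : nat) (B : pred (N.-tuple T)) (F : N.-tuple T -> R) :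
  (forall s, 0 <= F s) -> (forall s, B s -> 1 <= F s) ->
  \sum_(s : N.-tuple T | B s) \prod_(j < N) p (tnth s j) <=
  \sum_(s : N.-tuple T) (\prod_(j < N) p (tnth s j)) * F s.
Proof.
move=> F0 BF; rewrite [leRHS](bigID B) /= -[leLHS]addr0; apply: lerD.
  apply: ler_sum => s Bs; rewrite ler_peMr ?tuple_weight_ge0//; exact: BF.
by apply: sumr_ge0 => s _; rewrite mulr_ge0// tuple_weight_ge0.
Qed.

Lemma tuple_sum_marginal (N : nat) (I : Type) (r : seq I) (c : I -> R) (j : I -> 'I_N) (g : I -> T -> R) :
  \sum_(s : N.-tuple T) (\prod_(j < N) p (tnth s j)) *
     (\sum_(i <- r) c i * g i (tnth s (j i))) =
  \sum_(i <- r) c i * \sum_x p x * g i x.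
Proof.
under eq_bigr do rewrite mulr_sumr.
rewrite exchange_big /=; apply: eq_bigr => i _.
rewrite -(tuple_marginal (j i) (g i)) mulr_sumr; apply: eq_bigr => s _.
by rewrite mulrCA.
Qed.

End product_law.

Section outside.
Context {R : realType} (mu : probability (measurableTypeR R) R) (theta1 : R).

Definition null_mean : R := (\int[mu]_h tanh h)%R.

Definition outside_sum {n} (S : {set 'I_n}) (s : config n) : R :=
  \sum_(i in ~: S) (spin R (s i) - null_mean).

(** Outside the clique a spin is [tanh h] plus a defect, and both parts have
    uncorrelated summands. *)
Lemma outside_sum_moment {n} (S : {set 'I_n}) :
  \sum_s PS mu theta1 S s * outside_sum S s ^+ 2 <= 16 * n%:R.
Proof.
pose b := null_mean.
pose xi (h : measurableTypeR R) : R := tanh h - b.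
have bt : bounded_mfun (fun h : measurableTypeR R => tanh h).
  have := bm_tanh_translate (0 : R); congr bounded_mfun.
  by apply/funext => h; rewrite add0r.
have bxi : bounded_mfun xi by apply: bmB => //; exact: bm_cst.
have xi0 : (\int[mu]_h xi h = 0)%R by rewrite RintB ?Rint_cst ?subrr//; exact: bm_cst.
have b1 : `|b| <= 1 by apply: Rint_norm_le => // h; exact: norm_tanh_le1.
have xi2 : (\int[mu]_h xi h ^+ 2 <= 4)%R.
  rewrite -[leRHS](Rint_cst mu); apply: le_Rint; [exact: bmX|exact: bm_cst|move=> h].
  have xh : `|xi h| <= 2.
    by apply: (le_trans (ler_normB _ _)); have := norm_tanh_le1 h; lra.
  by rewrite -real_normK ?num_real//; have := normr_ge0 (xi h); nra.
pose F h s : R := \sum_(i in ~: S) (spin R (s i) - tanh (tnth h i)).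
pose G (h : n.-tuple (measurableTypeR R)) : R := \sum_(i in ~: S) xi (tnth h i).
have bF : bounded_obs F.
  move=> s; apply: bm_sum => i _; apply: bmB; first exact: bm_cst.
  exact: (@bm_tnth _ _ i (fun h => tanh h)).
have bG : bounded_mfun G by apply: bm_sum => i _; exact: bm_tnth.
have bF2 : bounded_obs (fun h s => F h s ^+ 2) by move=> s; exact: bmX.
have bG2 : bounded_obs (fun h (_ : config n) => G h ^+ 2) by move=> s; exact: bmX.
rewrite PS_expect.
apply: (@le_trans _ _ (avg mu theta1 S (fun h s => 2 * F h s ^+ 2 + 2 * G h ^+ 2))).
  apply: le_avg; first exact: bounded_obs_config.
    by move=> s; apply: bmD; [exact: bmZ (bF2 s)|exact: bmZ (bG2 s)].
  move=> h s; have -> : outside_sum S s = F h s + G h.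
    by rewrite /F /G -big_split /=; apply: eq_bigr => i _; rewrite /xi /b; ring.
  by have := sqr_ge0 (F h s - G h); lra.
have bF22 : bounded_obs (fun h s => 2 * F h s ^+ 2) by move=> s; exact: bmZ (bF2 s).
have bG22 : bounded_obs (fun h (s : config n) => 2 * G h ^+ 2) by move=> s; exact: bmZ (bG2 s).
rewrite (avgD mu theta1 S bF22 bG22) (avgZ mu theta1 S 2 bF2) (avgZ mu theta1 S 2 bG2).
have h1 : avg mu theta1 S (fun h s => F h s ^+ 2) <= 4 * n%:R.
  have := @avg_quenched_le R mu theta1 n S (fun h s => F h s ^+ 2) (fun=> 4 * n%:R) bF2 (bm_cst _).
  by rewrite Rint_cst; apply => h; exact: outside_defect_second_moment.
have h2 : avg mu theta1 S (fun h _ => G h ^+ 2) <= 4 * n%:R.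
  rewrite avg_field (second_moment_iid_sum bxi xi0) mulrC; apply: ler_pM => //.
    by apply: Rintegral_ge0 => h _; exact: sqr_ge0.
  by rewrite ler_nat -[leqRHS](card_ord n) max_card.
lra.
Qed.

End outside.

Section null_law.
Context {R : realType} (mu : probability (measurableTypeR R) R) {n : nat}.

Lemma null_sum_moment :
  \sum_s P0 mu s * (\sum_(i < n) (spin R (s i) - null_mean mu)) ^+ 2 <= 16 * n%:R.
Proof.
have := outside_sum_moment mu 1 (finset.set0 : {set 'I_n}); apply: le_trans.
apply: le_of_eq; apply: eq_bigr => s _.
rewrite -P0E /outside_sum; congr (_ * _ ^+ 2).
by apply: eq_bigl => i; rewrite !inE.
Qed.

Lemma P0_ge0 (s : config n) : 0 <= P0 mu s.
Proof. by rewrite (P0E mu 1) PS_ge0. Qed.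

Lemma sum_P0 : \sum_(s : config n) P0 mu s = 1.
Proof.
rewrite -(sum_PS mu 1 (finset.set0 : {set 'I_n})).
by apply: eq_bigr => s _; exact: P0E.
Qed.

End null_law.

(** * The pair statistic *)

Section pair_statistic.
Context {R : realType} (mu : probability (measurableTypeR R) R).
Variable (tau : nat).

(** The normalization of [phi8] apart from the number of pairs. *)
Definition pair_scale (k : nat) : R :=
  k%:R `^ (- ((4 * tau%:R - 3) / (2 * tau%:R - 1))).

Lemma pair_scale_ge0 k : 0 <= pair_scale k.
Proof. exact: powR_ge0. Qed.

Definition total_sum {n} (s : config n) : R :=
  \sum_(i < n) (spin R (s i) - null_mean mu).

Lemma pair_difference {n} (a b : config n) :
  \sum_(i < n) (spin R (a i) - spin R (b i)) = total_sum a - total_sum b.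
Proof. by rewrite -sumrB; apply: eq_bigr => i _; ring. Qed.

(** Markov's inequality for the statistic, whose mean is of order [n *
    pair_scale k]. *)
Lemma pair_test_null n m k (td : R) : 0 < td -> (1 <= m)%N ->
  prod_prob (P0 mu (n := n)) (fun s : (2 * m).-tuple (config n) => pair_test k tau s td)
  <= 64 * (n%:R * pair_scale k) / td.
Proof.
move=> td0 m1; have m0 : 0 < m%:R :> R by rewrite ltr0n.
set ka := pair_scale k.
have ka0 : 0 <= ka := pair_scale_ge0 k.
pose c : R := m%:R^-1 * ka / td * 2.
have c0 : 0 <= c by rewrite !mulr_ge0 ?invr_ge0// ltW.
pose Y (s : config n) := total_sum s ^+ 2.
pose F (s : (2 * m).-tuple (config n)) := \sum_(j < m) c * Y (tnth s (pair_fst j)) +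
  \sum_(j < m) c * Y (tnth s (pair_snd j)).
have Y0 s : 0 <= Y s by exact: sqr_ge0.
have F0 s : 0 <= F s by rewrite addr_ge0// sumr_ge0// => j _; rewrite mulr_ge0.
have P00 (s : config n) : 0 <= P0 mu s by exact: P0_ge0.
have P01 : \sum_(s : config n) P0 mu s = 1 by exact: sum_P0.
apply: (@le_trans _ _ (\sum_(s : (2 * m).-tuple (config n)) (\prod_(j < 2 * m) P0 mu (tnth s j)) * F s)).
  apply: tuple_markov => // s; rewrite /pair_test /phi8 -/(pair_scale k) -/ka => hs.
  have : 1 <= (m%:R^-1 * ka * \sum_(j < m) (\sum_(i < n) (spin R (tnth s (pair_fst j) i)
       - spin R (tnth s (pair_snd j) i))) ^+ 2) / td by rewrite ler_pdivlMr// mul1r.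
  move/le_trans; apply; rewrite /F -big_split /= mulrAC mulr_sumr; apply: ler_sum => j _.
  rewrite pair_difference /c /Y -mulrDr -[leRHS]mulrA ler_wpM2l//.
    by rewrite !mulr_ge0 ?invr_ge0// ltW.
  by have := sqr_ge0 (total_sum (tnth s (pair_fst j)) + total_sum (tnth s (pair_snd j))); lra.
under eq_bigr do rewrite mulrDr.
rewrite big_split /=.
have hY : \sum_(x : config n) P0 mu x * Y x <= 16 * n%:R by exact: null_sum_moment.
have half (f : 'I_m -> 'I_(2 * m)) : \sum_(s : (2 * m).-tuple (config n))
    (\prod_(j < 2 * m) P0 mu (tnth s j)) * (\sum_(j < m) c * Y (tnth s (f j)))
    <= 32 * (n%:R * ka) / td.
  rewrite (tuple_sum_marginal P01 _ (fun=> c) f (fun=> Y)).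
  rewrite sumr_const card_ord -[leLHS]mulr_natl.
  apply: (@le_trans _ _ (m%:R * (c * (16 * n%:R)))).
    by rewrite ler_wpM2l// ler_wpM2l.
  apply: le_of_eq.
  by rewrite /c; field; rewrite !gt_eqF.
have := lerD (half (@pair_fst m)) (half (@pair_snd m)).
move/le_trans; apply; apply: le_of_eq; field.
by rewrite gt_eqF.
Qed.

(** Markov's inequality for [expR (- m * phi8)], a product over the
    independent pairs. *)
Lemma pair_test_miss n m k (p : config n -> R) (td w : R) :
  (forall s, 0 <= p s) -> (1 <= m)%N ->
  \sum_a \sum_b p a * p b * expR (- (pair_scale k *
    (\sum_(i < n) (spin R (a i) - spin R (b i))) ^+ 2)) <= expR (- w) ->
  prod_prob p (predC (fun s : (2 * m).-tuple (config n) => pair_test k tau s td))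
  <= expR (m%:R * (td - w)).
Proof.
move=> p0 m1 hw; have m0 : 0 < m%:R :> R by rewrite ltr0n.
pose g (a b : config n) : R := expR (- (pair_scale k *
    (\sum_(i < n) (spin R (a i) - spin R (b i))) ^+ 2)).
pose F (s : (2 * m).-tuple (config n)) := expR (m%:R * td) *
  \prod_(j < m) g (tnth s (pair_fst j)) (tnth s (pair_snd j)).
have F0 s : 0 <= F s by rewrite mulr_ge0 ?expR_ge0// prodr_ge0// => j _; exact: expR_ge0.
apply: (@le_trans _ _ (\sum_(s : (2 * m).-tuple (config n)) (\prod_(j < 2 * m) p (tnth s j)) * F s)).
  apply: tuple_markov => // s; rewrite /= /pair_test -ltNge /phi8 -/(pair_scale k) => hs.
  rewrite /F -expR_sum -expRD -[leLHS]expR0 ler_expR sumrN -mulr_sumr subr_ge0.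
  by rewrite -ler_pdivrMl// mulrA ltW.
under eq_bigr do rewrite mulrCA.
rewrite -mulr_sumr sum_tuple_prod_pairs mulrBr expRD ler_wpM2l ?expR_ge0//.
rewrite -mulrN expRM_natl lerXn2r ?nnegrE ?expR_ge0//.
by apply: sumr_ge0 => a _; apply: sumr_ge0 => b _; rewrite !mulr_ge0 ?expR_ge0.
Qed.

End pair_statistic.

Section regime_two.
Context {R : realType} (mu : probability (measurableTypeR R) R) (theta1 : R).
Hypothesis mu_int : mu.-integrable setT (EFin \o (fun h : R => h)).
Hypothesis theta1_gt0 : 0 < theta1.
Variables (tau : nat) (xs : R).
Hypothesis noncentered : (\int[mu]_h tanh h)%R <> 0.
Hypothesis xs_min : forall x : R, x <> xs ->
      free_energy mu theta1 xs < free_energy mu theta1 x.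
Hypothesis xs_flat : has_flatness (free_energy mu theta1) xs tau.
Hypothesis tau_ge2 : (2 <= tau)%N.
Let sq := Num.sqrt theta1.
Let sq_gt0 : 0 < sq. Proof. by rewrite sqrtr_gt0. Qed.
Let sqq : sq ^+ 2 = theta1. Proof. by rewrite sqr_sqrtr// ltW. Qed.
Local Notation p := (2 * tau).-1.
Local Notation x S := (scaled_mag theta1 S).

Let tau4 : 0 < 2 * tau%:R - 1 :> R.
Proof. by have : (2 : R) <= tau%:R; [rewrite ler_nat|lra]. Qed.

(** The separation scale [1 / v] of two magnetizations, seen on the sum of the
    clique spins, is the inverse square root of the normalization. *)
Lemma pair_velocity (k : nat) : (0 < k)%N -> exists v : R,
  [/\ 0 < v, v ^+ p = Num.sqrt k%:R & v ^+ 2 = pair_scale tau k * k%:R ^+ 2].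
Proof.
move=> k0; have kp : 0 < k%:R :> R by rewrite ltr0n.
have pE : p%:R = 2 * tau%:R - 1 :> R.
  by rewrite -subn1 natrB ?natrM// muln_gt0/=; case: tau tau_ge2.
pose v : R := k%:R `^ (1 / (2 * (2 * tau%:R - 1))).
exists v; split; first exact: powR_gt0.
  rewrite -powR_mulrn ?powR_ge0// -powRrM pE -powR12_sqrt; last exact: ltW.
  by congr powR; field; rewrite gt_eqF.
rewrite -powR_mulrn ?powR_ge0// -powRrM /pair_scale -powR_mulrn; last exact: ltW.
rewrite -powRD; last by rewrite (gt_eqF kp) implybT.
by congr powR; field; rewrite gt_eqF.
Qed.

Lemma total_sumE {n} (S : {set 'I_n}) (s s' : config n) :
  total_sum mu s - total_sum mu s' = clique_sum S s - clique_sum S s' +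
     (outside_sum mu S s - outside_sum mu S s').
Proof.
rewrite /total_sum /clique_sum /outside_sum -!sumrB (bigID (mem S)) /=; congr (_ + _).
  by apply: eq_bigr => i _; ring.
by apply: eq_bigl => i; rewrite inE.
Qed.

(** In the second regime the [n - k] spins outside the clique fluctuate less
    than the magnetization of the clique, so the separation of two copies is
    seen by the sum over all coordinates. *)
Lemma pair_statistic_separation : exists w : R, exists e : R, exists k0 : nat,
  [/\ 0 < w, 0 < e & forall n (S : {set 'I_n}), (k0 <= #|S|)%N -> (0 < #|S|)%N ->
   n%:R * pair_scale tau #|S| <= e ->
   \sum_a \sum_b PS mu theta1 S a * PS mu theta1 S b *
     expR (- (pair_scale tau #|S| * (\sum_(i < n) (spin R (a i) - spin R (b i))) ^+ 2))
   <= expR (- w)].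
Proof.
have [w [k0 [w0 hsep]]] :=
  two_copy_separation mu_int theta1_gt0 noncentered xs_min xs_flat tau_ge2.
pose M := 3 * theta1 + 1; have M0 : 0 < M by rewrite /M; move: theta1_gt0; lra.
have t96 : 0 < 96 * theta1 by move: theta1_gt0; lra.
exists (w / (4 * M)), (w / (2 * (96 * theta1))), k0; split.
- by rewrite divr_gt0// mulr_gt0.
- by rewrite divr_gt0// mulr_gt0.
move=> n S Sk S0; set ka : R := pair_scale tau #|S|; set k : R := #|S|%:R => hn.
have ka0 : 0 <= ka := pair_scale_ge0 tau #|S|.
have kp : 0 < k by rewrite ltr0n.
have [v [v0 vp v2]] := pair_velocity S0.
have {}hsep := hsep n S Sk S0 v v0 vp.
pose P := PS mu theta1 S; pose D (a b : config n) := total_sum mu a - total_sum mu b.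
pose O := outside_sum mu S.
have P0' s : 0 <= P s by exact: PS_ge0.
have P1 : \sum_s P s = 1 by exact: sum_PS.
have pw a b : Num.min (v * `|x S b - x S a|) 1 ^+ 2 <=
    M * Num.min (ka * D b a ^+ 2) 1 + 3 * theta1 * ka * (O b ^+ 2 + O a ^+ 2).
  have e1 : (v * `|x S b - x S a|) ^+ 2 = theta1 * ka * (D b a - O b + O a) ^+ 2.
    rewrite exprMn v2 real_normK ?num_real// /D (total_sumE S) -/ka.
    rewrite (_ : x S b - x S a = sq * (clique_sum S b - clique_sum S a) / k); last first.
      by rewrite /scaled_mag -/sq -/k; ring.
    rewrite -/k -sqq /O.
    rewrite (_ : _ + _ - _ + _ = clique_sum S b - clique_sum S a); last by ring.
    by field; rewrite gt_eqF.
  have e0 : 0 <= v * `|x S b - x S a| by rewrite mulr_ge0// ltW.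
  have tk : 0 <= theta1 * ka by rewrite mulr_ge0// ltW.
  have e2 : (v * `|x S b - x S a|) ^+ 2 <= 3 * theta1 * (ka * D b a ^+ 2) +
      3 * theta1 * ka * (O b ^+ 2 + O a ^+ 2).
    rewrite e1 (_ : _ + _ = theta1 * ka * (3 * (D b a ^+ 2 + O b ^+ 2 + O a ^+ 2))); last by ring.
    (* [(d - o + o') ^ 2 <= 3 * (d ^ 2 + o ^ 2 + o' ^ 2)] *)
    rewrite ler_wpM2l//; move: (D b a) (O b) (O a) => d o o'.
    have := sqr_ge0 (d + o); have := sqr_ge0 (d - o'); have := sqr_ge0 (o + o'); lra.
  have r0 : 0 <= 3 * theta1 * ka * (O b ^+ 2 + O a ^+ 2).
    by apply: mulr_ge0; [rewrite -mulrA mulr_ge0|rewrite addr_ge0 ?sqr_ge0].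
  have d0 : 0 <= ka * D b a ^+ 2 by rewrite mulr_ge0 ?sqr_ge0.
  have t0 := ltW theta1_gt0.
  move: (v * `|_|) (ka * D b a ^+ 2) (3 * theta1 * ka * _) e0 e2 r0 d0 => e y r e0 e2 r0 d0.
  have m1 : Num.min e 1 ^+ 2 <= 1.
    by rewrite expr_le1// ?le_min ?e0 ?ler01// ge_min lexx orbT.
  have m2 : Num.min e 1 ^+ 2 <= e ^+ 2.
    by rewrite lerXn2r ?nnegrE ?le_min ?e0 ?ler01// ge_min lexx.
  rewrite /M; have [yy|yy] := leP y 1.
    by apply: (le_trans m2); apply: (le_trans e2); lra.
  by apply: (le_trans m1); lra.
pose E2 (f : config n -> config n -> R) := \sum_a \sum_b P a * P b * f a b.
have E2D f g : E2 (fun a b => f a b + g a b) = E2 f + E2 g.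
  rewrite /E2 -big_split; apply: eq_bigr => a _; rewrite -big_split; apply: eq_bigr => b _.
  by rewrite /= mulrDr.
have E2Z c f : E2 (fun a b => c * f a b) = c * E2 f.
  rewrite /E2 mulr_sumr; apply: eq_bigr => a _; rewrite mulr_sumr; apply: eq_bigr => b _.
  by rewrite mulrCA.
have le_E2 f g : (forall a b, f a b <= g a b) -> E2 f <= E2 g.
  move=> fg; apply: ler_sum => a _; apply: ler_sum => b _.
  by rewrite ler_wpM2l// mulr_ge0.
have E2l f : E2 (fun a _ => f a) = \sum_a P a * f a.
  apply: eq_bigr => a _; rewrite -mulr_suml -mulr_sumr P1 mulr1//.
have E2r f : E2 (fun _ b => f b) = \sum_b P b * f b.
  rewrite /E2; under eq_bigr do under eq_bigr do rewrite -mulrA.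
  by under eq_bigr do rewrite -mulr_sumr; rewrite -mulr_suml P1 mul1r.
have E21 c : E2 (fun _ _ => c) = c by rewrite E2r -mulr_suml P1 mul1r.
have hO : \sum_s P s * O s ^+ 2 <= 16 * n%:R by exact: outside_sum_moment.
have hs : w <= E2 (fun a b => Num.min (v * `|x S b - x S a|) 1 ^+ 2).
  apply: (le_trans hsep); apply: le_of_eq.
  apply: eq_bigr => a _; rewrite mulr_sumr; apply: eq_bigr => b _.
  by rewrite mulrA.
pose Z := E2 (fun a b => Num.min (ka * D b a ^+ 2) 1).
have hZ : w / (2 * M) <= Z.
  have := le_trans hs (le_E2 _ _ pw); rewrite E2D E2Z E2Z E2D (E2r (fun s => O s ^+ 2)) (E2l (fun s => O s ^+ 2)) -/Z => h1.
  have h2 : 3 * theta1 * ka * (\sum_s P s * O s ^+ 2 + \sum_s P s * O s ^+ 2) <= w / 2.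
    apply: (@le_trans _ _ (3 * theta1 * ka * (16 * n%:R + 16 * n%:R))).
      by rewrite ler_wpM2l ?lerD// -mulrA !mulr_ge0// ltW.
    have := ler_wpM2l (ltW t96) hn.
    rewrite (_ : 96 * theta1 * (w / (2 * (96 * theta1))) = w / 2); last by field; rewrite gt_eqF.
    by apply: le_trans; apply: le_of_eq; ring.
  rewrite ler_pdivrMr ?mulr_gt0//.
  by move: h1 h2; move: (3 * theta1 * ka * _) => y; rewrite [Z * _]mulrC -mulrA; lra.
rewrite -/P; apply: (@le_trans _ _ (E2 (fun a b => 1 + - (2^-1) * Num.min (ka * D b a ^+ 2) 1))).
  apply: le_E2 => a b; rewrite (pair_difference mu) -/(D a b).
  have -> : D a b ^+ 2 = D b a ^+ 2 by rewrite -sqrrN /D opprB.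
  have := expRN_le_min (mulr_ge0 ka0 (sqr_ge0 (D b a))).
  by move/le_trans; apply; apply: le_of_eq; field.
rewrite E2D E21 E2Z -/Z; apply: le_trans (expR_ge1Dx _); rewrite lerD2l.
have -> : w / (4 * M) = 2^-1 * (w / (2 * M)) by field; rewrite gt_eqF.
by rewrite mulNr lerN2 ler_wpM2l// invr_ge0.
Qed.

End regime_two.

(** * Chernoff bounds under the null *)

Section null_chernoff.
Context {R : realType} (mu : probability (measurableTypeR R) R).
Local Notation b := (null_mean mu).

Definition single_law (c : bool) : R :=
  (\int[mu]_h (expR (h * spin R c) / (expR h + expR (- h))))%R.

Let single_weight (c : bool) (h : measurableTypeR R) : R :=
  (1 + spin R c * tanh h) / 2.

Let bm_tanh : bounded_mfun (fun h : measurableTypeR R => tanh h).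
Proof.
have := bm_tanh_translate (0 : R); congr bounded_mfun.
by apply/funext => h; rewrite add0r.
Qed.

Let single_weightE (c : bool) (h : R) :
  expR (h * spin R c) / (expR h + expR (- h)) = single_weight c h.
Proof.
have d0 : expR h + expR (- h) != 0 by rewrite gt_eqF// addr_gt0 ?expR_gt0.
by rewrite /single_weight /tanh; case: c; rewrite /spin ?mulr1 ?mulrN1; field.
Qed.

Let bm_single (c : bool) : bounded_mfun (single_weight c).
Proof.
apply: bmM; last exact: bm_cst.
by apply: bmD; [exact: bm_cst|exact: bmZ].
Qed.

Lemma single_lawE (c : bool) : single_law c = (1 + spin R c * b) / 2.
Proof.
rewrite /single_law; under eq_Rintegral do rewrite single_weightE.
have -> : (fun h : measurableTypeR R => single_weight c h) =
    (fun h => 2^-1 + (spin R c / 2) * tanh h).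
  by apply/funext => h; rewrite /single_weight; field.
have bt := bmZ (spin R c / 2) bm_tanh.
rewrite (RintD mu (bm_cst _) bt) Rint_cst (RintZ mu _ bm_tanh) /null_mean.
by field.
Qed.

(** The Gibbs weight factorizes over the sites, and so does the law of the
    field. *)
Lemma P0_product n (s : config n) : P0 mu s = \prod_(i < n) single_law (s i).
Proof.
rewrite /P0 /single_law -(Rint_iid_prod mu
  (f := fun i h => expR (h * spin R (s i)) / (expR h + expR (- h)))); last first.
  move=> i; have := bm_single (s i); congr bounded_mfun.
  by apply/funext => h; rewrite single_weightE.
apply: eq_Rintegral => h _; rewrite /gibbs big_split /= prodfV -expR_sum.
congr (_ / _).
have -> : \prod_(i < n) (expR (tnth h i) + expR (- tnth h i)) =
   \prod_(i < n) \sum_(c : bool) expR (tnth h i * spin R c).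
  by apply: eq_bigr => i _; rewrite big_bool /= mulr1 mulrN1.
rewrite bigA_distr_bigA; apply: eq_bigr => t _.
by rewrite -expR_sum.
Qed.

Lemma single_law_ge0 c : 0 <= single_law c.
Proof.
apply: Rintegral_ge0 => h _; rewrite divr_ge0 ?expR_ge0// ltW// addr_gt0 ?expR_gt0//.
Qed.

Lemma norm_null_mean_le1 : `|b| <= 1.
Proof. by apply: Rint_norm_le => // h; exact: norm_tanh_le1. Qed.

Lemma single_exp_moment (lam : R) : `|lam| <= 1 / 4 ->
  \sum_(c : bool) single_law c * expR (lam * (spin R c - b)) <= expR (8 * lam ^+ 2).
Proof.
move=> l4; have b1 := norm_null_mean_le1.
have [b2 b3] : -1 <= b /\ b <= 1 by move: b1; rewrite ler_norml => /andP.
have key c : expR (lam * (spin R c - b)) <= 1 + lam * (spin R c - b) + 8 * lam ^+ 2.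
  have y2 : `|spin R c - b| <= 2.
    by apply: (le_trans (ler_normB _ _)); rewrite norm_spin; lra.
  have ly : `|lam * (spin R c - b)| <= 1 / 2.
    by rewrite normrM; have := normr_ge0 lam; have := normr_ge0 (spin R c - b); nra.
  apply: (le_trans (expR_le_quadratic (le_trans (ler_norm _) ly))).
  rewrite lerD2l exprMn mulrCA [leRHS]mulrC ler_wpM2l ?sqr_ge0//.
  by rewrite -real_normK ?num_real//; have := normr_ge0 (spin R c - b); nra.
apply: le_trans (expR_ge1Dx _).
apply: (@le_trans _ _ (\sum_(c : bool) single_law c * (1 + lam * (spin R c - b) + 8 * lam ^+ 2))).
  by apply: ler_sum => c _; rewrite ler_wpM2l ?single_law_ge0.
rewrite big_bool /= !single_lawE /spin; apply: le_of_eq.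
by field.
Qed.

Lemma null_exp_moment n (A : {set 'I_n}) (lam : R) : `|lam| <= 1 / 4 ->
  \sum_(s : config n) P0 mu s * expR (lam * \sum_(i in A) (spin R (s i) - b))
  <= expR (8 * lam ^+ 2 * #|A|%:R).
Proof.
move=> l4.
have -> : \sum_(s : config n) P0 mu s * expR (lam * \sum_(i in A) (spin R (s i) - b)) =
  \prod_(i < n) \sum_(c : bool) (single_law c * (if i \in A then expR (lam * (spin R c - b)) else 1)).
  rewrite bigA_distr_bigA; apply: eq_bigr => s _.
  rewrite P0_product [RHS]big_split /=; congr (_ * _).
  by rewrite mulr_sumr expR_sum big_mkcond.
rewrite mulrC expRM_natl -prodr_const [leRHS]big_mkcond /=.
apply: ler_prod => i _; apply/andP; split.
  apply: sumr_ge0 => c _; rewrite mulr_ge0 ?single_law_ge0//.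
  by case: ifP => // _; exact: expR_ge0.
case: ifP => _; first exact: single_exp_moment.
rewrite big_bool /= !single_lawE /spin; apply: le_of_eq.
by field.
Qed.

Definition sample_sum n m (A : {set 'I_n}) (s : m.-tuple (config n)) : R :=
  \sum_(j < m) \sum_(i in A) (spin R (tnth s j i) - b).

Lemma null_sample_exp_moment n m (A : {set 'I_n}) (lam : R) : `|lam| <= 1 / 4 ->
  \sum_(s : m.-tuple (config n)) (\prod_(j < m) P0 mu (tnth s j)) *
     expR (lam * sample_sum A s) <= expR (8 * lam ^+ 2 * #|A|%:R * m%:R).
Proof.
move=> l4.
have -> : \sum_(s : m.-tuple (config n)) (\prod_(j < m) P0 mu (tnth s j)) *
     expR (lam * sample_sum A s) = \prod_(j < m)
   \sum_(s : config n) P0 mu s * expR (lam * \sum_(i in A) (spin R (s i) - b)).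
  rewrite -(sum_tuple_prod (fun _ s => P0 mu s * expR (lam * \sum_(i in A) (spin R (s i) - b)))).
  by apply: eq_bigr => s _; rewrite big_split /= mulr_sumr expR_sum.
rewrite prodr_const card_ord mulrC expRM_natl lerXn2r ?nnegrE ?expR_ge0//.
  by apply: sumr_ge0 => s _; rewrite mulr_ge0 ?expR_ge0// P0_ge0.
exact: null_exp_moment.
Qed.

(** An exponential weight that is at least one when the sum over [A] deviates
    from its null mean by [delta / 2] per spin. The parameter [lam = delta /
    32] minimizes the exponent [8 * lam ^ 2 - lam * delta / 2] of its mean. *)
Definition deviation_weight n m (delta : R) (A : {set 'I_n}) (s : m.-tuple (config n)) : R :=
  expR (delta / 32 * sample_sum A s - delta ^+ 2 / 64 * (m%:R * #|A|%:R)) +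
  expR (- (delta / 32) * sample_sum A s - delta ^+ 2 / 64 * (m%:R * #|A|%:R)).

Lemma deviation_weight_ge0 n m delta (A : {set 'I_n}) (s : m.-tuple (config n)) :
  0 <= deviation_weight delta A s.
Proof. by rewrite addr_ge0 ?expR_ge0. Qed.

Lemma deviation_weight_ge1 n m delta (A : {set 'I_n}) (s : m.-tuple (config n)) :
  0 < delta -> delta / 2 * (m%:R * #|A|%:R) <= `|sample_sum A s| ->
  1 <= deviation_weight delta A s.
Proof.
move=> d0; have d32 : 0 <= delta / 32 by rewrite divr_ge0// ltW.
rewrite ler_normr => /orP[] /(ler_wpM2l d32) h; rewrite /deviation_weight.
  apply: (@le_trans _ _ (expR (delta / 32 * sample_sum A s - delta ^+ 2 / 64 * (m%:R * #|A|%:R)))).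
    by rewrite -[leLHS]expR0 ler_expR; lra.
  by rewrite lerDl expR_ge0.
apply: (@le_trans _ _ (expR (- (delta / 32) * sample_sum A s - delta ^+ 2 / 64 * (m%:R * #|A|%:R)))).
  by rewrite -[leLHS]expR0 ler_expR; lra.
by rewrite lerDr expR_ge0.
Qed.

Lemma deviation_weight_mean n m (delta : R) (A : {set 'I_n}) : 0 < delta <= 8 ->
  \sum_(s : m.-tuple (config n)) (\prod_(j < m) P0 mu (tnth s j)) * deviation_weight delta A s
  <= 2 * expR (- (delta ^+ 2 / 128 * (m%:R * #|A|%:R))).
Proof.
move=> /andP[d0 d8]; have l4 : `|delta / 32| <= 1 / 4 by rewrite ger0_norm; lra.
have l4' : `|- (delta / 32)| <= 1 / 4 by rewrite normrN.
pose E := expR (- (delta ^+ 2 / 64 * (m%:R * #|A|%:R))).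
have e (s : m.-tuple (config n)) : deviation_weight delta A s = expR (delta / 32 * sample_sum A s) * E +
    expR (- (delta / 32) * sample_sum A s) * E.
  by rewrite /deviation_weight !expRD.
under eq_bigr do rewrite e mulrDr !mulrA.
rewrite big_split /= -!mulr_suml -mulrDl.
have h1 := null_sample_exp_moment m A l4; have h2 := null_sample_exp_moment m A l4'.
rewrite sqrrN in h2.
apply: (le_trans (ler_wpM2r (expR_ge0 _) (lerD h1 h2))).
rewrite -[X in X * _]mulr2n -[X in X * _]mulr_natl -mulrA.
rewrite ler_wpM2l// /E -expRD ler_expR.
by move: (m%:R) (#|A|%:R) => x y; apply: le_of_eq; field.
Qed.

Lemma clique_mean_sample_sum n m k (s : m.-tuple (config n)) (S : {set 'I_n}) :
  (0 < m)%N -> (0 < k)%N -> #|S| = k ->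
  clique_mean R k s S = b + sample_sum S s / (m%:R * k%:R).
Proof.
move=> m0 k0 Sk; rewrite /clique_mean /sample_sum.
have -> : \sum_(j < m) \sum_(i in S) (spin R (tnth s j i) - b) =
   \sum_(j < m) \sum_(i in S) spin R (tnth s j i) - m%:R * (k%:R * b).
  under eq_bigr do rewrite sumrB sumr_const Sk.
  by rewrite sumrB sumr_const card_ord -[_ *+ m]mulr_natl -[b *+ k]mulr_natl.
by field; rewrite !pnatr_eq0 -!lt0n m0 k0.
Qed.

Lemma overall_mean_sample_sum n m (s : m.-tuple (config n)) :
  (0 < m)%N -> (0 < n)%N ->
  overall_mean R s = b + sample_sum [set: 'I_n]%SET s / (m%:R * n%:R).
Proof.
move=> m0 n0; rewrite -(clique_mean_sample_sum s m0 n0) ?cardsT ?card_ord//.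
rewrite /overall_mean /clique_mean; congr (_ * _); apply: eq_bigr => j _.
by apply: eq_bigl => i; rewrite !inE.
Qed.

End null_chernoff.

(** * The mean test *)

Section mean_test_null.
Context {R : realType} (mu : probability (measurableTypeR R) R).
Local Notation b := (null_mean mu).

(** If a clique average and the overall average differ by [delta], one of them
    is [delta / 2] away from the null mean: a union bound over the cliques and
    the full set. *)
Lemma mean_test_null n m k (delta : R) : 0 < delta <= 8 ->
  (0 < m)%N -> (0 < k)%N -> (k <= n)%N ->
  256 / delta ^+ 2 * ln n%:R <= m%:R ->
  prod_prob (P0 mu (n := n)) (fun s : m.-tuple (config n) => mean_test k s delta)
  <= 4 / k%:R.
Proof.
move=> d08 m0 k0 kn hm; have /andP[d0 d8] := d08.
have n0 : (0 < n)%N by exact: leq_trans kn.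
have mp : 0 < m%:R :> R by rewrite ltr0n.
have kp : 0 < k%:R :> R by rewrite ltr0n.
have np : 0 < n%:R :> R by rewrite ltr0n.
pose F (s : m.-tuple (config n)) := \sum_(S : {set 'I_n} | #|S| == k) deviation_weight mu delta S s
  + deviation_weight mu delta [set: 'I_n]%SET s.
have F0 s : 0 <= F s.
  by rewrite addr_ge0 ?deviation_weight_ge0// sumr_ge0// => S _; exact: deviation_weight_ge0.
have dev_F s (S : {set 'I_n}) : #|S| = k ->
    delta < `|clique_mean R k s S - overall_mean R s| -> 1 <= F s.
  move=> Sk; rewrite (clique_mean_sample_sum mu s m0 k0 Sk) (overall_mean_sample_sum mu s m0 n0).
  set u := sample_sum mu S s / _; set u' := sample_sum mu _ s / _ => hd.
  have : (delta / 2 <= `|u|) || (delta / 2 <= `|u'|).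
    apply/orP; have [|h1] := leP (delta / 2) `|u|; first by left.
    have [|h2] := leP (delta / 2) `|u'|; first by right.
    have : `|b + u - (b + u')| <= `|u| + `|u'|.
      by rewrite (_ : b + u - (b + u') = u - u') ?ler_normB//; ring.
    by move: hd; lra.
  case/orP => h.
    have hS : 1 <= deviation_weight mu delta S s.
      apply: deviation_weight_ge1 => //; rewrite Sk -ler_pdivlMr ?mulr_gt0//.
      by move: h; rewrite /u normrM normfV (ger0_norm (_ : 0 <= m%:R * k%:R))// mulr_ge0// ltW.
    apply: (le_trans hS); rewrite /F (bigD1 S)/=; last by rewrite Sk.
    rewrite -addrA lerDl addr_ge0 ?deviation_weight_ge0//.
    by apply: sumr_ge0 => S' _; exact: deviation_weight_ge0.
  have hT : 1 <= deviation_weight mu delta [set: 'I_n]%SET s.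
    apply: deviation_weight_ge1 => //; rewrite cardsT card_ord -ler_pdivlMr ?mulr_gt0//.
    by move: h; rewrite /u' normrM normfV (ger0_norm (_ : 0 <= m%:R * n%:R))// mulr_ge0// ltW.
  apply: (le_trans hT); rewrite /F lerDr; apply: sumr_ge0 => S' _; exact: deviation_weight_ge0.
have [S0 S0k] : exists S : {set 'I_n}, #|S| = k.
  have : (0 < #|[set A : {set 'I_n} | #|A| == k]%SET|)%N.
    by rewrite card_draws card_ord bin_gt0.
  by case/card_gt0P => S; rewrite inE => /eqP; exists S.
have P00 (s : config n) : 0 <= P0 mu s by exact: P0_ge0.
apply: (@le_trans _ _ (\sum_(s : m.-tuple (config n)) (\prod_(j < m) P0 mu (tnth s j)) * F s)).
  apply: tuple_markov => // s /orP[].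
    case/sup_gt; first by exists (clique_mean R k s S0); exists S0.
    move=> _ [S Sk <-] h; apply: (dev_F s S Sk).
    by rewrite ltr_normr; apply/orP; left; move: h; lra.
  case/inf_lt; first by exists (clique_mean R k s S0); exists S0.
  move=> _ [S Sk <-] h; apply: (dev_F s S Sk).
  by rewrite ltr_normr; apply/orP; right; move: h; lra.
under eq_bigr do rewrite mulrDr mulr_sumr.
rewrite big_split /= exchange_big /=.
pose L := ln (n%:R : R).
have L0 : 0 <= L by rewrite ln_ge0// ler1n.
(* the constant 256 turns a deviation of a clique into [n ^ (- 2 * k)], which
   absorbs the at most [n ^ k] cliques *)
have hL : 2 * L <= delta ^+ 2 / 128 * m%:R.
  have dd : 0 < delta ^+ 2 by rewrite exprn_gt0.
  have := ler_wpM2l (ltW dd) hm; rewrite (_ : delta ^+ 2 * (256 / delta ^+ 2 * ln n%:R) = 256 * L); last first.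
    by rewrite /L; move: (delta ^+ 2) dd => y y0; field; rewrite gt_eqF.
  rewrite (_ : delta ^+ 2 / 128 * m%:R = delta ^+ 2 * m%:R / 128); last by ring.
  by move: (delta ^+ 2 * m%:R) => y; lra.
have expL : expR (- L) = n%:R^-1 by rewrite expRN /L lnK ?posrE.
have nk1 : (n%:R : R)^-1 <= k%:R^-1 by rewrite lef_pV2 ?posrE// ler_nat.
have -> : 4 / k%:R = 2 / k%:R + 2 / k%:R :> R by field; rewrite gt_eqF.
have tail (j : nat) : (0 < j)%N -> 2 * expR (- (delta ^+ 2 / 128 * (m%:R * j%:R))) <= 2 * expR (- (2 * L * j%:R)).
  by move=> j0; rewrite ler_wpM2l// ler_expR lerN2 mulrA ler_wpM2r.
apply: lerD.
  apply: (@le_trans _ _ (\sum_(S : {set 'I_n} | #|S| == k) 2 * expR (- (2 * L * k%:R)))).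
    apply: ler_sum => S /eqP Sk; apply: le_trans (deviation_weight_mean mu m S d08) _.
    by rewrite Sk; exact: tail.
  rewrite sumr_const (_ : #|_| = 'C(n, k)); last first.
    have := card_draws 'I_n k; rewrite card_ord => <-; apply: eq_card => S; by rewrite !inE.
  rewrite -[leLHS]mulr_natl.
  apply: (@le_trans _ _ (expR (L * k%:R) * (2 * expR (- (2 * L * k%:R))))).
    rewrite ler_wpM2r ?mulr_ge0 ?expR_ge0// mulrC expRM_natl /L lnK ?posrE//.
    by rewrite -natrX ler_nat bin_le_exp.
  rewrite mulrCA -expRD ler_wpM2l//; apply: le_trans nk1; rewrite -expL ler_expR.
  have : L <= L * k%:R by rewrite ler_peMr// ler1n.
  by rewrite -[2 * L * _]mulrA; move: (L * k%:R) => y; lra.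
apply: le_trans (deviation_weight_mean mu m [set: 'I_n]%SET d08) _.
rewrite cardsT card_ord; apply: (le_trans (tail n n0)).
rewrite ler_wpM2l//; apply: le_trans nk1; rewrite -expL ler_expR lerN2.
have : L <= L * n%:R by rewrite ler_peMr// ler1n.
by rewrite -[2 * L * _]mulrA; move: (L * n%:R) => y; lra.
Qed.

End mean_test_null.

Section mean_test_alternative.
Context {R : realType} (mu : probability (measurableTypeR R) R) (theta1 : R).
Hypothesis mu_int : mu.-integrable setT (EFin \o (fun h : R => h)).
Hypothesis theta1_gt0 : 0 < theta1.
Variables (tau : nat) (xs : R).
Hypothesis xs_min : forall x : R, x <> xs ->
      free_energy mu theta1 xs < free_energy mu theta1 x.
Hypothesis xs_flat : has_flatness (free_energy mu theta1) xs tau.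
Let sq := Num.sqrt theta1.
Let sq_gt0 : 0 < sq. Proof. by rewrite sqrtr_gt0. Qed.
Let xss : `|xs| <= sq. Proof. exact: norm_minimizer_le xs_flat. Qed.
Local Notation b := (null_mean mu).

Definition mean_gap : R := `|xs / Num.sqrt theta1 - null_mean mu|.

Lemma mean_gap_le2 : mean_gap <= 2.
Proof.
rewrite /mean_gap -/sq (le_trans (ler_normB _ _))//.
have h1 : `|xs / sq| <= 1.
  by rewrite normrM normfV (ger0_norm (ltW sq_gt0)) ler_pdivrMr// mul1r.
by have := norm_null_mean_le1 mu; lra.
Qed.

(** The clique average minus the overall average is [1 - k / n] times the
    clique average minus the null mean, up to the outside average. So
    acceptance needs a deviation of the clique magnetization from [xs / sqrt
    theta1], or of the outside average from the null mean. *)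
Lemma mean_test_accept n m k (S : {set 'I_n}) (c delta : R) (s : m.-tuple (config n)) :
  (0 < m)%N -> (0 < k)%N -> #|S| = k -> c < 1 -> k%:R <= c * n%:R ->
  0 < delta < (1 - c) * mean_gap / 2 -> ~~ mean_test k s delta ->
  (1 - c) * mean_gap / 2 <= m%:R^-1 * \sum_(j < m)
    (`|scaled_mag theta1 S (tnth s j) - xs| / sq + `|outside_sum mu S (tnth s j)| / n%:R).
Proof.
move=> m0 k0 Sk c1 kc /andP[d0 dlt]; rewrite negb_or -!leNgt => /andP[hsup hinf].
have mp : 0 < m%:R :> R by rewrite ltr0n.
have kp : 0 < k%:R :> R by rewrite ltr0n.
have n0 : (0 < n)%N.
  by rewrite (leq_trans k0)// -Sk -[leqRHS](card_ord n) max_card.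
have np : 0 < n%:R :> R by rewrite ltr0n.
set phi := clique_mean R k s S; set zeta := overall_mean R s in hsup hinf.
pose A := [set clique_mean R k s S | S in [set S : {set 'I_n} | #|S| = k]].
have Aphi : A phi by exists S.
have bnd : forall y, A y -> `|y| <= (m%:R * k%:R)^-1 * (m%:R * k%:R).
  move=> _ [S' S'k <-]; rewrite /clique_mean normrM normfV (ger0_norm (_ : 0 <= m%:R * k%:R)).
    rewrite ler_wpM2l ?invr_ge0 ?mulr_ge0//.
    apply: (le_trans (ler_norm_sum _ _ _)); apply: (@le_trans _ _ (\sum_(j < m) k%:R)).
      apply: ler_sum => j _; rewrite -S'k; exact: norm_clique_sum_le.
    by rewrite sumr_const card_ord -[leLHS]mulr_natl.
  by rewrite mulr_ge0.
have ubA : has_ubound A.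
  by exists ((m%:R * k%:R)^-1 * (m%:R * k%:R)) => y /bnd; apply: le_trans; exact: ler_norm.
have lbA : has_lbound A.
  by exists (- ((m%:R * k%:R)^-1 * (m%:R * k%:R))) => y /bnd; rewrite ler_norml => /andP[].
have h1 : phi <= zeta + delta by apply: le_trans hsup; exact: ub_le_sup.
have h2 : zeta - delta <= phi by apply: (le_trans hinf); exact: ge_inf.
pose M := xs / sq; pose o := (m%:R * n%:R)^-1 * \sum_(j < m) outside_sum mu S (tnth s j).
have phiE : phi - M = m%:R^-1 * \sum_(j < m) (scaled_mag theta1 S (tnth s j) - xs) / sq.
  rewrite /phi /clique_mean /M /scaled_mag -/sq Sk.
  have -> : \sum_(j < m) (sq * clique_sum S (tnth s j) / k%:R - xs) / sq =
     k%:R^-1 * (\sum_(j < m) \sum_(i in S) spin R (tnth s j i)) - m%:R * (xs / sq).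
    have -> : m%:R * (xs / sq) = \sum_(j < m) xs / sq.
      by rewrite sumr_const card_ord -[RHS]mulr_natl.
    rewrite mulr_sumr -sumrB.
    by apply: eq_bigr => j _; rewrite -/(clique_sum S (tnth s j)); field; rewrite !gt_eqF.
  by field; rewrite !gt_eqF.
have zetaE : phi - zeta = (1 - k%:R / n%:R) * (phi - b) - o.
  rewrite /phi /zeta /clique_mean /overall_mean /o.
  have -> : \sum_(j < m) \sum_(i < n) spin R (tnth s j i) =
     \sum_(j < m) \sum_(i in S) spin R (tnth s j i) +
     \sum_(j < m) outside_sum mu S (tnth s j) + m%:R * ((n%:R - k%:R) * b).
    have -> : m%:R * ((n%:R - k%:R) * b) = \sum_(j < m) (n%:R - k%:R) * b.
      by rewrite sumr_const card_ord -[RHS]mulr_natl.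
    rewrite -!big_split /=; apply: eq_bigr => j _.
    rewrite (bigID (mem S)) /= -addrA; congr (_ + _).
    have -> : (n%:R - k%:R) * b = \sum_(i in ~: S) b.
      by rewrite sumr_const cardsCs finset.setCK card_ord Sk -[RHS]mulr_natl natrB// -Sk -[leqRHS](card_ord n) max_card.
    rewrite /outside_sum -big_split /=; apply: eq_big => [i|i _]; first by rewrite inE.
    by rewrite subrK.
  by field; rewrite !gt_eqF.
have kn1 : k%:R / n%:R <= c by rewrite ler_pdivrMr.
have kn0 : 0 <= k%:R / n%:R :> R by rewrite divr_ge0.
set la := 1 - k%:R / n%:R in zetaE.
have la1 : la <= 1 by rewrite /la; lra.
have lac : 1 - c <= la by rewrite /la; lra.
have g0 : 0 <= mean_gap by exact: normr_ge0.
have e1 : `|phi - zeta| <= delta by rewrite ler_norml; apply/andP; split; lra.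
have e2 : (1 - c) * mean_gap <= `|phi - M| + `|o| + delta.
  apply: (@le_trans _ _ (la * mean_gap)); first by rewrite ler_wpM2r.
  have la0 : 0 <= la by lra.
  rewrite /mean_gap -/sq -/M -[la in leLHS](ger0_norm la0) -normrM.
  have -> : la * (M - b) = (phi - zeta) + o - la * (phi - M).
    by rewrite zetaE; ring.
  apply: le_trans (ler_normB _ _) _.
  have : `|la * (phi - M)| <= `|phi - M| by rewrite normrM (ger0_norm la0) ler_piMl.
  by have := ler_normD (phi - zeta) o; lra.
have e3 : `|phi - M| <= m%:R^-1 * \sum_(j < m) `|scaled_mag theta1 S (tnth s j) - xs| / sq.
  rewrite phiE normrM (ger0_norm (_ : 0 <= m%:R^-1)) ?invr_ge0// ler_wpM2l ?invr_ge0//.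
  apply: (le_trans (ler_norm_sum _ _ _)); apply: ler_sum => j _.
  by rewrite normrM normfV (ger0_norm (ltW sq_gt0)).
have e4 : `|o| <= m%:R^-1 * \sum_(j < m) `|outside_sum mu S (tnth s j)| / n%:R.
  rewrite /o invfM -mulrA normrM (ger0_norm (_ : 0 <= m%:R^-1)) ?invr_ge0// ler_wpM2l ?invr_ge0//.
  rewrite normrM normfV normr_nat mulrC -mulr_suml ler_wpM2r ?invr_ge0//.
  exact: ler_norm_sum.
rewrite big_split /= mulrDr; lra.
Qed.

(** Markov's inequality for the two deviations in [mean_test_accept]; both are
    averages over the samples, so that the first moments of one sample
    suffice. *)
Lemma mean_test_miss (c e : R) : c < 1 -> 0 < e -> 0 < mean_gap ->
  exists k0 : nat, forall n m k (S : {set 'I_n}) (delta : R),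
  (k0 <= k)%N -> (0 < m)%N -> (0 < k)%N -> #|S| = k -> k%:R <= c * n%:R ->
  0 < delta < (1 - c) * mean_gap / 2 ->
  prod_prob (PS mu theta1 S) (predC (fun s : m.-tuple (config n) => mean_test k s delta)) <= e.
Proof.
move=> c1 e0 g0; pose eta := (1 - c) * mean_gap / 2.
have eta0 : 0 < eta by rewrite divr_gt0// mulr_gt0// subr_gt0.
(* the mean of the deviations [f] below will be at most [4 * ep] *)
pose ep := e * eta / 4; have ep0 : 0 < ep by rewrite divr_gt0// mulr_gt0.
have e4 : eta * e = 4 * ep by rewrite /ep; field.
have r0 : 0 < sq * ep by rewrite mulr_gt0.
have [a a0 hfar] := scaled_mag_concentration mu_int theta1_gt0 xs_min xs_flat r0.
have ep2 : 0 < ep / 2 by rewrite divr_gt0.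
have [k1 hk1] := poly_expR_small 1 a0 ep2.
pose k2 := Num.trunc (16 / ep ^+ 2).
exists (maxn k1 k2.+1) => n m k S delta; rewrite geq_max => /andP[kk1 kk2] m0 k0 Sk kc dd.
have mp : 0 < m%:R :> R by rewrite ltr0n.
have kp : 0 < k%:R :> R by rewrite ltr0n.
have kn : (k <= n)%N by rewrite -Sk -[leqRHS](card_ord n) max_card.
have n0 : (0 < n)%N by exact: leq_trans kn.
have np : 0 < n%:R :> R by rewrite ltr0n.
have S0 : (0 < #|S|)%N by rewrite Sk.
pose f (s : config n) : R := `|scaled_mag theta1 S s - xs| / sq + `|outside_sum mu S s| / n%:R.
have f0 s : 0 <= f s by rewrite addr_ge0// divr_ge0// ltW.
pose F (s : m.-tuple (config n)) := \sum_(j < m) (eta^-1 * m%:R^-1) * f (tnth s j).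
have F0 s : 0 <= F s.
  by apply: sumr_ge0 => j _; rewrite mulr_ge0// mulr_ge0// invr_ge0 ltW.
have P00 s : 0 <= PS mu theta1 S s by exact: PS_ge0.
have P01 : \sum_s PS mu theta1 S s = 1 by exact: sum_PS.
apply: (@le_trans _ _ (\sum_(s : m.-tuple (config n)) (\prod_(j < m) PS mu theta1 S (tnth s j)) * F s)).
  apply: tuple_markov => // s /= acc.
  have := mean_test_accept m0 k0 Sk c1 kc dd acc; rewrite -/eta => h.
  rewrite /F -mulr_sumr -mulrA -ler_pdivrMl ?invr_gt0// invrK mulr1.
  exact: h.
rewrite (tuple_sum_marginal P01 _ (fun=> eta^-1 * m%:R^-1) id (fun=> f)).
rewrite sumr_const card_ord -[leLHS]mulr_natl.
have -> : m%:R * (eta^-1 * m%:R^-1 * \sum_x PS mu theta1 S x * f x) =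
   eta^-1 * \sum_x PS mu theta1 S x * f x by field; rewrite !gt_eqF.
clearbody eta; rewrite ler_pdivrMl//.
have pw s : f s <= ep + 2 * (sq * ep <= `|scaled_mag theta1 S s - xs|)%R%:R +
    (ep + (ep * n%:R ^+ 2)^-1 * outside_sum mu S s ^+ 2).
  apply: lerD.
    rewrite ler_pdivrMr//; have [far|/ltW near] := leP (sq * ep) `|scaled_mag theta1 S s - xs|.
      rewrite mulr1; have := le_trans (ler_normB (scaled_mag theta1 S s) xs) (lerD (norm_scaled_mag_le theta1_gt0 S s) xss).
      by rewrite -/sq; have := mulr_ge0 (ltW ep0) (ltW sq_gt0); lra.
    by rewrite mulr0 addr0 mulrC.
  rewrite -[outside_sum mu S s ^+ 2]real_normK ?num_real//; move: (`|_|) => y.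
  rewrite -subr_ge0 (_ : _ - _ = ((ep * n%:R - y / 2) ^+ 2 + 3 / 4 * y ^+ 2) / (ep * n%:R ^+ 2)).
    by rewrite divr_ge0 ?addr_ge0 ?sqr_ge0// mulr_ge0 ?sqr_ge0// ?ltW// divr_ge0.
  by move: (ep) ep0 => l l0; field; rewrite !gt_eqF.
apply: (@le_trans _ _ (\sum_s PS mu theta1 S s * (ep + 2 * (sq * ep <= `|scaled_mag theta1 S s - xs|)%R%:R +
    (ep + (ep * n%:R ^+ 2)^-1 * outside_sum mu S s ^+ 2)))).
  by apply: ler_sum => s _; rewrite ler_wpM2l.
have -> : \sum_s PS mu theta1 S s * (ep + 2 * (sq * ep <= `|scaled_mag theta1 S s - xs|)%R%:R +
    (ep + (ep * n%:R ^+ 2)^-1 * outside_sum mu S s ^+ 2)) =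
  ep + 2 * (\sum_s PS mu theta1 S s * (sq * ep <= `|scaled_mag theta1 S s - xs|)%R%:R) +
    (ep + (ep * n%:R ^+ 2)^-1 * \sum_s PS mu theta1 S s * outside_sum mu S s ^+ 2).
  rewrite -[X in X + 2 * _ + _]mul1r -[X in _ + (X + _)]mul1r -P01 !mulr_suml !mulr_sumr -!big_split /=.
  by apply: eq_bigr => s _; ring.
have t1 := hfar n S S0; have t2 := hk1 k kk1; rewrite expr1 in t2; rewrite Sk in t1.
have t3 : (ep * n%:R ^+ 2)^-1 * (\sum_s PS mu theta1 S s * outside_sum mu S s ^+ 2) <= ep.
  rewrite ler_pdivrMl ?mulr_gt0 ?exprn_gt0//.
  apply: (le_trans (outside_sum_moment mu theta1 S)).
  have : 16 / ep ^+ 2 <= n%:R.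
    rewrite (le_trans (ltW (truncnS_gt _)))// ler_nat (leq_trans _ kn)//.
  rewrite ler_pdivrMr ?exprn_gt0// => h.
  have := ler_wpM2l (ltW np) h; move: (n%:R) => x; lra.
rewrite e4; have := le_trans t1 t2.
by move: (\sum_s _ * _%:R) (_ * \sum_s _) t3 => y z; lra.
Qed.

End mean_test_alternative.

(** * Asymptotic power *)

Section power.
Context {R : realType} (mu : probability (measurableTypeR R) R) (theta1 : R).

Lemma prod_prob_ge0 n N (p : config n -> R) (B : pred (N.-tuple (config n))) :
  (forall s, 0 <= p s) -> 0 <= prod_prob p B.
Proof. by move=> p0; apply: sumr_ge0 => s _; exact: tuple_weight_ge0. Qed.

Lemma asymptotically_powerful_of_bounds (n N : nat -> nat)
    (psi : forall k, pred ((N k).-tuple (config (n k)))) :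
  (forall e : R, 0 < e -> exists k0 : nat, forall k, (k0 <= k)%N ->
     prod_prob (P0 mu (n := n k)) (psi k) <= e /\
     forall S : {set 'I_(n k)}, #|S| = k ->
       prod_prob (PS mu theta1 S) (predC (psi k)) <= e) ->
  asymptotically_powerful mu theta1 n N psi.
Proof.
move=> H; apply/cvgrPdist_le => e e0.
have e2 : 0 < e / 2 by rewrite divr_gt0.
have [k0 hk] := H _ e2; exists k0 => // k /= k0k; have [h0 hS] := hk k k0k.
rewrite sub0r normrN; set A := [set _ | _ in _].
have null0 := prod_prob_ge0 (psi k) (P0_ge0 mu (n := n k)).
have [supA0 supAe] : 0 <= sup A /\ sup A <= e / 2.
  have [->|/set0P[y Ay]] := eqVneq A set0.
    by rewrite sup0; split => //; exact: ltW.
  have ubA : ubound A (e / 2) by move=> _ [S Sk <-]; exact: hS.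
  split; last by apply: ge_sup => //; exists y.
  apply: (@le_trans _ _ y); last by apply: ub_le_sup => //; exists (e / 2).
  by case: Ay => S _ <-; apply: prod_prob_ge0; exact: PS_ge0.
by rewrite ger0_norm ?addr_ge0//; lra.
Qed.

End power.

Section growth_conditions.
Context {R : realType} (tau : nat).
Local Notation a := ((2 * tau%:R - 1) / (4 * tau%:R - 3) : R).

(** For [tau >= 2] the exponent is below one, so that [k = O(n ^ a)] implies
    [k = o(n)]; for [tau = 1] it does not. *)
Lemma clique_fraction_small (n : nat -> nat) (c : R) : (2 <= tau)%N -> 0 < c ->
  (forall k, (k <= n k)%N) ->
  (fun k : nat => k%:R : R) =O_\oo (fun k : nat => (n k)%:R `^ a : R) ->
  exists k0, forall k, (k0 <= k)%N -> k%:R <= c * (n k)%:R.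
Proof.
move=> tau2 c0 kn /eqOP[M0 [_ hM]].
have t2 : (2 : R) <= tau%:R by rewrite ler_nat.
pose K := `|M0| + 1; have K0 : 0 < K by rewrite ltr_wpDl.
have MK : M0 < K by rewrite ltr_pwDr// ler_norm.
have [N _ hN] := hM K MK.
pose be : R := 1 - a.
have d0 : 0 < 4 * tau%:R - 3 :> R by lra.
have be0 : 0 < be.
  have -> : be = (2 * tau%:R - 2) / (4 * tau%:R - 3) by rewrite /be; field; rewrite gt_eqF.
  by rewrite divr_gt0//; lra.
pose L := (K / c) `^ be^-1.
exists (maxn N (Num.trunc L).+1) => k; rewrite geq_max => /andP[Nk Lk].
have Lk' : L <= k%:R by rewrite (le_trans (ltW (truncnS_gt _)))// ler_nat.
have k0 : 0 < k%:R :> R by rewrite ltr0n (leq_trans _ Lk).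
have n0 : 0 < (n k)%:R :> R by rewrite (lt_le_trans k0)// ler_nat.
have := hN k Nk; rewrite normr_nat ger0_norm ?powR_ge0// => hk.
have Kc : 0 <= K / c by rewrite divr_ge0// ltW.
have h1 : K / c <= (n k)%:R `^ be.
  have -> : K / c = L `^ be by rewrite /L -powRrM mulVf ?powRr1// gt_eqF.
  apply: (@le_trans _ _ (k%:R `^ be)); apply: ge0_ler_powR;
    rewrite ?nnegrE ?powR_ge0 ?ler_nat ?(ltW be0)//.
apply: (le_trans hk); rewrite ler_pdivrMr// in h1.
apply: le_trans (ler_wpM2r (powR_ge0 _ _) h1) _.
rewrite mulrAC -powRD; last by rewrite (gt_eqF n0) implybT.
by rewrite /be subrK powRr1 ?(ltW n0)// mulrC.
Qed.

(** As [pair_scale k] is [k ^ (- 1 / a)], this is the hypothesis raised to the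
    power [1 / a]. *)
Lemma null_scale_small (n : nat -> nat) (eta : R) : (1 <= tau)%N -> 0 < eta ->
  (fun k : nat => (n k)%:R `^ a : R) =o_\oo (fun k : nat => k%:R : R) ->
  exists k0, forall k, (k0 <= k)%N -> (n k)%:R * pair_scale tau k <= eta.
Proof.
move=> tau1 eta0 /eqoP ho.
have t1 : (1 : R) <= tau%:R by rewrite ler1n.
have d0 : 0 < 4 * tau%:R - 3 :> R by lra.
have d1 : 0 < 2 * tau%:R - 1 :> R by lra.
have a0 : 0 < a by rewrite divr_gt0.
have [N _ hN] := ho (eta `^ a) (powR_gt0 _ eta0).
exists N.+1 => k Nk; have := hN k (ltnW Nk).
have k0 : 0 < k%:R :> R by rewrite ltr0n (leq_trans _ Nk).
rewrite /= ger0_norm ?powR_ge0// normr_nat => h.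
have ainv : (a)^-1 = (4 * tau%:R - 3) / (2 * tau%:R - 1) by rewrite invf_div.
have h2 : (n k)%:R <= eta * k%:R `^ a^-1.
  have ia0 : 0 <= a^-1 by rewrite invr_ge0 ltW.
  have := ge0_ler_powR ia0 (_ : _ \in Num.nneg) (_ : _ \in Num.nneg) h.
  rewrite -powRrM divff ?gt_eqF// powRr1// powRM ?powR_ge0 ?(ltW k0)//.
  rewrite -powRrM divff ?gt_eqF// powRr1 ?(ltW eta0)//.
  by apply; rewrite nnegrE ?powR_ge0// mulr_ge0 ?powR_ge0// ltW.
rewrite /pair_scale powRN -ainv ler_pdivrMr ?powR_gt0//.
Qed.

End growth_conditions.

Theorem theorem4p2 (R : realType) (mu : probability (measurableTypeR R) R)
    (theta1 : R) (tau : nat) (xs : R)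
    (mu_int : mu.-integrable setT (EFin \o (fun h : R => h)))
    (theta1_gt0 : 0 < theta1)
    (noncentered : (\int[mu]_h tanh h)%R <> 0)
    (xs_min : forall x : R, x <> xs ->
      free_energy mu theta1 xs < free_energy mu theta1 x)
    (xs_flat : has_flatness (free_energy mu theta1) xs tau) :
  (forall c : R, 0 < c < 1 ->
   exists2 delta0 : R, 0 < delta0 &
   forall delta : R, 0 < delta < delta0 ->
   exists2 C : R, 0 < C &
   forall n m : nat -> nat,
     (forall k, (k <= n k)%N) ->
     (forall k, (1 <= m k)%N) ->
     (fun k : nat => k%:R : R) =O_\oo
       (fun k : nat => (n k)%:R `^ ((2 * tau%:R - 1) / (4 * tau%:R - 3)) : R) ->
     (tau = 1%N -> \forall k \near \oo, k%:R <= c * (n k)%:R) ->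
     (\forall k \near \oo, C * ln (n k)%:R <= (m k)%:R) ->
     asymptotically_powerful mu theta1 n m
       (fun k s => mean_test k s delta))
  /\
  (exists2 tau_delta0 : R, 0 < tau_delta0 &
   forall tau_delta : R, 0 < tau_delta < tau_delta0 ->
   forall n m : nat -> nat,
     (forall k, (k <= n k)%N) ->
     (forall k, (1 <= m k)%N) ->
     (fun k : nat => (n k)%:R `^ ((2 * tau%:R - 1) / (4 * tau%:R - 3)) : R)
       =o_\oo (fun k : nat => k%:R : R) ->
     m k @[k --> \oo] --> \oo ->
     asymptotically_powerful mu theta1 n (fun k => (2 * m k)%N)
       (fun k s => pair_test k tau s tau_delta)).
Proof.
have tau1 : (1 <= tau)%N by case: xs_flat.
have gap : 0 < mean_gap mu theta1 xs.
  rewrite normr_gt0 subr_eq0.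
  exact: (magnetization_separated mu_int theta1_gt0 noncentered xs_flat).
split.
  move=> c /andP[c0 c1]; exists ((1 - c) * mean_gap mu theta1 xs / 2).
    by rewrite divr_gt0// mulr_gt0// subr_gt0.
  move=> delta dd; have /andP[d0 dlt] := dd.
  have d8 : delta <= 8.
    have g2 := mean_gap_le2 mu_int theta1_gt0 xs_flat.
    by move: (mean_gap mu theta1 xs) gap dlt g2 => g g0 dlt g2; nra.
  exists (256 / delta ^+ 2); first by apply: divr_gt0; [rewrite ltr0n|exact: exprn_gt0].
  move=> n m kn m1 hO hc [N _ hm].
  have [k1 hk1] : exists k0, forall k, (k0 <= k)%N -> k%:R <= c * (n k)%:R.
    have [t1|t2] := eqVneq tau 1%N.
      by have [N' _ hN'] := hc t1; exists N' => k; exact: hN'.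
    by apply: (@clique_fraction_small _ tau) => //; rewrite ltn_neqAle eq_sym t2.
  apply: asymptotically_powerful_of_bounds => e e0.
  have [k2 hk2] := mean_test_miss mu_int theta1_gt0 xs_min xs_flat c1 e0 gap.
  exists (maxn (maxn N k1) (maxn k2 (Num.trunc (4 / e)).+1)) => k.
  rewrite !geq_max => /andP[/andP[Nk k1k] /andP[k2k ek]].
  have k0 : (0 < k)%N by exact: leq_trans ek.
  split.
    apply: le_trans (mean_test_null mu (n := n k) (m := m k) _ (m1 k) k0 (kn k) (hm k Nk)) _.
      by rewrite d0.
    rewrite ler_pdivrMr ?ltr0n// mulrC -ler_pdivrMr//.
    by rewrite (le_trans (ltW (truncnS_gt _)))// ler_nat.
  by move=> S Sk; apply: hk2 => //; exact: hk1.
have [t1|t2] := eqVneq tau 1%N.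
  (* the growth condition would force k <= n = o(k) *)
  exists 1 => // td _ n m kn m1 ho _; exfalso.
  move/eqoP: ho => /(_ (2^-1)); rewrite invr_gt0 => /(_ (ltr0Sn _ _)).
  move=> [N _ hN]; have := hN N.+1 (leqnSn N).
  rewrite t1 mulr1 (_ : (2 - 1) / (4 * 1 - 3) = 1 :> R); last by field.
  rewrite /= powRr1// !normr_nat => h.
  have : (N.+1%:R : R) <= (n N.+1)%:R by rewrite ler_nat.
  have : 0 < N.+1%:R :> R by rewrite ltr0n.
  by lra.
have tau2 : (2 <= tau)%N by rewrite ltn_neqAle eq_sym t2.
have [w [e1 [k0 [w0 e10 hsep]]]] :=
  pair_statistic_separation mu_int theta1_gt0 noncentered xs_min xs_flat tau2.
exists (w / 2); first by rewrite divr_gt0.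
move=> td /andP[td0 tdw] n m kn m1 ho hm.
apply: asymptotically_powerful_of_bounds => e e0.
have [k1 hk1] := null_scale_small tau1 e10 ho.
have etd : 0 < e * td / 64 by rewrite divr_gt0// mulr_gt0.
have [k2 hk2] := null_scale_small tau1 etd ho.
have [k3 _ hk3] := (cvgnyPge m).1 hm (Num.trunc (2 / (w * e))).+1.
exists (maxn (maxn k0 k1) (maxn k2 (maxn k3 1))) => k.
rewrite !geq_max => /andP[/andP[k0k k1k] /andP[k2k /andP[k3k kpos]]].
split.
  apply: le_trans (pair_test_null mu tau (n k) k td0 (m1 k)) _.
  rewrite ler_pdivrMr//; have := hk2 k k2k; move: (_ * pair_scale _ _) => y.
  by lra.
move=> S Sk.
have := hsep (n k) S; rewrite Sk => /(_ k0k kpos (hk1 k k1k)) hE.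
apply: le_trans (pair_test_miss td _ (m1 k) hE) _; first exact: PS_ge0.
have mk : 2 / (w * e) <= (m k)%:R.
  by rewrite (le_trans (ltW (truncnS_gt _)))// ler_nat; exact: hk3.
have we : 0 < w * e by rewrite mulr_gt0.
rewrite ler_pdivrMr// in mk.
have mp : 0 < (m k)%:R :> R by rewrite ltr0n.
pose y := (m k)%:R * (w / 2).
have y0 : 0 < y by rewrite mulr_gt0// divr_gt0.
have -> : e = e^-1^-1 by rewrite invrK.
apply: (@le_trans _ _ (expR (- y))).
  by rewrite ler_expR -mulrN ler_wpM2l// ?ltW//; lra.
rewrite expRN lef_pV2 ?posrE ?expR_gt0 ?invr_gt0//.
apply: le_trans (expR_ge1Dx y); rewrite -[e^-1]mulr1 ler_pdivrMl//.
rewrite /y; move: ((m k)%:R) mk mp e0 => M mk mp e0.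
have -> : e * (1 + M * (w / 2)) = e + M * (w * e) / 2 by field.
by lra.
Qed.
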